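(* Assume that $\Omega$ satisfies the Boundary Regularity Condition. For $\varepsilon\in(0,1)$ let $u_\varepsilon$ denote the unique continuous solution on $\overline\Omega_\varepsilon$ of the dynamic programming principle $u_\varepsilon=T_\varepsilon u_\varepsilon$ with continuous boundary function $F$. Then there are a function $u:\overline\Omega\to\mathbb R$ and a sequence $\varepsilon_i\to0$ such that $u_{\varepsilon_i}$ converges uniformly to $u$ on $\overline\Omega$, and $u$ is a viscosity solution in $\Omega$ of the normalized $p(x)$-Laplace equation $\Delta^N_{p(x)}u=0$ with boundary data $F$ (i.e. $u=F$ on $\partial\Omega$).
   Context: $n\ge 2$ is an integer and $\Omega\subset\mathbb R^n$ is a bounded domain. For $\varepsilon>0$ put $I_\varepsilon=\{x\in\Omega:\operatorname{dist}(x,\partial\Omega)<\varepsilon\}$, $O_\varepsilon=\{x\in\mathbb R^n\setminus\overline\Omega:\operatorname{dist}(x,\partial\Omega)<\varepsilon\}$, $\Omega_\varepsilon=\overline\Omega\cup O_\varepsilon$, $\overline\Omega_\varepsilon$ its closure, and $\Gamma_{\varepsilon,\varepsilon}=\overline{I_\varepsilon}\cup\overline{O_\varepsilon}$. $F:\Gamma_{1,1}\to\mathbb R$ is a fixed continuous function, and for $\varepsilon<1$ its restriction to $\Gamma_{\varepsilon,\varepsilon}\subset\Gamma_{1,1}$ is used. Let $\delta:\overline\Omega_\varepsilon\to[0,1]$ be $\delta(x)=0$ for $x\in\Omega\setminus I_\varepsilon$, $\delta(x)=1-\varepsilon^{-1}\operatorname{dist}(x,\partial\Omega)$ for $x\in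 I_\varepsilon$, and $\delta(x)=1$ for $x\in\overline{O_\varepsilon}\cup\partial\Omega$. Let $p:\overline\Omega\to\mathbb R$ be continuous with $1<\inf_\Omega p\le\sup_\Omega p<\infty$, and set $\alpha(x)=\frac{p(x)-1}{p(x)+n}$, $\beta(x)=1-\alpha(x)=\frac{n+1}{p(x)+n}$ for $x\in\overline\Omega$. For $\nu\ne0$ let $B_\varepsilon^\nu=\{z\in\mathbb R^n:|z|<\varepsilon,\ \langle z,\nu\rangle=0\}$, let $\mathcal L^{n-1}$ be $(n-1)$-dimensional Lebesgue measure, and put $$W(u;x,\nu)=\alpha(x)u(x+\nu)+\beta(x)\frac1{\mathcal L^{n-1}(B_\varepsilon^\nu)}\int_{B_\varepsilon^\nu}u(x+h)\,d\mathcal L^{n-1}(h),$$ $$T_\varepsilon u(x)=\frac{1-\delta(x)}2\Big[\sup_{|\nu|=\varepsilon}W(u;x,\nu)+\inf_{|\nu|=\varepsilon}W(u;x,\nu)\Big]+\delta(x)F(x),$$ with the conventions $T_\varepsilon u(x)=F(x)$ for $x\in\overline\Omega_\varepsilon\setminus\overline\Omega$ and $\delta(x)F(x)=0$ for $x\in\Omega\setminus I_\varepsilon$. For each $\varepsilon$ there is a unique continuous $u_\varepsilon:\overline\Omega_\varepsilon\to\mathbb R$ with $u_\varepsilon=T_\varepsilon u_\varepsilon$. Boundary Regularity Condition: there are universal constants $r_0,s\in(0,1)$ such that for all $r\in(0,r_0]$ and $y\in\partial\Omega$ there exists a ball $B_{sr}(z)\subset B_r(y)\setminus\Omega$ for some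 $z\in B_r(y)\setminus\Omega$ (open balls in $\mathbb R^n$). Normalized $p(x)$-Laplacian: $\Delta^N_{p(x)}u(x)=\Delta u(x)+(p(x)-2)\Delta^N_\infty u(x)$ with $\Delta_\infty^Nu=|\nabla u|^{-2}\sum_{i,j=1}^nu_{x_ix_j}u_{x_i}u_{x_j}$. For $h\in\mathbb R^n\setminus\{0\}$ and symmetric $X$, let $\mathbb F_{p(x)}(x,h,X)=\operatorname{trace}(X)-\sum_{i,j}\frac{h_ih_j}{|h|^2}X_{ij}+(p(x)-1)\sum_{i,j}\frac{h_ih_j}{|h|^2}X_{ij}$; $\lambda_{\min}(X)$, $\lambda_{\max}(X)$ denote the smallest and largest eigenvalues of $X$. A continuous $u:\Omega\to\mathbb R$ is a viscosity solution of $\Delta^N_{p(x)}u=0$ if: (i) for all $x\in\Omega$ and $\phi\in C^2$ with $u(x)=\phi(x)$ and $u(y)>\phi(y)$ for $y\neq x$, one has $0\ge\mathbb F_{p(x)}(x,\nabla\phi(x),D^2\phi(x))$ if $\nabla\phi(x)\ne0$, and $0\ge\lambda_{\min}((p(x)-2)D^2\phi(x))+\operatorname{trace}(D^2\phi(x))$ if $\nabla\phi(x)=0$; (ii) for all $x\in\Omega$ and $\phi\in C^2$ with $u(x)=\phi(x)$ and $u(y)<\phi(y)$ for $y\ne x$, one has $0\le\mathbb F_{p(x)}(x,\nabla\phi(x),D^2\phi(x))$ if $\nabla\phi(x)\neq0$, and $0\le\lambda_{\max}((p(x)-2)D^2\phi(x))+\operatorname{trace}(D^2\phi(x))$ if $\nabla\phi(x)=0$.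 *)

(* Defs.v *)
From HB Require Import structures.
From mathcomp Require Import all_boot all_order all_algebra.
From mathcomp Require Import all_classical all_reals all_analysis.
Set Implicit Arguments.
Unset Strict Implicit.
Unset Printing Implicit Defensive.
Import Order.TTheory GRing.Theory Num.Theory.
Import numFieldNormedType.Exports.
Local Open Scope classical_set_scope.
Local Open Scope ring_scope.

Section lebesgue_tuple_cons.
Variables (R : realType) (k : nat).
Local Notation T := (measurableTypeR R).

Definition tcons (z : T * k.-tuple T) : k.+1.-tuple T := [tuple of z.1 :: z.2].

Lemma measurable_tcons : measurable_fun [set: T * k.-tuple T] tcons.
Proof. exact: measurable_cons. Qed.

Variable mu : {sigma_finite_measure set (k.-tuple T) -> \bar R}.

Definition lebesgue_cons : set (k.+1.-tuple T) -> \bar R :=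
  pushforward (lebesgue_measure \x mu)%E tcons.

Let lebesgue_cons0 : lebesgue_cons set0 = 0%E.
Proof. by rewrite /lebesgue_cons /pushforward preimage_set0 measure0. Qed.

Let lebesgue_cons_ge0 A : (0 <= lebesgue_cons A)%E.
Proof. exact: (measure_ge0 (lebesgue_measure \x mu)%E). Qed.

Let lebesgue_cons_sigma_additive : semi_sigma_additive lebesgue_cons.
Proof.
move=> F mF tF mUF; rewrite /lebesgue_cons /pushforward preimage_bigcup.
have mp A : measurable A -> measurable (tcons @^-1` A).
  by move=> mA; rewrite -[X in measurable X]setTI; exact: measurable_tcons.
apply: (@measure_semi_sigma_additive _ _ _ (lebesgue_measure \x mu)%E).
- by move=> n; exact: mp.
- apply/trivIsetP => /= i j _ _ ij; rewrite -preimage_setI.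
  by move/trivIsetP : tF => /(_ _ _ _ _ ij) ->//; rewrite preimage_set0.
- by rewrite -preimage_bigcup; exact: mp.
Qed.

HB.instance Definition _ := isMeasure.Build _ _ _ lebesgue_cons
  lebesgue_cons0 lebesgue_cons_ge0 lebesgue_cons_sigma_additive.

Let lebesgue_cons_sigma_finite : sigma_finite setT lebesgue_cons.
Proof.
have /sigma_finiteP[F [TF ndF Foo]] := sigma_finiteT (@lebesgue_measure R).
have /sigma_finiteP[G [TG ndG Goo]] := sigma_finiteT mu.
pose g (t : k.+1.-tuple T) : T * k.-tuple T := (thead t, [tuple of behead t]).
have mg : measurable_fun setT g.
  apply/measurable_fun_pairP; split.
  - exact: measurable_tnth.
  - exact: measurable_behead.
have gK : cancel tcons g.
  by move=> [x t]; rewrite /g /tcons /= theadE; congr pair; exact: val_inj.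
exists (fun i => g @^-1` (F i `*` G i)).
  apply/esym; rewrite -subTset => t _.
  have : [set: T] (g t).1 by []. rewrite TF => -[i _ Fi].
  have : [set: k.-tuple T] (g t).2 by []. rewrite TG => -[j _ Gj].
  exists (maxn i j) => //; split.
  - by move: Fi; exact/subsetPset/ndF/leq_maxl.
  - by move: Gj; exact/subsetPset/ndG/leq_maxr.
move=> i; have [mF Fi] := Foo i; have [mG Gi] := Goo i; split.
  by rewrite -[X in measurable X]setTI; apply: mg => //; exact: measurableX.
rewrite /lebesgue_cons /pushforward (_ : _ @^-1` _ = F i `*` G i).
  by rewrite product_measure1E// lte_mul_pinfty// ge0_fin_numE.
by apply/funext => z; exact: (congr1 (F i `*` G i) (gK z)).
Qed.

HB.instance Definition _ := Measure_isSigmaFinite.Build _ _ _ lebesgue_cons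
  lebesgue_cons_sigma_finite.

End lebesgue_tuple_cons.

Fixpoint lebesgue_tuple (R : realType) (k : nat) :
    {sigma_finite_measure set (k.-tuple (measurableTypeR R)) -> \bar R} :=
  if k is k'.+1 then lebesgue_cons (lebesgue_tuple R k')
  else \d_([tuple] : 0.-tuple (measurableTypeR R)).

Lemma lebesgue_tuple_box (R : realType) (k : nat)
    (A : 'I_k -> set (measurableTypeR R)) (mA : forall i, measurable (A i)) :
  lebesgue_tuple R k [set t | forall i, A i (tnth t i)] =
  (\prod_(i < k) lebesgue_measure (A i))%E.
Proof.
elim: k A mA => [|k IH] A mA.
  rewrite big_ord0 /= diracE (_ : _ \in _ = true)//; apply/mem_set => -[]//.
rewrite big_ord_recl -IH//.
rewrite -product_measure1E//=.
  rewrite /lebesgue_cons /pushforward; congr (product_measure1 _ _ _).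
  apply/seteqP; split=> -[x t] /=.
    move=> h; split; first by have := h ord0.
    by move=> i; have := h (lift ord0 i); rewrite tnthS.
  move=> [Ax At] i; case: (unliftP ord0 i) => [j ->|->]//.
  by rewrite tnthS; apply: At.
rewrite (_ : [set t | _] = \bigcap_(i in [set: 'I_k]) 
   ((@tnth _ _ ^~ i) @^-1` A (lift ord0 i))).
  apply: fin_bigcap_measurable => // i _.
  by rewrite -[X in measurable X]setTI; exact: measurable_tnth.
by apply/seteqP; split => t h i => [_|]; exact: h.
Qed.

Section domain.
Variables (R : realType) (n : nat).
Implicit Types (x y z h nu : 'rV[R]_n) (A Omega : set 'rV[R]_n).
Implicit Types (p F u phi : 'rV[R]_n -> R) (eps r : R).

(* The topology of 'rV[R]_n is the usual one, but its library norm `|x| and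
   library balls are those of the sup norm, hence the Euclidean versions. *)
Definition dotv x y : R := \sum_i x 0 i * y 0 i.

Definition enorm x : R := Num.sqrt (dotv x x).

Definition eball x r : set 'rV[R]_n := [set y | enorm (y - x) < r].

Definition edist x A : R := inf [set enorm (x - y) | y in A].

Definition boundary A : set 'rV[R]_n := closure A `\` A°.

Definition domain Omega : Prop :=
  [/\ Omega !=set0, open Omega & connected Omega].

Definition boundary_regular Omega : Prop :=
  exists r0 s : R, [/\ 0 < r0 < 1, 0 < s < 1 &
    forall r y, 0 < r <= r0 -> boundary Omega y ->
      exists2 z, (eball y r `\` Omega) z &
                 eball z (s * r) `<=` eball y r `\` Omega].

Definition inner_strip Omega eps : set 'rV[R]_n :=
  [set x | Omega x /\ edist x (boundary Omega) < eps].

Definition outer_strip Omega eps : set 'rV[R]_n :=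
  [set x | ~ closure Omega x /\ edist x (boundary Omega) < eps].

Definition extended Omega eps : set 'rV[R]_n :=
  closure Omega `|` outer_strip Omega eps.

Definition strip Omega eps : set 'rV[R]_n :=
  closure (inner_strip Omega eps) `|` closure (outer_strip Omega eps).

(* The last branch is used on closure (extended Omega eps) `\` Omega, which
   is the union of the boundary and of the closure of the outer strip. *)
Definition cutoff Omega eps x : R :=
  if x \in Omega then
    if x \in inner_strip Omega eps
    then 1 - eps^-1 * edist x (boundary Omega) else 0
  else 1.

Definition alpha p x : R := (p x - 1) / (p x + n%:R).

Definition beta p x : R := 1 - alpha p x.

(* The rows form an orthonormal basis of the hyperplane orthogonal to nu; such
   a basis exists by [hyperplane_basisP] below. *)
Definition hyperplane_basis nu : 'M[R]_(n.-1, n) :=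
  get [set B : 'M[R]_(n.-1, n) | B *m B^T = 1%:M /\ B *m nu^T = 0].

Definition hyperplane_point nu (t : n.-1.-tuple (measurableTypeR R)) :
  'rV[R]_n := (\row_i tnth t i) *m hyperplane_basis nu.

(* (n-1)-dimensional Lebesgue measure and integral on the hyperplane orthogonal
   to nu, carried over from R^(n-1) by the linear isometry
   [hyperplane_point nu]; by rotation invariance of Lebesgue measure they do
   not depend on the choice of the orthonormal basis. *)
Definition hyperplane_measure nu (S : set 'rV[R]_n) : \bar R :=
  lebesgue_tuple R n.-1 (hyperplane_point nu @^-1` S).

Definition hyperplane_integral nu (S : set 'rV[R]_n) (f : 'rV[R]_n -> R) : R :=
  \int[lebesgue_tuple R n.-1]_(t in hyperplane_point nu @^-1` S)
    f (hyperplane_point nu t).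

Definition hyperplane_ball eps nu : set 'rV[R]_n :=
  [set z | enorm z < eps /\ dotv z nu = 0].

Definition tug_value p eps u x nu : R :=
  alpha p x * u (x + nu) +
  beta p x * ((fine (hyperplane_measure nu (hyperplane_ball eps nu)))^-1 *
    hyperplane_integral nu (hyperplane_ball eps nu) (fun h => u (x + h))).

Definition dpp_operator Omega p F eps u x : R :=
  if x \in closure Omega then
    (1 - cutoff Omega eps x) / 2 *
      (sup [set tug_value p eps u x nu | nu in [set nu | enorm nu = eps]] +
       inf [set tug_value p eps u x nu | nu in [set nu | enorm nu = eps]]) +
    cutoff Omega eps x * F x
  else F x.

Definition dpp_solution Omega p F eps u : Prop :=
  {within closure (extended Omega eps), continuous u} /\
  forall x, closure (extended Omega eps) x ->
    u x = dpp_operator Omega p F eps u x.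

Definition partial (i : 'I_n) phi x : R := 'D_(delta_mx 0 i) phi x.

Definition gradient phi x : 'rV[R]_n := \row_i partial i phi x.

Definition hessian phi x : 'M[R]_n :=
  \matrix_(i, j) partial j (partial i phi) x.

Definition C2_on Omega phi : Prop :=
  forall x, Omega x ->
  [/\ {for x, continuous phi},
      forall i, derivable phi x (delta_mx 0 i) /\
                {for x, continuous (partial i phi)} &
      forall i j, derivable (partial i phi) x (delta_mx 0 j) /\
                  {for x, continuous (partial j (partial i phi))}].

Definition lambda_min (X : 'M[R]_n) : R := inf [set a | eigenvalue X a].

Definition lambda_max (X : 'M[R]_n) : R := sup [set a | eigenvalue X a].

Definition Fp p x h (X : 'M[R]_n) : R :=
  \tr X - \sum_i \sum_j h 0 i * h 0 j / enorm h ^+ 2 * X i j +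
  (p x - 1) * \sum_i \sum_j h 0 i * h 0 j / enorm h ^+ 2 * X i j.

Definition viscosity_super Omega p u : Prop :=
  forall x phi, Omega x -> C2_on Omega phi -> u x = phi x ->
    (forall y, Omega y -> y != x -> phi y < u y) ->
  if gradient phi x == 0 then
    lambda_min ((p x - 2) *: hessian phi x) + \tr (hessian phi x) <= 0
  else Fp p x (gradient phi x) (hessian phi x) <= 0.

Definition viscosity_sub Omega p u : Prop :=
  forall x phi, Omega x -> C2_on Omega phi -> u x = phi x ->
    (forall y, Omega y -> y != x -> u y < phi y) ->
  if gradient phi x == 0 then
    0 <= lambda_max ((p x - 2) *: hessian phi x) + \tr (hessian phi x)
  else 0 <= Fp p x (gradient phi x) (hessian phi x).

Definition viscosity_solution Omega p u : Prop :=
  [/\ {within Omega, continuous u},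
      viscosity_super Omega p u & viscosity_sub Omega p u].

End domain.

Lemma hyperplane_basisP (R : realType) (n : nat) (nu : 'rV[R]_n) : nu != 0 ->
  hyperplane_basis nu *m (hyperplane_basis nu)^T = 1%:M /\
  hyperplane_basis nu *m nu^T = 0.
Proof.
move=> nu0; apply: (@getPex _ [set B : 'M[R]_(n.-1, n) | B *m B^T = 1%:M /\ B *m nu^T = 0]).
case: n nu nu0 => [|n] nu nu0.
  by move: nu0; rewrite (_ : nu = 0) ?eqxx//; apply/rowP => -[].
have nn : 0 < dotv nu nu.
  have [i nui] : exists i, nu 0 i != 0.
    by apply/existsP; move: nu0; apply: contraNT; rewrite negb_exists =>
      /forallP h; apply/eqP/rowP => i; rewrite mxE; apply/eqP; rewrite -[_ == _]negbK.
  rewrite /dotv (bigD1 i)//= ltr_pwDl ?sumr_ge0//.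
  - by rewrite -expr2 exprn_even_gt0.
  - by move=> j _; rewrite -expr2 sqr_ge0.
pose w : 'rV[R]_n.+1 := (enorm nu)^-1 *: nu.
have dE (a b : 'rV[R]_n.+1) : a *m b^T = (dotv a b)%:M.
  by apply/matrixP => i j; rewrite !mxE !ord1 eqxx mulr1n; apply: eq_bigr => k _; rewrite mxE.
have dC (a b : 'rV[R]_n.+1) : dotv a b = dotv b a.
  by apply: eq_bigr => i _; rewrite mulrC.
have dBl (a b c : 'rV[R]_n.+1) : dotv (a - b) c = dotv a c - dotv b c.
  by rewrite -sumrB; apply: eq_bigr => i _; rewrite !mxE mulrBl.
have ww : dotv w w = 1.
  rewrite /dotv (eq_bigr (fun i => (enorm nu)^-2 * (nu 0 i * nu 0 i))); last first.
    by move=> i _; rewrite !mxE mulrACA -expr2 exprVn.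
  rewrite -mulr_sumr -/(dotv nu nu) /enorm sqr_sqrtr ?ltW// mulVf ?gt_eqF//.
pose e : 'rV[R]_n.+1 := delta_mx 0 0.
have ee : dotv e e = 1.
  rewrite /dotv (bigD1 0)//= big1 ?addr0; last by move=> i i0; rewrite !mxE (negPf i0) !mul0r.
  by rewrite !mxE !eqxx mulr1.
pose v := w - e.
suff [H [HH HE]] : exists H : 'M[R]_n.+1, H *m H^T = 1%:M /\ H *m w^T = e^T.
  exists (row' 0 H); split.
    apply/matrixP => i j; move/matrixP : HH => /(_ (lift 0 i) (lift 0 j)).
    rewrite !mxE (inj_eq lift_inj) => <-.
    by apply: eq_bigr => k _; rewrite !mxE.
  have -> : nu = enorm nu *: w.
    rewrite scalerA mulfV ?scale1r// gt_eqF//. 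
    by rewrite sqrtr_gt0.
  apply/matrixP => i j; rewrite linearZ/= -scalemxAr.
  rewrite mxE; move/matrixP : HE => /(_ (lift 0 i) j).
  rewrite !mxE /= => HEij.
  under eq_bigr do rewrite mxE.
  by rewrite HEij andbF mulr0.
have [v0|v0] := eqVneq v 0.
  exists 1%:M; rewrite trmx1 !mul1mx; split => //.
  by move/eqP : v0; rewrite subr_eq0 => /eqP ->.
have vv : dotv v v != 0.
  apply: contra v0 => /eqP vv; apply/eqP/rowP => i; rewrite [RHS]mxE; apply/eqP.
  move: vv => /eqP; rewrite psumr_eq0; last by move=> j _; rewrite -expr2 sqr_ge0.
  by move=> /allP/(_ i (mem_index_enum _)) /=; rewrite mulf_eq0 orbb.
have vE : dotv v v = 2 * dotv v w.
  rewrite {1}/v dBl (dC w) (dC e) /v !dBl (dC e w) ww ee opprB.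
  by rewrite -mulr2n mulr_natl.
have dd : dotv v v / dotv v v = 1 by rewrite mulfV.
pose M := v^T *m v; pose c := 2 / dotv v v.
have MT : M^T = M by rewrite trmx_mul trmxK.
have MM : M *m M = dotv v v *: M.
  by rewrite -mulmxA (mulmxA v) dE mul_scalar_mx -scalemxAr.
have cE : c * (c * dotv v v) = c * 2 by rewrite /c divfK.
have HT : (1%:M - c *: M)^T = 1%:M - c *: M.
  by rewrite [LHS]raddfB /= trmx1 [X in _ - X]linearZ /= MT.
exists (1%:M - c *: M); split.
  rewrite HT mulmxBl mul1mx mulmxBr mulmx1 -scalemxAl -scalemxAr MM !scalerA.
  by rewrite -mulrA cE mulr_natr mulr2n scalerDl opprB addrK subrK.
rewrite mulmxBl mul1mx -scalemxAl -mulmxA dE mul_mx_scalar scalerA /c.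
rewrite -mulrA (mulrC _ (dotv v w)) mulrA -vE dd scale1r.
by rewrite /v linearB /= subKr.
Qed.

(* Main.v *)
(* The family u_eps is asymptotically equicontinuous up to the boundary. At the
   boundary, exp(-k |x - z|^2), centred in an exterior ball supplied by the
   regularity condition, is a strict barrier for the dynamic programming principle,
   so the oscillation of u_eps decays geometrically along a sequence of scales. In
   the interior, u_eps(x) - u_eps(z) is compared with
   J + C |x - z|^(1/2) - K exp(- lam |x - z| / eps): the two steps are coupled by
   reflecting the hyperplane balls into each other, one of the players reacts to the
   near-optimal direction of the opponent, and concavity of the comparison function
   makes the difference decrease on average. An Arzela-Ascoli argument along an
   ultrafilter finer than eps -> 0+ then produces the limit u.

   If phi touches u strictly from below at x0, then u_eps - phi has local minima at
   points converging to x0. Inserting the second-order expansion of phi into the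
   dynamic programming principle, with the near-optimal direction nu of the
   minimizing player answered by -nu and by the gradient direction, gives unit
   vectors nu with (p(x0) - 2) <X nu, nu> + tr X <= o(1) and
   <grad phi, nu> <= -|grad phi| + o(1), that is, the supersolution inequality. *)
Require Import Defs.
From HB Require Import structures.
From mathcomp Require Import all_boot all_order all_algebra.
From mathcomp Require Import all_classical all_reals all_analysis.
From mathcomp Require Import measurable_realfun perm.
From mathcomp Require Import ring lra.
Set Implicit Arguments.
Unset Strict Implicit.
Unset Printing Implicit Defensive.
Import Order.TTheory GRing.Theory Num.Theory.
Import numFieldNormedType.Exports.
Local Open Scope classical_set_scope.
Local Open Scope ring_scope.

(** * Euclidean geometry of row vectors *)

Section euclid.
Variables (R : realType) (n : nat).
Implicit Types (x y z w : 'rV[R]_n).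

(** No modulus of continuity below scale [e] is derived for a solution: the players move by exactly
    [e], and the mean is taken over a hyperplane that they choose. The comparison function therefore
    jumps at the origin; the jump [J] absorbs what happens below that scale, and equicontinuity is
    claimed only for small [e]. Two obstacles shape the coupling. The hyperplanes at the two points
    depend on the chosen directions, and [alpha] differs between the points, so that one point may
    be moved by a player while the other moves at random. The costs are affordable because [alpha]
    is bounded below by some a0 > 0 and is nearly constant at small distances. Every estimate on the
    half-sum of sup and inf is made by pairing: one direction is near-optimal for its player, the
    other is a reply chosen freely, so that only sums of two tug values occur. The Lebesgue side
    reduces to two facts, rotation invariance and the second moment of a ball. In dimension n - 1
    the latter is e^2 / (n + 1) per coordinate, which is the reason for the value of [alpha]. *)

Lemma dotvC x y : dotv x y = dotv y x.
Proof. by apply: eq_bigr => i _; rewrite mulrC. Qed.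

Lemma dotvDl x y z : dotv (x + y) z = dotv x z + dotv y z.
Proof. by rewrite -big_split; apply: eq_bigr => i _; rewrite mxE mulrDl. Qed.

Lemma dotvDr x y z : dotv z (x + y) = dotv z x + dotv z y.
Proof. by rewrite !(dotvC z) dotvDl. Qed.

Lemma dotvZl a x y : dotv (a *: x) y = a * dotv x y.
Proof. by rewrite mulr_sumr; apply: eq_bigr => i _; rewrite mxE mulrA. Qed.

Lemma dotvZr a x y : dotv x (a *: y) = a * dotv x y.
Proof. by rewrite dotvC dotvZl dotvC. Qed.

Lemma dotvNl x y : dotv (- x) y = - dotv x y.
Proof. by rewrite -scaleN1r dotvZl mulN1r. Qed.

Lemma dotvNr x y : dotv x (- y) = - dotv x y.
Proof. by rewrite dotvC dotvNl dotvC. Qed.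

Lemma dotv0l x : dotv 0 x = 0.
Proof. by rewrite -(scale0r x) dotvZl mul0r. Qed.

Lemma dotv0r x : dotv x 0 = 0.
Proof. by rewrite dotvC dotv0l. Qed.

Definition dotvE := (dotvDl, dotvDr, dotvNl, dotvNr, dotvZl, dotvZr).

Lemma dotvv_ge0 x : 0 <= dotv x x.
Proof. by apply: sumr_ge0 => i _; rewrite -expr2 sqr_ge0. Qed.

Lemma dotvv_eq0 x : (dotv x x == 0) = (x == 0).
Proof.
apply/idP/eqP => [|->]; last by rewrite dotv0l.
rewrite psumr_eq0 => [/allP h|i _]; last by rewrite -expr2 sqr_ge0.
apply/rowP => i; rewrite mxE; have := h i (mem_index_enum _).
by rewrite /= -expr2 sqrf_eq0 => /eqP.
Qed.

Lemma mul_trmx_dotv x y : x *m y^T = (dotv x y)%:M.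
Proof.
apply/matrixP => i j; rewrite !mxE !ord1 eqxx mulr1n.
by apply: eq_bigr => k _; rewrite mxE.
Qed.

Lemma enorm_ge0 x : 0 <= enorm x.
Proof. exact: sqrtr_ge0. Qed.

Lemma sqr_enorm x : enorm x ^+ 2 = dotv x x.
Proof. by rewrite sqr_sqrtr// dotvv_ge0. Qed.

Lemma enorm_eq0 x : (enorm x == 0) = (x == 0).
Proof. by rewrite -dotvv_eq0 -sqr_enorm sqrf_eq0. Qed.

Lemma enorm_gt0 x : (0 < enorm x) = (x != 0).
Proof. by rewrite lt_def enorm_ge0 andbT enorm_eq0. Qed.

Lemma enorm0 : enorm (0 : 'rV[R]_n) = 0.
Proof. by apply/eqP; rewrite enorm_eq0. Qed.

Lemma enormZ a x : enorm (a *: x) = `|a| * enorm x.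
Proof. by rewrite /enorm !dotvE mulrA -expr2 sqrtrM ?sqr_ge0// sqrtr_sqr. Qed.

Lemma enormN x : enorm (- x) = enorm x.
Proof. by rewrite -scaleN1r enormZ normrN1 mul1r. Qed.

Lemma enormB x y : enorm (x - y) = enorm (y - x).
Proof. by rewrite -enormN opprB. Qed.

Lemma enorm_le_sqr x r : 0 <= r -> (enorm x <= r) = (dotv x x <= r ^+ 2).
Proof. by move=> r0; rewrite -sqr_enorm ler_pXn2r// nnegrE enorm_ge0. Qed.

Lemma enorm_lt_sqr x r : 0 <= r -> (enorm x < r) = (dotv x x < r ^+ 2).
Proof. by move=> r0; rewrite -sqr_enorm ltr_pXn2r// nnegrE enorm_ge0. Qed.

Lemma dotv_le x y : dotv x y <= enorm x * enorm y.
Proof.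
have [->|x0] := eqVneq x 0; first by rewrite dotv0l enorm0 mul0r.
have [->|y0] := eqVneq y 0; first by rewrite dotv0r enorm0 mulr0.
have a0 : 0 < enorm x by rewrite enorm_gt0.
have b0 : 0 < enorm y by rewrite enorm_gt0.
have := dotvv_ge0 (enorm y *: x - enorm x *: y).
rewrite !dotvE -!sqr_enorm (dotvC y x).
set a := enorm x in a0 *; set b := enorm y in b0 *; set d := dotv x y => h.
have h2 : 0 <= (a * b) * (2 * (a * b - d)) by move: h; nra.
by move: h2; rewrite pmulr_rge0 ?mulr_gt0//; lra.
Qed.

Lemma normr_dotv_le x y : `|dotv x y| <= enorm x * enorm y.
Proof.
by rewrite ler_norml dotv_le andbT lerNl -dotvNl (le_trans (dotv_le _ _))// enormN.
Qed.

Lemma ler_enormD x y : enorm (x + y) <= enorm x + enorm y.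
Proof.
rewrite enorm_le_sqr ?addr_ge0 ?enorm_ge0// !dotvE -!sqr_enorm (dotvC y x).
by have := dotv_le x y; nra.
Qed.

Lemma ler_enormB x y : enorm (x - y) <= enorm x + enorm y.
Proof. by rewrite (le_trans (ler_enormD _ _))// enormN. Qed.

Lemma ler_enorm_dist x y z : enorm (x - z) <= enorm (x - y) + enorm (y - z).
Proof. by rewrite (le_trans _ (ler_enormD _ _))// addrA subrK. Qed.

Lemma norm_coord_le x i : `|x 0 i| <= `|x|.
Proof. by rewrite [leRHS]/Num.norm /= mx_normrE; apply/bigmax_geP; right => /=; exists (0, i). Qed.

Lemma norm_coord_le_enorm x i : `|x 0 i| <= enorm x.
Proof.
rewrite -(@ler_pXn2r _ 2)// ?nnegrE ?enorm_ge0// sqr_enorm real_normK ?num_real//.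
by rewrite /dotv (bigD1 i)//= expr2 lerDl sumr_ge0// => j _; rewrite -expr2 sqr_ge0.
Qed.

Lemma norm_le_enorm x : `|x| <= enorm x.
Proof.
rewrite [leLHS]/Num.norm /= mx_normrE; apply/bigmax_leP; split; first exact: enorm_ge0.
by move=> [i j] _; rewrite ord1 norm_coord_le_enorm.
Qed.

Lemma sum_norm_ge0 x : 0 <= \sum_i `|x 0 i|.
Proof. by apply: sumr_ge0. Qed.

Lemma enorm_le_sum x : enorm x <= \sum_i `|x 0 i|.
Proof.
rewrite enorm_le_sqr ?sum_norm_ge0// expr2 mulr_suml ler_sum// => i _.
apply: (@le_trans _ _ (`|x 0 i| * `|x 0 i|)); first by rewrite -normrM ler_norm.
by rewrite ler_wpM2l// (bigD1 i)//= lerDl sumr_ge0.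
Qed.

Lemma enorm_le_norm x : enorm x <= n%:R * `|x|.
Proof.
apply: (le_trans (enorm_le_sum x)).
rewrite -[X in X%:R]card_ord -sum1_card natr_sum mulr_suml ler_sum// => i _.
by rewrite mul1r norm_coord_le.
Qed.

Lemma nbhs_eball x r : 0 < r -> nbhs x (eball x r).
Proof.
move=> r0; apply/nbhs_ballP; exists (r / n.+1%:R) => /=; first by rewrite divr_gt0.
move=> y; rewrite -ball_normE/= => h; rewrite /eball/= enormB.
apply: (le_lt_trans (enorm_le_norm _)).
apply: (@le_lt_trans _ _ (n.+1%:R * `|x - y|)).
  by rewrite ler_wpM2r// ler_nat.
by rewrite mulrC -ltr_pdivlMr.
Qed.

Lemma nbhs_eballP x (A : set 'rV[R]_n) :
  nbhs x A <-> exists2 r, 0 < r & eball x r `<=` A.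
Proof.
split=> [/nbhs_ballP[r /= r0 rA]|[r r0 rA]].
  exists r => // y xy; apply: rA; rewrite -ball_normE/= distrC.
  exact: le_lt_trans (norm_le_enorm _) xy.
by apply: filterS rA _; exact: nbhs_eball.
Qed.

Lemma closure_eballP (A : set 'rV[R]_n) x :
  closure A x <-> forall r, 0 < r -> exists2 y, A y & enorm (y - x) < r.
Proof.
split=> [cA r r0|h B /nbhs_eballP[r r0 rB]].
  by have [y [Ay xy]] := cA _ (nbhs_eball x r0); exists y.
by have [y Ay xy] := h _ r0; exists y; split => //; apply: rB.
Qed.

End euclid.

(** * Continuity of Euclidean expressions on row vectors *)

Section euclid_continuity.
Variable R : realType.

Lemma lipschitz_continuous_rV (m n : nat) (f : 'rV[R]_m -> 'rV[R]_n) (C : R) :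
  (forall x y, enorm (f x - f y) <= C * enorm (x - y)) -> continuous f.
Proof.
move=> fC x B /nbhs_eballP[e e0 eB].
pose D := `|C| + 1.
have D0 : 0 < D by rewrite ltr_wpDl.
apply/nbhs_eballP; exists (e / D); rewrite ?divr_gt0// => y.
rewrite /eball/= ltr_pdivlMr// => xy; apply: eB; rewrite /eball/=.
apply: (le_lt_trans (fC _ _)).
apply: le_lt_trans xy; rewrite mulrC ler_wpM2l ?enorm_ge0//.
by rewrite /D (le_trans (ler_norm _))// lerDl.
Qed.

Lemma continuousT_comp (S T U : topologicalType) (f : S -> T) (g : T -> U) :
  continuous f -> continuous g -> continuous (fun x => g (f x)).
Proof. by move=> cf cg x; apply: continuous_comp; [exact: cf|exact: cg]. Qed.

Section continuousT_real.
Variables (T : topologicalType) (f g : T -> R).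
Hypotheses (cf : continuous f) (cg : continuous g).

Lemma continuousT_add : continuous (fun x => f x + g x).
Proof. by move=> x; apply: continuousD; [exact: cf|exact: cg]. Qed.

Lemma continuousT_opp : continuous (fun x => - f x).
Proof. by move=> x; apply: continuousN; exact: cf. Qed.

Lemma continuousT_sub : continuous (fun x => f x - g x).
Proof. by move=> x; apply: continuousB; [exact: cf|exact: cg]. Qed.

Lemma continuousT_mul : continuous (fun x => f x * g x).
Proof. by move=> x; apply: (@continuousM _ _ f g); [exact: cf|exact: cg]. Qed.

Lemma continuousT_mull (c : R) : continuous (fun x => c * f x).
Proof. by move=> x; apply: (@continuousM _ _ (fun=> c) f); [exact: cst_continuous|exact: cf]. Qed.

End continuousT_real.

Lemma continuous_coord n (i : 'I_n) : continuous (fun x : 'rV[R]_n => x 0 i).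
Proof. by move=> x; exact: coord_continuous. Qed.

Lemma continuous_sum (T : topologicalType) (I : Type) (r : seq I) (f : I -> T -> R) :
  (forall i, continuous (f i)) -> continuous (fun x => \sum_(i <- r) f i x).
Proof.
move=> cf x; elim: r => [|i r IH].
  rewrite (_ : (fun x => _) = cst 0); first exact: cst_continuous.
  by apply/funext => y; rewrite big_nil.
rewrite (_ : (fun x => _) = (f i \+ (fun x => \sum_(i <- r) f i x))); last first.
  by apply/funext => y; rewrite big_cons.
by apply: continuousD => //; exact: cf.
Qed.

Lemma continuous_dotv (T : topologicalType) n (f g : T -> 'rV[R]_n) :
  continuous f -> continuous g -> continuous (fun t => dotv (f t) (g t)).
Proof.
move=> cf cg; apply: continuous_sum => i x.
have c (h : T -> 'rV[R]_n) : continuous h -> {for x, continuous (fun t => h t 0 i)}.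
  by move=> ch; apply: (@continuous_comp _ _ _ h (fun z : 'rV_n => z 0 i)); [exact: ch|exact: continuous_coord].
by apply: continuousM; exact: c.
Qed.

Lemma continuous_enorm (T : topologicalType) n (f : T -> 'rV[R]_n) :
  continuous f -> continuous (fun t => enorm (f t)).
Proof.
move=> cf x; apply: (@continuous_comp _ _ _ (fun t => dotv (f t) (f t)) Num.sqrt).
  exact: continuous_dotv.
exact: sqrt_continuous.
Qed.

Lemma continuous_mulmx m n (A : 'M[R]_(m, n)) :
  continuous (fun x : 'rV[R]_m => x *m A).
Proof.
apply: (@lipschitz_continuous_rV _ _ _ (\sum_j enorm (row j A))) => x y.
rewrite -mulmxBl; set z := x - y.
rewrite mulmx_sum_row (le_trans (_ : _ <= \sum_j enorm (z 0 j *: row j A)))//.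
  elim/big_rec2 : _ => [|j a b _ h]; first by rewrite enorm0.
  by rewrite (le_trans (ler_enormD _ _))// lerD2l.
rewrite mulr_suml ler_sum// => j _; rewrite enormZ mulrC.
by rewrite ler_wpM2l ?enorm_ge0// norm_coord_le_enorm.
Qed.

End euclid_continuity.

(** * Averages over balls *)

Section tuple_space.
Variables (R : realType) (m : nat).
Local Notation T := (measurableTypeR R).
Local Notation mu := (lebesgue_tuple R m).
Implicit Types (t : m.-tuple T) (x : 'rV[R]_m).

(** Measures live on tuples, topology and linear algebra on row vectors; these two mutually inverse
    maps carry statements across. *)
Definition row_of t : 'rV[R]_m := \row_i tnth t i.

Definition tuple_of_row x : m.-tuple T := [tuple x 0 i | i < m].

Lemma row_ofK : cancel row_of tuple_of_row.
Proof. by move=> t; apply: eq_from_tnth => i; rewrite tnth_mktuple mxE. Qed.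

Lemma tuple_of_rowK : cancel tuple_of_row row_of.
Proof. by move=> x; apply/rowP => i; rewrite mxE tnth_mktuple. Qed.

Lemma measurable_tuple_box (A : 'I_m -> set T) : (forall i, measurable (A i)) ->
  measurable [set t : m.-tuple T | forall i, A i (tnth t i)].
Proof.
move=> mA; rewrite (_ : [set t | _] = \bigcap_(i in [set: 'I_m])
   ((@tnth _ _ ^~ i) @^-1` A i)).
  apply: fin_bigcap_measurable => // i _.
  by rewrite -[X in measurable X]setTI; exact: measurable_tnth.
by apply/seteqP; split => t h i => [_|]; exact: h.
Qed.

(** The product sigma-algebra is generated by the coordinates, so an open set has to be written as a
    countable union of boxes: rational centres and half-sides 1 / (k + 1), keeping only the boxes
    inside [U]. *)
Lemma open_row_of_measurable (U : set 'rV[R]_m) : open U ->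
  measurable (row_of @^-1` U).
Proof.
move=> oU.
pose box (c : {ffun 'I_m -> rat} * nat) : set (m.-tuple T) :=
  [set t | forall i, `]ratr (c.1 i) - c.2.+1%:R^-1, ratr (c.1 i) + c.2.+1%:R^-1[%classic (tnth t i)].
pose D := [set c | box c `<=` row_of @^-1` U].
have -> : row_of @^-1` U = \bigcup_c (if c \in D then box c else set0).
  apply/seteqP; split => [t Ut|t [c _]]; last first.
    by case: ifPn => // /set_mem; apply.
  have /nbhs_ballP[e /= e0 eU] : nbhs (row_of t) U by exact: open_nbhs_nbhs.
  have [k ke] : exists k : nat, k.+1%:R^-1 < e / 2.
    have [k kP] := @near_infty_natSinv_lt R (PosNum (divr_gt0 e0 (ltr0n R 2))).
    by move=> /(_ k (leqnn k)) /=; exists k.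
  set d : R := k.+1%:R^-1 in ke.
  have k0 : 0 < d by rewrite invr_gt0.
  have hq (i : 'I_m) : exists q : rat, `|tnth t i - ratr q| < d.
    have lt_d : tnth t i - d < tnth t i + d by lra.
    have [q] := rat_in_itvoo lt_d.
    by rewrite in_itv/= => /andP[q1 q2]; exists q; rewrite ltr_norml; lra.
  pose c : {ffun 'I_m -> rat} := [ffun i => projT1 (cid (hq i))].
  have cP i : `|tnth t i - ratr (c i)| < d.
    by rewrite ffunE; case: cid.
  exists (c, k) => //.
  have tb : box (c, k) t.
    by move=> i /=; rewrite in_itv/= -/d; have := cP i; rewrite ltr_norml; lra.
  rewrite (_ : ((c, k) \in D) = true)//; apply/mem_set => s sb; apply: eU; split => // i j.
  rewrite ord1 /ball/= !mxE.
  have := cP j; have := sb j; rewrite /= in_itv/= -/d => /andP[h1 h2].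
  by rewrite !ltr_norml; lra.
apply: countable_bigcupT_measurable => [|c]; first exact: countableP.
case: ifPn => // _.
exact: (measurable_tuple_box (fun i => measurable_itv _)).
Qed.

Lemma continuous_row_of_measurable (g : 'rV[R]_m -> R) : continuous g ->
  measurable_fun setT (g \o row_of : _ -> T).
Proof.
move=> /continuousP cg; apply: (measurability _ (RGenOpens.measurableE R)).
move=> _ [_ [a [b ->]] <-]; rewrite setTI.
rewrite comp_preimage; apply: open_row_of_measurable; apply: cg.
exact: interval_open.
Qed.

End tuple_space.

(** * Uniqueness and affine behaviour of Lebesgue measure on tuples *)

Section lebesgue_tuple_theory.
Variables (R : realType) (m : nat).
Local Notation T := (measurableTypeR R).
Local Notation mu := (lebesgue_tuple R m).
Implicit Types (t : m.-tuple T) (x : 'rV[R]_m).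

Lemma measurable_tuple_of_continuous (f : 'rV[R]_m -> 'rV[R]_m) : continuous f ->
  measurable_fun setT (fun t : m.-tuple T => tuple_of_row (f (row_of t)) : m.-tuple T).
Proof.
move=> cf; apply/measurable_fun_tnthP => i.
rewrite (_ : _ \o _ = (fun x => f x 0 i) \o (@row_of R m)); last first.
  by apply/funext => t /=; rewrite tnth_mktuple.
apply: continuous_row_of_measurable => x.
by apply: (@continuous_comp _ _ _ f (fun z : 'rV_m => z 0 i)); [exact: cf|exact: continuous_coord].
Qed.

(** Boxes are stable under intersection and generate the sigma-algebra, and open cubes exhaust the
    space; finiteness of one of the measures on cubes is then enough. *)
Lemma tuple_measure_unique (m1 m2 : {measure set (m.-tuple T) -> \bar R}) :
  (forall A : 'I_m -> set T, (forall i, measurable (A i)) ->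
    m1 [set t | forall i, A i (tnth t i)] = m2 [set t | forall i, A i (tnth t i)]) ->
  (forall r : R, (m1 [set t | forall i, (`](- r)%R, r[%classic : set T) (tnth t i)] < +oo)%E) ->
  forall X, measurable X -> m1 X = m2 X.
Proof.
move=> m12 m1oo X mX.
pose G : set (set (m.-tuple T)) := [set B | exists2 A : 'I_m -> set T,
  (forall i, measurable (A i)) & B = [set t | forall i, A i (tnth t i)]].
pose g (k : nat) := [set t : m.-tuple T | forall i, `]-k%:R, k%:R[%classic (tnth t i)].
apply: (measure_unique G g) => //.
- apply/seteqP; split; last first.
    apply: smallest_sub; first exact: sigma_algebra_measurable.
    by move=> _ [A mA ->]; exact: measurable_tuple_box.
  apply: smallest_sub; first exact: smallest_sigma_algebra.
  move=> B; rewrite -bigcup_seq => -[i /= _ [C mC <-]]; apply: sub_sigma_algebra.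
  exists (fun j => if j == i then C else setT) => [j|]; first by case: ifPn.
  apply/seteqP; split => [t /= [_ Ct] j|t /= /(_ i)]; last by rewrite eqxx.
  by case: ifPn => // /eqP ->.
- move=> _ _ [A mA ->] [B mB ->]; exists (fun i => A i `&` B i).
    by move=> i; exact: measurableI.
  by apply/seteqP; split => [t [hA hB] i|t h]; split => // i; case: (h i).
- by move=> k; exists (fun _ => `]-k%:R, k%:R[%classic) => // i; exact: measurable_itv.
- apply/seteqP; split => // t _.
  exists (Num.truncn (\sum_i `|tnth t i|)).+1 => // i /=; rewrite in_itv/= -ltr_norml.
  apply: le_lt_trans (truncnS_gt _); by rewrite (bigD1 i)//= lerDl sumr_ge0.
- by move=> _ [A mA ->]; exact: m12.
- by move=> k; exact: m1oo.
Qed.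

Lemma lebesgue_measure_affine (c a : R) (A : set T) : 0 < c -> measurable A ->
  lebesgue_measure A = (c%:E * lebesgue_measure [set t : T | A (c * t + a)%R])%E.
Proof.
move=> c0 mA.
have mf : measurable_fun setT (fun t : T => c * t + a : T).
  by apply: measurable_funD => //; exact: measurable_funM.
have c0' : 0 <= c by exact: ltW.
pose m2 : {measure set T -> \bar R} :=
  mscale (NngNum c0') (measure_function_pushforward__canonical__measure_function_Measure lebesgue_measure mf).
apply: (@lebesgue_measure_unique _ m2) => // _ [[x y] _ <-].
have -> : m2 `]x, y]%classic =
  (c%:E * lebesgue_measure ((fun t : T => (c * t + a)%R : T) @^-1` `]x, y]%classic))%E by [].
rewrite (_ : _ @^-1` _ = `](x - a) / c, (y - a) / c]%classic); last first.
  apply/seteqP; split => t; rewrite /= !in_itv/= ltr_pdivrMr// ler_pdivlMr//; lra.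
rewrite !lebesgue_measure_itv /= !lte_fin ltr_pM2r ?invr_gt0// ltrD2r.
case: ifPn => _; last by rewrite mule0.
rewrite -!EFinD -EFinM; congr EFin; field; lra.
Qed.

(** Dilations and translations act coordinatewise, so preimages of boxes are boxes and the
    one-dimensional formula applies factor by factor. A rotation does not preserve boxes and needs
    [lebesgue_tuple_rotation]. *)
Lemma lebesgue_tuple_affine (c : R) (a : 'rV[R]_m) (A : set (m.-tuple T)) :
  0 < c -> measurable A ->
  mu A = ((c ^+ m)%:E * mu [set t | A (tuple_of_row (c *: row_of t + a)%R)])%E.
Proof.
move=> c0 mA.
have mf : measurable_fun setT (fun t => tuple_of_row (c *: row_of t + a) : m.-tuple T).
  apply: (@measurable_tuple_of_continuous (fun x => c *: x + a)).
  apply: (@lipschitz_continuous_rV _ _ _ _ `|c|) => x y.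
  by rewrite opprD addrACA subrr addr0 -scalerBr enormZ.
have c0' : 0 <= c ^+ m by rewrite exprn_ge0// ltW.
pose m2 : {measure set (m.-tuple T) -> \bar R} :=
  mscale (NngNum c0') (measure_function_pushforward__canonical__measure_function_Measure mu mf).
apply: (@tuple_measure_unique mu m2) => // [B mB|r].
  rewrite [LHS](lebesgue_tuple_box mB); set E := (X in m2 X).
  have -> : m2 E = ((c ^+ m)%:E *
    mu ((fun t => tuple_of_row (c *: row_of t + a)%R : m.-tuple T) @^-1` E))%E by [].
  rewrite (_ : _ @^-1` _ = [set t | forall i, [set t : T | B i (c * t + a 0 i)] (tnth t i)]).
    have mB' i : measurable [set t : T | B i (c * t + a 0 i)].
      rewrite -[X in measurable X]setTI.
      suff : measurable_fun setT (fun t : T => c * t + a 0 i : T) by apply.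
      by apply: measurable_funD => //; exact: measurable_funM.
    rewrite (lebesgue_tuple_box mB').
    rewrite -[X in c ^+ X]card_ord -prodr_const -prodEFin -big_split/=.
    by apply: eq_bigr => i _; exact: lebesgue_measure_affine.
  apply/seteqP; split => t /= h i; move: (h i); by rewrite tnth_mktuple !mxE.
rewrite [X in (X < _)%E](lebesgue_tuple_box (fun i => measurable_itv _)).
rewrite (eq_bigr (fun=> (Num.max 0 (r - - r))%:E)).
  by rewrite prodEFin ltry.
move=> i _; rewrite lebesgue_measure_itv /= lte_fin -EFinD.
have [h|h] := ltP (-r) r; congr EFin; [rewrite max_r//|rewrite max_l//]; lra.
Qed.

End lebesgue_tuple_theory.

Section sigma_finite_copy.
Context d (T : measurableType d) (R : realType) (m0 : {measure set T -> \bar R}).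

(** An alias whose argument [sf] is a proof: a measure known to be sigma-finite only through a
    hypothesis, such as the image of Lebesgue measure under a rotation, can then be used where the
    structure is required. *)
Definition sigma_finite_copy (sf : sigma_finite setT m0) : set T -> \bar R := m0.

Variable sf : sigma_finite setT m0.
HB.instance Definition _ := Measure.copy (sigma_finite_copy sf) m0.
HB.instance Definition _ := Measure_isSigmaFinite.Build _ _ _ (sigma_finite_copy sf) sf.

End sigma_finite_copy.

(** * Rotation invariance of Lebesgue measure *)

Section rotation.
Variables (R : realType) (m : nat).
Local Notation T := (measurableTypeR R).
Local Notation mu := (lebesgue_tuple R m).
Implicit Types (t : m.-tuple T) (A B : set (m.-tuple T)).

Definition tball (e : R) : set (m.-tuple T) := [set t | enorm (row_of t) < e].

Lemma open_enorm_lt (e : R) : open [set x : 'rV[R]_m | enorm x < e].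
Proof.
have h : continuous (fun x : 'rV[R]_m => enorm x).
  by apply: (@continuous_enorm _ _ _ id) => x; exact: cvg_id.
exact: (open_comp (fun x _ => h x) (@open_lt _ e)).
Qed.

Lemma measurable_tball e : measurable (tball e).
Proof. exact: (open_row_of_measurable (@open_enorm_lt e)). Qed.

Lemma mu_tball_lty e : (mu (tball e) < +oo)%E.
Proof.
apply: (@le_lt_trans _ _ (mu [set t | forall i, (`](- e)%R, e%R[%classic : set T) (tnth t i)])).
  apply: le_measure; rewrite ?inE; [exact: measurable_tball| |].
    exact: (measurable_tuple_box (fun i => measurable_itv _)).
  move=> t te i /=; rewrite in_itv/= -ltr_norml.
  by apply: le_lt_trans te; have := norm_coord_le_enorm (row_of t) i; rewrite mxE.
rewrite [X in (X < _)%E](lebesgue_tuple_box (fun i => measurable_itv _)).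
rewrite (eq_bigr (fun=> (Num.max 0 (e - - e))%:E)).
  by rewrite prodEFin ltry.
move=> i _; rewrite lebesgue_measure_itv /= lte_fin -EFinD.
have [h|h] := ltP (-e) e; congr EFin; [rewrite max_r//|rewrite max_l//]; lra.
Qed.

Lemma mu_tball_gt0 e : 0 < e -> (0 < mu (tball e))%E.
Proof.
move=> e0; pose d := e / m.+1%:R.
have d0 : 0 < d by rewrite divr_gt0.
apply: (@lt_le_trans _ _ (mu [set t | forall i, (`](- d)%R, d%R[%classic : set T) (tnth t i)])).
  rewrite [X in (_ < X)%E](lebesgue_tuple_box (fun i => measurable_itv _)).
  rewrite (eq_bigr (fun=> (d - - d)%:E)).
    rewrite prodEFin lte_fin prodr_const exprn_gt0//; lra.
  by move=> i _; rewrite lebesgue_measure_itv /= lte_fin -EFinD gtrN.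
apply: le_measure; rewrite ?inE; [|exact: measurable_tball|].
  exact: (measurable_tuple_box (fun i => measurable_itv _)).
move=> t td /=; apply: (le_lt_trans (enorm_le_sum _)).
apply: (@le_lt_trans _ _ (\sum_(i < m) d)).
  apply: ler_sum => i _; rewrite mxE; have := td i.
  by rewrite /= in_itv/= -ltr_norml => /ltW.
rewrite sumr_const card_ord -mulr_natl /d mulrCA gtr_pMr// ltr_pdivrMr// mul1r.
by rewrite ltr_nat.
Qed.

Lemma sigma_finite_tball (nu : {measure set (m.-tuple T) -> \bar R}) :
  (forall e, (nu (tball e) < +oo)%E) -> sigma_finite setT nu.
Proof.
move=> h; exists (fun k => tball k%:R) => [|k]; last by split; [exact: measurable_tball|].
apply/esym/seteqP; split => // t _; exists (Num.truncn (enorm (row_of t))).+1 => //.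
exact: truncnS_gt.
Qed.

(* Both sides of the equality below are the (mu \x nu)-measure of the set of
   pairs with a coordinate in A and a difference of coordinates in B, computed
   by the two iterated integrals after a translation. *)
Lemma translation_invariant_measure_prop
    (m1 m2 : {sigma_finite_measure set (m.-tuple T) -> \bar R}) A B :
  (forall a A, measurable A -> m1 [set t | A (tuple_of_row (row_of t + a)%R)] = m1 A) ->
  (forall a A, measurable A -> m2 [set t | A (tuple_of_row (row_of t + a)%R)] = m2 A) ->
  measurable A -> measurable B -> (forall t, B t -> B (tuple_of_row (- row_of t)%R)) ->
  (m1 A * m2 B = m1 B * m2 A)%E.
Proof.
move=> t1 t2 mA mB symB.
pose S1 : set (m.-tuple T * m.-tuple T) :=
  [set z | B z.2 /\ A (tuple_of_row (row_of z.1 + row_of z.2)%R)].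
pose S2 : set (m.-tuple T * m.-tuple T) :=
  [set z | A z.2 /\ B (tuple_of_row (row_of z.2 - row_of z.1)%R)].
have msnd C : measurable C -> measurable [set z : m.-tuple T * m.-tuple T | C z.2].
  move=> mC; rewrite -[X in measurable X]setTI.
  by apply: (@measurable_snd _ _ (m.-tuple T) (m.-tuple T)).
have mlin (a b : R) C : measurable C -> measurable
    [set z : m.-tuple T * m.-tuple T | C (tuple_of_row (a *: row_of z.1 + b *: row_of z.2)%R)].
  move=> mC; rewrite -[X in measurable X]setTI.
  suff : measurable_fun setT (fun z : m.-tuple T * m.-tuple T =>
    tuple_of_row (a *: row_of z.1 + b *: row_of z.2)%R : m.-tuple T) by apply.
  apply/measurable_fun_tnthP => i.
  rewrite (_ : _ \o _ = fun z => a * tnth z.1 i + b * tnth z.2 i); last first.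
    by apply/funext => z /=; rewrite tnth_mktuple !mxE.
  apply: measurable_funD; apply: measurable_funM => //.
    apply: (@measurableT_comp _ _ _ _ _ _ (fun t : m.-tuple T => tnth t i)) => //.
    exact: measurable_tnth.
  apply: (@measurableT_comp _ _ _ _ _ _ (fun t : m.-tuple T => tnth t i)) => //.
  exact: measurable_tnth.
have mS1 : measurable S1.
  apply: measurableI; first exact: msnd.
  by have := mlin 1 1 A mA; under eq_set do rewrite !scale1r.
have mS2 : measurable S2.
  apply: measurableI; first exact: msnd.
  by have := mlin (-1) 1 B mB; under eq_set do rewrite scale1r scaleN1r addrC.
have fub S : measurable S ->
    (\int[m1]_x m2 (xsection S x) = \int[m2]_y m1 (ysection S y))%E.
  move=> mS; have := indic_fubini_tonelli m1 m2 mS.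
  by rewrite indic_fubini_tonelli_FE// indic_fubini_tonelli_GE.
have sec C D (h : m.-tuple T -> m.-tuple T -> m.-tuple T) : measurable D ->
    (forall y, m1 [set x | C (h x y)] = m1 C) ->
    (\int[m2]_y m1 (ysection [set z | D z.2 /\ C (h z.1 z.2)] y) = m1 C * m2 D)%E.
  move=> mD hC; rewrite -(integral_cst _ mD) [RHS]integral_mkcond.
  apply: eq_integral => y _; rewrite patchE; case: ifPn => [/set_mem|/negP] Dy.
    rewrite -[RHS](hC y); congr (m1 _); apply/seteqP; split => x /=.
      by rewrite /ysection /= => /set_mem [].
    by move=> Cx; apply/mem_set.
  rewrite (_ : ysection _ _ = set0) ?measure0//; apply/seteqP; split => // x.
  by rewrite /ysection /= => /set_mem [] /mem_set.
rewrite -(sec A B (fun x y : m.-tuple T => tuple_of_row (row_of x + row_of y)%R))//; last first.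
  by move=> y; exact: t1.
rewrite -(sec B A (fun x y : m.-tuple T => tuple_of_row (row_of y - row_of x)%R))//; last first.
  move=> y; rewrite -[RHS](t1 (- row_of y))//; congr (m1 _).
  apply/seteqP; split => x /= /symB; rewrite tuple_of_rowK.
    by rewrite opprB.
  by rewrite opprD opprK addrC.
rewrite -/S1 -/S2 -!fub//; apply: eq_integral => x _.
rewrite -[RHS](t2 (row_of x)); last exact: measurable_xsection.
congr (m2 _); apply/seteqP; split => y.
  rewrite /xsection/= => /set_mem [/= By Axy]; apply/mem_set; split => /=.
    by rewrite addrC.
  by rewrite tuple_of_rowK addrK row_ofK.
rewrite /xsection/= => /set_mem [/=]; rewrite tuple_of_rowK addrK row_ofK addrC => Axy By.
by apply/mem_set; split.
Qed.

Lemma row_of_tuple_of_translate a A : measurable A ->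
  mu [set t | A (tuple_of_row (row_of t + a)%R)] = mu A.
Proof.
move=> mA; rewrite [RHS](lebesgue_tuple_affine a ltr01 mA) expr1n mul1e.
by congr (mu _); apply/funext => t /=; rewrite scale1r.
Qed.

(** The image measure under [O] is again translation invariant, so
    [translation_invariant_measure_prop] makes it proportional to Lebesgue measure. The unit ball is
    symmetric, preserved by [O] and of positive finite measure, hence the factor is 1. *)
Lemma lebesgue_tuple_rotation (O : 'M[R]_m) A : O *m O^T = 1%:M -> measurable A ->
  mu [set t | A (tuple_of_row (row_of t *m O)%R)] = mu A.
Proof.
move=> OO mA.
have OTO : O^T *m O = 1%:M by exact: mulmx1C.
have eO x : enorm (x *m O) = enorm x.
  have h (y : 'rV[R]_m) : (dotv y y)%:M = y *m y^T :> 'M[R]_1 by rewrite mul_trmx_dotv.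
  rewrite /enorm; congr Num.sqrt.
  have := h (x *m O); rewrite trmx_mul mulmxA -(mulmxA x) OO mulmx1 -h.
  by move/matrixP/(_ 0 0); rewrite !mxE.
have mf := measurable_tuple_of_continuous (@continuous_mulmx _ _ _ O).
pose m0 := measure_function_pushforward__canonical__measure_function_Measure mu mf.
have m0ball e : m0 (tball e) = mu (tball e).
  rewrite /m0/= /pushforward; congr (mu _); apply/seteqP; split => t;
    by rewrite /tball/= tuple_of_rowK eO.
have m0sf : sigma_finite setT m0.
  by apply: sigma_finite_tball => e; rewrite m0ball mu_tball_lty.
pose m2 : {sigma_finite_measure set (m.-tuple T) -> \bar R} := sigma_finite_copy m0sf.
have tr a B : measurable B -> m2 [set t | B (tuple_of_row (row_of t + a)%R)] = m2 B.
  move=> mB; rewrite -[RHS](row_of_tuple_of_translate (a *m O^T)).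
    congr (mu _); apply/seteqP; split => t /=; rewrite !tuple_of_rowK mulmxDl -mulmxA OTO mulmx1//.
  by rewrite -[X in measurable X]setTI; have := mf; apply.
have := translation_invariant_measure_prop (fun a A => @row_of_tuple_of_translate a A) tr mA (measurable_tball 1).
have symb t : tball 1 t -> tball 1 (tuple_of_row (- row_of t)%R).
  by rewrite /tball/= tuple_of_rowK enormN.
move=> /(_ symb); have -> : m2 (tball 1) = mu (tball 1) by rewrite -m0ball.
have b0 := mu_tball_gt0 ltr01.
have bf : mu (tball 1) \is a fin_num by rewrite ge0_fin_numE ?mu_tball_lty.
rewrite muleC => /(congr1 (fun z => (((fine (mu (tball 1)))^-1)%:E * z)%E)).
have k : (((fine (mu (tball 1)))^-1)%:E * mu (tball 1) = 1)%E.
  rewrite -{2}(fineK bf) -EFinM mulVf// gt_eqF// fine_gt0// b0/= mu_tball_lty//.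
by rewrite !muleA k !mul1e => ->.
Qed.

End rotation.

(** * Normalized averages over centred balls *)

Section ball_average.
Variables (R : realType) (m : nat).
Local Notation T := (measurableTypeR R).
Local Notation mu := (lebesgue_tuple R m).
Local Notation tb := (@tball R m).
Implicit Types (f g : 'rV[R]_m -> R) (e : R).

Definition avg e g : R :=
  (fine (mu (tb e)))^-1 * \int[mu]_(t in tb e) g (row_of t).

Lemma continuous_bounded_ball g (e : R) : continuous g ->
  exists M, forall x, enorm x <= e -> `|g x| <= M.
Proof.
move=> cg; have [e0|e0] := ltP e 0.
  by exists 0 => x xe; have := enorm_ge0 x; lra.
pose A : set 'rV[R]_m := [set x | enorm x <= e].
have ce : continuous (fun x : 'rV[R]_m => enorm x).
  by apply: (@continuous_enorm _ _ _ id) => x; exact: cvg_id.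
have cA : compact A.
  apply: bounded_closed_compact.
    exists e; split; first exact: num_real.
    by move=> y ey x /= xe; rewrite (le_trans (norm_le_enorm x))// (le_trans xe)// ltW.
  exact: (closed_comp (fun x _ => ce x) (@closed_le _ e)).
have A0 : A !=set0 by exists 0; rewrite /A/= enorm0.
have cn : {within A, continuous (fun x => `|g x|)}.
  exact: (continuous_subspaceT (continuousT_comp cg (@norm_continuous _ _))).
have [c _ cM] := EVT_max_rV A0 cA cn.
by exists `|g c| => x xe; apply: cM; rewrite inE.
Qed.

Lemma integrable_ball e g : continuous g ->
  mu.-integrable (tb e) (EFin \o (g \o @row_of R m)).
Proof.
move=> cg; apply: measurable_bounded_integrable.
- exact: measurable_tball.
- exact: mu_tball_lty.
- exact: measurable_funS (continuous_row_of_measurable cg).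
have [M gM] := continuous_bounded_ball e cg.
exists M; split; first exact: num_real.
by move=> y My t /ltW te; apply: (le_trans (gM _ te)); exact: ltW.
Qed.

Lemma fine_mu_tball_gt0 e : 0 < e -> 0 < fine (mu (tb e)).
Proof. by move=> e0; rewrite fine_gt0// mu_tball_gt0//= mu_tball_lty. Qed.

Lemma avg_cst e c : 0 < e -> avg e (fun=> c) = c.
Proof.
move=> e0; rewrite /avg Rintegral_cst; last exact: measurable_tball.
by rewrite mulrCA mulVf ?mulr1// gt_eqF// fine_mu_tball_gt0.
Qed.

Lemma avgD e f g : continuous f -> continuous g ->
  avg e (fun x => f x + g x) = avg e f + avg e g.
Proof.
move=> cf cg; rewrite /avg.
have -> := RintegralD (@measurable_tball R m e) (integrable_ball e cf) (integrable_ball e cg).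
by rewrite mulrDr.
Qed.

Lemma avgZ e c f : continuous f -> avg e (fun x => c * f x) = c * avg e f.
Proof.
move=> cf; rewrite /avg.
have -> := @RintegralZl _ _ _ mu (tb e) (f \o @row_of R m) c (@measurable_tball R m e)
  (integrable_ball e cf).
by rewrite mulrCA.
Qed.

Lemma avgN e f : continuous f -> avg e (fun x => - f x) = - avg e f.
Proof.
move=> cf; rewrite -mulN1r -avgZ//.
by congr avg; apply/funext => x; rewrite mulN1r.
Qed.

Lemma avgB e f g : continuous f -> continuous g ->
  avg e (fun x => f x - g x) = avg e f - avg e g.
Proof.
by move=> cf cg; rewrite avgD ?avgN// => x; apply: continuousN; exact: cg.
Qed.

Lemma avg_sum e (I : Type) (r : seq I) (f : I -> 'rV[R]_m -> R) : 0 < e ->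
  (forall i, continuous (f i)) ->
  avg e (fun x => \sum_(i <- r) f i x) = \sum_(i <- r) avg e (f i).
Proof.
move=> e0 cf; elim: r => [|i r IH].
  rewrite big_nil -[RHS](@avg_cst e 0 e0); congr avg.
  by apply/funext => x; rewrite big_nil.
transitivity (avg e (fun x => f i x + \sum_(i <- r) f i x)).
  by congr avg; apply/funext => x; rewrite big_cons.
by rewrite avgD ?big_cons ?IH//; exact: continuous_sum.
Qed.

Lemma le_avg e f g : 0 < e -> continuous f -> continuous g ->
  (forall x, enorm x < e -> f x <= g x) -> avg e f <= avg e g.
Proof.
move=> e0 cf cg fg; rewrite /avg ler_pM2l ?invr_gt0 ?fine_mu_tball_gt0//.
apply: (le_Rintegral (@measurable_tball R m e) (integrable_ball e cf) (integrable_ball e cg)).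
by move=> t te; exact: fg.
Qed.

Lemma avg_le e f c : 0 < e -> continuous f ->
  (forall x, enorm x < e -> f x <= c) -> avg e f <= c.
Proof.
move=> e0 cf fc; rewrite -[leRHS](avg_cst c e0); apply: le_avg => //.
exact: cst_continuous.
Qed.

Lemma avg_ge e f c : 0 < e -> continuous f ->
  (forall x, enorm x < e -> c <= f x) -> c <= avg e f.
Proof.
move=> e0 cf fc; rewrite -[leLHS](avg_cst c e0); apply: le_avg => //.
exact: cst_continuous.
Qed.

Lemma enorm_mulmx_orthogonal k (O : 'M[R]_(m, k)) x : O *m O^T = 1%:M ->
  enorm (x *m O) = enorm x.
Proof.
move=> OO; rewrite /enorm; congr Num.sqrt.
have := mul_trmx_dotv (x *m O) (x *m O).
rewrite trmx_mul mulmxA -(mulmxA x) OO mulmx1 mul_trmx_dotv.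
by move/matrixP/(_ 0 0); rewrite !mxE.
Qed.

Lemma avg_rotation e (O : 'M[R]_m) g : O *m O^T = 1%:M -> continuous g ->
  avg e (fun x => g (x *m O)) = avg e g.
Proof.
move=> OO cg; rewrite /avg; congr (_ * fine _).
have mf := measurable_tuple_of_continuous (@continuous_mulmx _ _ _ O).
set phi := (fun t => _) in mf.
have pball : phi @^-1` tb e = tb e.
  by apply/seteqP; split => t; rewrite /phi /tball/= tuple_of_rowK enorm_mulmx_orthogonal.
transitivity (\int[mu]_(t in phi @^-1` tb e) (EFin \o (g \o @row_of R m) \o phi) t)%E.
  by rewrite pball; apply: eq_integral => t _ /=; rewrite /phi tuple_of_rowK.
have mg : measurable_fun setT (EFin \o (g \o @row_of R m)).
  by apply/measurable_EFinP; exact: continuous_row_of_measurable.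
have ig : mu.-integrable (phi @^-1` tb e) ((EFin \o (g \o @row_of R m)) \o phi).
  rewrite pball (_ : _ \o phi = EFin \o ((fun x => g (x *m O)) \o @row_of R m)).
    exact: (integrable_ball e (continuousT_comp (@continuous_mulmx _ _ _ O) cg)).
  by apply/funext => t /=; rewrite /phi tuple_of_rowK.
rewrite -(integral_pushforward mf mg ig (@measurable_tball R m e)).
apply: eq_measure_integral => A mA _; exact: lebesgue_tuple_rotation.
Qed.

Lemma avg_opp e g : continuous g -> avg e (fun x => g (- x)) = avg e g.
Proof.
move=> cg; rewrite -(@avg_rotation e (- 1%:M) g)//.
  by congr avg; apply/funext => x; rewrite mulmxN mulmx1.
by rewrite linearN /= trmx1 mulNmx mulmxN opprK mulmx1.
Qed.

(** The antipodal map is orthogonal and leaves [avg] unchanged. First-order terms in the random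
    displacement are removed this way throughout. *)
Lemma avg_odd e g : continuous g -> (forall x, g (- x) = - g x) -> avg e g = 0.
Proof.
move=> cg og; have := avg_opp e cg; under eq_fun do rewrite og.
by rewrite avgN//; lra.
Qed.

End ball_average.

(** * Second moments of a ball *)

Section ball_moments.
Variables (R : realType) (m : nat).
Local Notation T := (measurableTypeR R).
Local Notation mu := (lebesgue_tuple R m).
Local Notation tb := (@tball R m).
Implicit Types (f g : 'rV[R]_m -> R) (e c : R).

Lemma integral_tball_scale c e f : 0 < c -> continuous f -> (forall x, 0 <= f x) ->
  (\int[mu]_(t in tb (c * e)) (f (row_of t))%:E =
   (c ^+ m)%:E * \int[mu]_(t in tb e) (f (c *: row_of t)%R)%:E)%E.
Proof.
move=> c0 cf f0.
have mf : measurable_fun setT (fun t => tuple_of_row (c *: row_of t + 0)%R : m.-tuple T).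
  apply: (@measurable_tuple_of_continuous R m (fun x => c *: x + 0)).
  apply: (@lipschitz_continuous_rV _ _ _ _ `|c|) => x y.
  by rewrite opprD addrACA subrr addr0 -scalerBr enormZ.
set phi := (fun t => _) in mf.
have c0' : 0 <= c ^+ m by rewrite exprn_ge0// ltW.
pose m1 := measure_function_pushforward__canonical__measure_function_Measure mu mf.
pose m2 : {measure set (m.-tuple T) -> \bar R} := mscale (NngNum c0') m1.
have mg : measurable_fun setT (EFin \o (f \o @row_of R m)).
  by apply/measurable_EFinP; exact: continuous_row_of_measurable.
have mtb := @measurable_tball R m (c * e).
transitivity (\int[m2]_(t in tb (c * e)) (EFin \o (f \o @row_of R m)) t)%E.
  by apply: eq_measure_integral => A mA _; exact: lebesgue_tuple_affine.
have mgD : measurable_fun (tb (c * e)) (EFin \o (f \o @row_of R m)).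
  exact: measurable_funS mg.
rewrite [LHS]ge0_integral_mscale//; last by move=> t _; rewrite lee_fin; exact: f0.
congr (_ * _)%E.
transitivity (\int[mu]_(t in phi @^-1` tb (c * e)) ((EFin \o (f \o @row_of R m)) \o phi) t)%E.
  apply: ge0_integral_pushforward => //.
  by move=> t _; rewrite lee_fin; exact: f0.
rewrite (_ : phi @^-1` tb (c * e) = tb e).
  by apply: eq_integral => t _ /=; rewrite /phi tuple_of_rowK addr0.
apply/seteqP; split => t; rewrite /phi /tball/= tuple_of_rowK addr0 enormZ gtr0_norm//;
  by rewrite ltr_pM2l.
Qed.

Lemma fine_mu_tball_scale c e : 0 < c ->
  fine (mu (tb (c * e))) = c ^+ m * fine (mu (tb e)).
Proof.
move=> c0; have mtb r := @measurable_tball R m r.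
have := @integral_tball_scale c e (fun=> 1) c0 (@cst_continuous _ _ _) (fun=> ler01).
rewrite !integral_cst// !mul1e => ->.
by rewrite fineM// ge0_fin_numE// mu_tball_lty.
Qed.

Lemma avg_scale c e f : 0 < c -> 0 < e -> continuous f -> (forall x, 0 <= f x) ->
  avg (c * e) f = avg e (fun x => f (c *: x)).
Proof.
move=> c0 e0 cf f0; rewrite /avg fine_mu_tball_scale// /Rintegral integral_tball_scale//.
have cs : continuous (fun x : 'rV[R]_m => c *: x).
  apply: (@lipschitz_continuous_rV _ _ _ _ `|c|) => x y.
  by rewrite -scalerBr enormZ.
rewrite fineM//; last first.
  by apply: integrable_fin_num; [exact: measurable_tball|exact: (integrable_ball e (continuousT_comp cs cf))].
have h1 := fine_mu_tball_gt0 m e0.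
have h2 : 0 < c ^+ m by rewrite exprn_gt0.
by rewrite invfM mulrACA mulVf ?gt_eqF// mul1r.
Qed.

Lemma le_of_mul_expr (a b : R) (k : nat) : 0 <= a ->
  (forall l, 0 < l < 1 -> a * l ^+ k <= b) -> a <= b.
Proof.
move=> a0 h.
have ch : continuous (fun l : R => a * l ^+ k).
  exact: (continuousT_mull (@exprn_continuous _ k)).
apply/ler_addgt0Pr => e e0.
have /cvgrPdist_lt/(_ e e0)/nbhs_ballP[d /= d0 dP] := ch 1.
pose l := Num.max (1 - d / 2) (1 / 2).
have l1 : 0 < l < 1 by rewrite lt_max gt_max; apply/andP; split; [apply/orP; right|]; lra.
have : `|1 - l| < d.
  have hl : 1 - d / 2 <= l by rewrite le_max lexx.
  by rewrite ger0_norm; lra.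
by move=> /dP; rewrite expr1n mulr1 ltr_norml => /andP[_]; have := h _ l1; lra.
Qed.

(** No polar coordinates are used. With Q the mean and V the measure for the unit ball, scaling
    gives the integral over the ball of radius l as l^(m + 2) V Q and its measure as l^m V. On the
    shell between l and 1 the integrand lies between l^2 and 1, so l^2 (1 - l^m) <= Q (1 - l^(m +
    2)) <= 1 - l^m; dividing by 1 - l and letting l increase to 1 gives Q (m + 2) = m. *)
Lemma avg_sqr_enorm e : 0 < e ->
  avg e (fun x : 'rV[R]_m => dotv x x) = m%:R / m.+2%:R * e ^+ 2.
Proof.
have ci : continuous (fun x : 'rV[R]_m => x) by move=> x; exact: cvg_id.
have cd := continuous_dotv ci ci.
have sc r : 0 < r -> avg r (fun x : 'rV[R]_m => dotv x x) = r ^+ 2 * avg 1 (fun x : 'rV[R]_m => dotv x x).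
  move=> r0; rewrite -{1}(mulr1 r) avg_scale//; last exact: dotvv_ge0.
  rewrite -avgZ//; congr avg; apply/funext => x; rewrite !dotvE; ring.
move=> e0; rewrite sc// mulrC; congr (_ * _).
set Q := avg 1 _.
have Q0 : 0 <= Q by apply: avg_ge => // x _; exact: dotvv_ge0.
pose V := fine (mu (tb 1)).
have V0 : 0 < V by exact: fine_mu_tball_gt0.
have Vr r : 0 < r -> fine (mu (tb r)) = r ^+ m * V.
  by move=> r0; rewrite -[in LHS](mulr1 r) fine_mu_tball_scale.
have Ir r : 0 < r -> \int[mu]_(t in tb r) dotv (row_of t) (row_of t) = r ^+ m.+2 * (V * Q).
  move=> r0.
  have h2 : r ^+ m * V != 0 by rewrite gt_eqF// mulr_gt0// exprn_gt0.
  have := sc r r0; rewrite {1}/avg Vr// -/Q => /(canRL (mulKf (invr_neq0 h2))).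
  by rewrite invrK => ->; rewrite !exprS expr0; ring.
have shell l : 0 < l < 1 -> l ^+ 2 * (1 - l ^+ m) <= Q * (1 - l ^+ m.+2) <= 1 - l ^+ m.
  move=> /andP[l0 l1].
  pose S := tb 1 `\` tb l.
  have mS : measurable S by apply: measurableD; exact: measurable_tball.
  have i1 := integrable_ball 1 cd.
  have ST : tb l `|` S = tb 1.
    apply/seteqP; split => [t [tl|[]//]|t t1].
      by apply: lt_trans l1.
    by have [tl|tl] := pselect (tb l t); [left|right].
  have iS : mu.-integrable S (EFin \o ((fun x => dotv x x) \o @row_of R m)).
    by apply: integrableS i1 => //; [exact: measurable_tball|move=> t []].
  have iC r : mu.-integrable S (EFin \o (fun=> r)).
    have ir := @integrable_ball R m 1 (fun=> r) (@cst_continuous _ _ _).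
    by apply: integrableS ir => //; [exact: measurable_tball|move=> t []].
  have dj : [disjoint tb l & S].
    by apply/disj_setPS => t [tl [_ ntl]].
  have eI : \int[mu]_(t in S) dotv (row_of t) (row_of t) = V * (Q * (1 - l ^+ m.+2)).
    have := @Rintegral_setU _ _ _ mu (tb l) S ((fun x => dotv x x) \o @row_of R m)
      (@measurable_tball R m l) mS.
    rewrite ST => /(_ i1 dj) /=; rewrite !Ir// expr1n; lra.
  have eM : fine (mu S) = V * (1 - l ^+ m).
    have fl r : mu (tb r) \is a fin_num by rewrite ge0_fin_numE// mu_tball_lty.
    have Sl : (mu S < +oo)%E.
      by apply: le_lt_trans (mu_tball_lty m 1); apply: le_measure; rewrite ?inE//;
        [exact: measurable_tball|move=> t []].
    have := measureU mu (@measurable_tball R m l) mS; rewrite ST.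
    have -> : tb l `&` S = set0 by apply/seteqP; split => // t [tl [_]].
    move=> /(_ erefl) /(congr1 fine); rewrite fineD ?ge0_fin_numE// ?mu_tball_lty//.
    rewrite -/V Vr//; lra.
  apply/andP; split.
    rewrite -(ler_pM2l V0) -eI mulrCA -eM -Rintegral_cst//.
    apply: (le_Rintegral mS (iC _) iS) => t [_ /negP]; rewrite -leNgt => lt.
    by rewrite /= -sqr_enorm ler_pXn2r// ?nnegrE ?enorm_ge0// ltW.
  rewrite -(ler_pM2l V0) -eI -eM -[leRHS]mul1r -Rintegral_cst//.
  apply: (le_Rintegral mS iS (iC _)) => t [t1 _].
  by rewrite /= -sqr_enorm expr_le1// ?enorm_ge0// ltW.
have geo k l : 1 - l ^+ k = (1 - l) * \sum_(i < k) l ^+ i :> R.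
  by rewrite -[in LHS](expr1n _ k) subrXX; congr (_ * _); apply: eq_bigr => i _; rewrite expr1n mul1r.
have sle k l : 0 < l < 1 -> \sum_(i < k) l ^+ i <= k%:R :> R.
  move=> /andP[l0 l1]; rewrite -[X in X%:R]card_ord -sum1_card natr_sum ler_sum// => i _.
  by rewrite exprn_ile1// ltW.
have sge k j l : (k <= j)%N -> 0 < l < 1 -> k%:R * l ^+ j <= \sum_(i < k) l ^+ i :> R.
  move=> kj /andP[l0 l1]; rewrite mulr_natl -[X in _ *+ X]card_ord -sumr_const ler_sum// => i _.
  by rewrite ler_wiXn2l// ?ltW// (leq_trans _ kj)// ltnW.
have fin l : 0 < l < 1 -> l ^+ 2 * (\sum_(i < m) l ^+ i) <= Q * (\sum_(i < m.+2) l ^+ i) <= \sum_(i < m) l ^+ i.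
  move=> l01; have := shell l l01; rewrite !geo => /andP[h1 h2].
  have l0 : 0 < 1 - l by lra.
  by apply/andP; split; rewrite -(ler_pM2l l0); [rewrite mulrCA (mulrCA _ Q)|rewrite mulrCA].
suff : Q * m.+2%:R = m%:R by move=> <-; rewrite mulfK.
apply/eqP; rewrite eq_le; apply/andP; split.
  apply: (@le_of_mul_expr _ _ m.+2); first by rewrite mulr_ge0.
  move=> l l01; have /andP[_ h] := fin l l01.
  apply: le_trans (sle m l l01); apply: le_trans h.
  by rewrite -mulrA ler_wpM2l// sge.
apply: (@le_of_mul_expr _ _ m.+2) => // l l01; have /andP[h _] := fin l l01.
apply: (@le_trans _ _ (Q * \sum_(i < m.+2) l ^+ i)); last by rewrite ler_wpM2l// sle.
apply: le_trans h; rewrite -(addn2 m) exprD mulrA mulrC ler_wpM2l ?sqr_ge0//.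
exact: sge.
Qed.

(** Reflecting one coordinate kills the mixed moments, exchanging two coordinates makes the diagonal
    ones equal, and their sum is known from [avg_sqr_enorm]. *)
Lemma avg_quadratic e (M : 'M[R]_m) : 0 < e ->
  avg e (fun x => dotv (x *m M) x) = e ^+ 2 / m.+2%:R * \tr M.
Proof.
move=> e0.
have cc i j : continuous (fun x : 'rV[R]_m => x 0 i * x 0 j).
  exact: (continuousT_mul (@continuous_coord _ _ i) (@continuous_coord _ _ j)).
pose q i j := avg e (fun x : 'rV[R]_m => x 0 i * x 0 j).
have q0 i j : i != j -> q i j = 0.
  move=> ij; pose d : 'rV[R]_m := \row_k (if k == i then -1 else 1).
  have dd : diag_mx d *m (diag_mx d)^T = 1%:M.
    rewrite tr_diag_mx mulmx_diag -diag_const_mx; congr diag_mx.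
    by apply/rowP => k; rewrite !mxE; case: ifP; rewrite ?mulrNN mulr1.
  have h : avg e (fun x => (x *m diag_mx d) 0 i * (x *m diag_mx d) 0 j) = - q i j.
    rewrite -avgN//; congr avg; apply/funext => x.
    by rewrite !mul_mx_diag !mxE eqxx [j == i]eq_sym (negPf ij); ring.
  by have := avg_rotation e dd (cc i j); rewrite h -/(q i j); lra.
have qq i j : q i i = q j j.
  pose P : 'M[R]_m := perm_mx (tperm i j).
  have PP : P *m P^T = 1%:M by rewrite tr_perm_mx tpermV -perm_mxM tperm2 perm_mx1.
  rewrite /q -(avg_rotation e PP (cc i i)); congr avg; apply/funext => x.
  have -> : x *m P = col_perm (tperm i j) x by rewrite col_permE tpermV.
  by rewrite !mxE tpermL.
have sumq : \sum_i q i i = m%:R / m.+2%:R * e ^+ 2.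
  by rewrite -avg_sqr_enorm// avg_sum.
have qE i : q i i = e ^+ 2 / m.+2%:R.
  have m0 : m%:R != 0 :> R by rewrite pnatr_eq0 -lt0n (leq_ltn_trans _ (ltn_ord i)).
  have sE : \sum_j q j j = \sum_(j < m) q i i by apply: eq_bigr => j _; exact: qq.
  move: sumq; rewrite sE.
  rewrite sumr_const card_ord -(mulr_natl (q i i)) => h.
  by apply: (mulfI m0); rewrite h; ring.
transitivity (avg e (fun x => \sum_i \sum_j M j i * (x 0 j * x 0 i))).
  congr avg; apply/funext => x; apply: eq_bigr => i _.
  by rewrite mxE mulr_suml; apply: eq_bigr => j _; ring.
rewrite avg_sum// => [|i]; last first.
  by apply: continuous_sum => j; exact: (continuousT_mull (cc j i)).
rewrite /mxtrace mulr_sumr; apply: eq_bigr => i _.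
rewrite avg_sum// => [|j]; last first.
  exact: (continuousT_mull (cc j i)).
rewrite (bigD1 i)//= big1 ?addr0 => [|j ji].
  by rewrite avgZ// -/(q i i) qE mulrC.
by rewrite avgZ// -/(q j i) q0// mulr0.
Qed.

End ball_moments.

(** * Hyperplane means and their coupling *)

Section hyperplane_mean.
Variables (R : realType) (m : nat).
Local Notation n := m.+1.
Implicit Types (nu x y k : 'rV[R]_n) (e : R).

Definition hmean e nu (g : 'rV[R]_n -> R) : R :=
  avg e (fun s : 'rV[R]_m => g (s *m hyperplane_basis nu)).

(** Adding the unit vector along [nu] to the rows of [H] gives a square matrix with orthonormal
    rows, hence with orthonormal columns; the second property is the claim. *)
Lemma orthonormal_hyperplane_projection nu (H : 'M[R]_(m, n)) : nu != 0 ->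
  H *m H^T = 1%:M -> H *m nu^T = 0 ->
  H^T *m H = 1%:M - (dotv nu nu)^-1 *: (nu^T *m nu).
Proof.
move=> nu0 HH Hnu.
have d0 : 0 < enorm nu by rewrite enorm_gt0.
pose w := (enorm nu)^-1 *: nu.
have ww : w *m w^T = 1%:M.
  by rewrite mul_trmx_dotv !dotvE -sqr_enorm mulrA -expr2 exprVn mulVf// expf_neq0// gt_eqF.
have Hw : H *m w^T = 0 by rewrite linearZ /= -scalemxAr Hnu scaler0.
have wH : w *m H^T = 0 by rewrite -[LHS]trmxK trmx_mul trmxK Hw trmx0.
pose A : 'M[R]_(1 + m, n) := col_mx w H.
have AA : A *m A^T = 1%:M.
  by rewrite tr_col_mx mul_col_row ww HH Hw wH -scalar_mx_block.
have wE : w^T *m w = (dotv nu nu)^-1 *: (nu^T *m nu).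
  have -> : w^T = (enorm nu)^-1 *: nu^T by rewrite linearZ.
  rewrite -scalemxAl -scalemxAr scalerA -sqr_enorm; congr (_ *: _).
  by rewrite -expr2 exprVn.
have := mulmx1C AA; rewrite tr_col_mx mul_row_col wE => <-.
by rewrite addrC addKr.
Qed.

(** Two orthonormal bases of one hyperplane differ by the orthogonal matrix [H *m B^T], so rotation
    invariance applies. This frees [hmean] from the basis selected by [hyperplane_basis] and makes
    room for a coupled one. *)
Lemma avg_orthonormal_hyperplane e nu (H : 'M[R]_(m, n)) (g : 'rV[R]_n -> R) : nu != 0 ->
  H *m H^T = 1%:M -> H *m nu^T = 0 -> continuous g ->
  avg e (fun s => g (s *m H)) = hmean e nu g.
Proof.
move=> nu0 HH Hnu cg; have [BB Bnu] := hyperplane_basisP nu0.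
set B := hyperplane_basis nu in BB Bnu.
have PB := orthonormal_hyperplane_projection nu0 BB Bnu.
have HE : H *m B^T *m B = H.
  by rewrite -mulmxA PB mulmxBr mulmx1 -scalemxAr mulmxA Hnu mul0mx scaler0 subr0.
have OO : (H *m B^T) *m (H *m B^T)^T = 1%:M.
  by rewrite trmx_mul trmxK mulmxA HE.
rewrite /hmean -/B -[RHS](avg_rotation e OO); last first.
  exact: (continuousT_comp (@continuous_mulmx _ _ _ B) cg).
by congr avg; apply/funext => s; rewrite -mulmxA HE.
Qed.

Lemma continuous_hyperplane_point nu (g : 'rV[R]_n -> R) : continuous g ->
  continuous (fun s : 'rV[R]_m => g (s *m hyperplane_basis nu)).
Proof. by move=> cg; exact: (continuousT_comp (@continuous_mulmx _ _ _ _) cg). Qed.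

Lemma enorm_hyperplane_basis nu (s : 'rV[R]_m) : nu != 0 ->
  enorm (s *m hyperplane_basis nu) = enorm s.
Proof. by move=> nu0; have [BB _] := hyperplane_basisP nu0; exact: enorm_mulmx_orthogonal. Qed.

Lemma dotv_orthogonal (H : 'M[R]_(m, n)) nu (s : 'rV[R]_m) : H *m nu^T = 0 ->
  dotv (s *m H) nu = 0.
Proof.
move=> Hnu; have := mul_trmx_dotv (s *m H) nu.
by rewrite -mulmxA Hnu mulmx0 => /matrixP/(_ 0 0); rewrite !mxE.
Qed.

Lemma dotv_hyperplane_basis nu (s : 'rV[R]_m) : nu != 0 ->
  dotv (s *m hyperplane_basis nu) nu = 0.
Proof. by move=> nu0; have [_ Bnu] := hyperplane_basisP nu0; exact: dotv_orthogonal. Qed.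

(** [hyperplane_point] is an isometry onto the hyperplane, so the preimage of the hyperplane ball is
    the round ball of R^m. *)
Lemma tug_valueE p e u x nu : nu != 0 ->
  tug_value p e u x nu =
  alpha p x * u (x + nu) + (1 - alpha p x) * hmean e nu (fun h => u (x + h)).
Proof.
move=> nu0; rewrite /tug_value /hmean /avg /hyperplane_measure /hyperplane_integral.
have -> : hyperplane_point nu @^-1` hyperplane_ball e nu = @tball R m e.
  apply/seteqP; split => t; rewrite /hyperplane_ball /hyperplane_point /tball/=.
    by rewrite enorm_hyperplane_basis// => -[].
  by rewrite enorm_hyperplane_basis// dotv_hyperplane_basis.
by [].
Qed.

(** The form restricted to the hyperplane has matrix [B *m M *m B^T], whose trace is that of [M]
    times the projection. The hyperplane has dimension m, whence the denominator m + 2, which is n +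
    1. *)
Lemma hmean_quadratic e nu (M : 'M[R]_n) : 0 < e -> nu != 0 ->
  hmean e nu (fun h => dotv (h *m M) h) =
  e ^+ 2 / m.+2%:R * (\tr M - dotv (nu *m M) nu / dotv nu nu).
Proof.
move=> e0 nu0; rewrite /hmean; have [BB Bnu] := hyperplane_basisP nu0.
set B := hyperplane_basis nu in BB Bnu *.
transitivity (avg e (fun s : 'rV[R]_m => dotv (s *m (B *m M *m B^T)) s)).
  congr avg; apply/funext => s.
  have : (s *m B *m M) *m (s *m B)^T = (s *m (B *m M *m B^T)) *m s^T.
    by rewrite trmx_mul !mulmxA.
  by rewrite !mul_trmx_dotv => /matrixP/(_ 0 0); rewrite !mxE.
rewrite avg_quadratic//; congr (_ * _).
rewrite -mulmxA mxtrace_mulC -mulmxA (orthonormal_hyperplane_projection nu0 BB Bnu).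
rewrite mulmxBr mulmx1 raddfB/= -scalemxAr mxtraceZ; congr (_ - _).
by rewrite mulmxA mxtrace_mulC mulmxA mul_trmx_dotv mxtrace_scalar mulr1n mulrC.
Qed.

(* H' is obtained from the basis of nu^perp by the Householder reflection
   exchanging nu and nu'. *)
Lemma hyperplane_coupling e nu nu' : 0 < e -> enorm nu = e -> enorm nu' = e ->
  exists H' : 'M[R]_(m, n),
  [/\ forall g, continuous g -> avg e (fun s => g (s *m H')) = hmean e nu' g,
      forall s, enorm (s *m H') = enorm s,
      forall s, dotv (s *m H') nu' = 0 &
      forall s, dotv (nu - nu') (nu - nu') *
        enorm (s *m hyperplane_basis nu - s *m H') ^+ 2 <=
        4 * enorm s ^+ 2 * (4 * e ^+ 2 - dotv (nu - nu') (nu - nu'))].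
Proof.
move=> e0 en en'.
have nu0 : nu != 0 by rewrite -enorm_gt0 en.
have nu'0 : nu' != 0 by rewrite -enorm_gt0 en'.
have [BB Bnu] := hyperplane_basisP nu0; set B := hyperplane_basis nu in BB Bnu *.
suff [H' [HH Hnu' hs]] : exists H' : 'M[R]_(m, n),
    [/\ H' *m H'^T = 1%:M, H' *m nu'^T = 0 &
    forall s, dotv (nu - nu') (nu - nu') * enorm (s *m B - s *m H') ^+ 2 <=
        4 * enorm s ^+ 2 * (4 * e ^+ 2 - dotv (nu - nu') (nu - nu'))].
  exists H'; split => // [g cg|s|s].
  - exact: avg_orthonormal_hyperplane.
  - exact: enorm_mulmx_orthogonal.
  - exact: dotv_orthogonal.
have dn : dotv nu nu = e ^+ 2 by rewrite -sqr_enorm en.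
have dn' : dotv nu' nu' = e ^+ 2 by rewrite -sqr_enorm en'.
(* Equal directions define no reflection; one basis then serves both. *)
have [nn'|nn'] := eqVneq nu nu'.
  exists B; rewrite -nn' subrr dotv0l; split => // s.
  by rewrite mul0r subr0; have := sqr_ge0 (enorm s); have := sqr_ge0 e; nra.
pose k := nu - nu'.
have k0 : k != 0 by rewrite subr_eq0.
have kk0 : 0 < dotv k k by rewrite lt_def dotvv_eq0 k0 dotvv_ge0.
have kkE : dotv k k = 2 * e ^+ 2 - 2 * dotv nu nu'.
  by rewrite /k !dotvE dn dn' (dotvC nu' nu); ring.
pose Q : 'M[R]_n := 1%:M - (2 / dotv k k) *: (k^T *m k).
have QT : Q^T = Q.
  by rewrite /Q linearB /= trmx1 linearZ /= trmx_mul trmxK.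
have xQ x : x *m Q = x - (2 * dotv x k / dotv k k) *: k.
  rewrite /Q mulmxBr mulmx1 -scalemxAr mulmxA mul_trmx_dotv mul_scalar_mx scalerA.
  by congr (_ - _ *: _); ring.
have kQ : k *m Q = - k.
  by rewrite xQ mulfK ?gt_eqF// scaler_nat mulr2n opprD addrA subrr add0r.
have QQ : Q *m Q = 1%:M.
  rewrite {1}/Q mulmxBl mul1mx -scalemxAl -mulmxA kQ mulmxN scalerN opprK.
  by rewrite /Q subrK.
exists (B *m Q); split.
- by rewrite trmx_mul QT mulmxA -(mulmxA B Q) QQ mulmx1.
- have -> : nu'^T = Q *m nu^T.
    rewrite -[in RHS]QT -trmx_mul xQ; congr trmx.
    have -> : dotv nu k = dotv k k / 2.
      by rewrite kkE /k !dotvE dn; field.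
    by rewrite mulrCA mulfV ?mulr1 ?pnatr_eq0// divff ?gt_eqF// scale1r /k opprB addrC subrK.
  by rewrite mulmxA -(mulmxA B Q) QQ mulmx1.
move=> s; rewrite -/k mulmxA xQ opprB addrC subrK enormZ exprMn.
set h := s *m B; rewrite real_normK ?num_real// (sqr_enorm k).
have -> : enorm s = enorm h by rewrite /h enorm_mulmx_orthogonal.
have -> : 4 * e ^+ 2 - dotv k k = enorm (nu + nu') ^+ 2.
  by rewrite sqr_enorm kkE !dotvE dn dn' (dotvC nu' nu); ring.
(* As [h] is orthogonal to [nu], its product with nu - nu' is minus its product with nu + nu'.
   Cauchy-Schwarz then bounds the displacement through |nu + nu'|, which is small when the
   directions are nearly opposite. *)
have hnu : dotv h nu = 0 by exact: dotv_orthogonal.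
have -> : dotv h k = - dotv h (nu + nu') by rewrite /k !dotvE hnu; ring.
rewrite (_ : dotv k k * _ = 4 * dotv h (nu + nu') ^+ 2); last by field; rewrite gt_eqF.
rewrite -mulrA ler_pM2l// -exprMn -[leLHS]real_normK ?num_real//.
by rewrite ler_pXn2r ?nnegrE ?normr_dotv_le// mulr_ge0// enorm_ge0.
Qed.

End hyperplane_mean.

(** * The game operator and replies to near-optimal directions *)

Section midrange.
Variables (R : realType) (m : nat).
Local Notation n := m.+1.
Implicit Types (nu x y z h : 'rV[R]_n) (p u : 'rV[R]_n -> R) (e : R).

Definition tug_set p e u x : set R :=
  [set tug_value p e u x nu | nu in [set nu | enorm nu = e]].

Definition midrange p e u x : R := (sup (tug_set p e u x) + inf (tug_set p e u x)) / 2.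

Lemma exists_enorm e : 0 <= e -> exists nu : 'rV[R]_n, enorm nu = e.
Proof.
move=> e0; exists (e *: delta_mx 0 0); rewrite enormZ ger0_norm//.
rewrite /enorm (_ : dotv _ _ = 1) ?sqrtr1 ?mulr1//.
rewrite /dotv (bigD1 0)//= big1 ?addr0; last by move=> i i0; rewrite !mxE (negPf i0) !mul0r.
by rewrite !mxE !eqxx mulr1.
Qed.

Lemma continuous_translate u x : continuous u -> continuous (fun h => u (x + h)).
Proof.
apply: continuousT_comp.
apply: (@lipschitz_continuous_rV _ _ _ _ 1) => y z.
by rewrite opprD addrACA subrr add0r mul1r.
Qed.

Section midrange_at.
Variables (p u : 'rV[R]_n -> R) (e : R).
Hypotheses (e0 : 0 < e) (cu : continuous u).

Lemma direction_neq0 nu : enorm nu = e -> nu != 0.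
Proof. by move=> en; rewrite -enorm_gt0 en. Qed.

Lemma tug_le_cst x nu c : 0 <= alpha p x <= 1 -> enorm nu = e ->
  (forall h, enorm h <= e -> u (x + h) <= c) -> tug_value p e u x nu <= c.
Proof.
move=> /andP[a0 a1] en uc; rewrite tug_valueE ?direction_neq0//.
have h1 : u (x + nu) <= c by rewrite uc// en.
have h2 : hmean e nu (fun h => u (x + h)) <= c.
  apply: avg_le => //; first exact: (continuous_hyperplane_point (continuous_translate cu)).
  by move=> s se; apply: uc; rewrite enorm_hyperplane_basis ?direction_neq0// ltW.
set A := alpha p x in a0 a1 *; set B := hmean _ _ _ in h2 *; set C := u _ in h1 *.
have : 0 <= A * (c - C) by rewrite mulr_ge0// subr_ge0.
have : 0 <= (1 - A) * (c - B) by rewrite mulr_ge0// subr_ge0.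
lra.
Qed.

Lemma tug_ge_cst x nu c : 0 <= alpha p x <= 1 -> enorm nu = e ->
  (forall h, enorm h <= e -> c <= u (x + h)) -> c <= tug_value p e u x nu.
Proof.
move=> /andP[a0 a1] en uc; rewrite tug_valueE ?direction_neq0//.
have h1 : c <= u (x + nu) by rewrite uc// en.
have h2 : c <= hmean e nu (fun h => u (x + h)).
  apply: avg_ge => //; first exact: (continuous_hyperplane_point (continuous_translate cu)).
  by move=> s se; apply: uc; rewrite enorm_hyperplane_basis ?direction_neq0// ltW.
set A := alpha p x in a0 a1 *; set B := hmean _ _ _ in h2 *; set C := u _ in h1 *.
have : 0 <= A * (C - c) by rewrite mulr_ge0// subr_ge0.
have : 0 <= (1 - A) * (B - c) by rewrite mulr_ge0// subr_ge0.
lra.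
Qed.

Lemma tug_set_bounded x : 0 <= alpha p x <= 1 ->
  has_sup (tug_set p e u x) /\ has_inf (tug_set p e u x).
Proof.
move=> a01; have [M uM] := continuous_bounded_ball e (continuous_translate (x := x) cu).
have [nu en] := exists_enorm (ltW e0).
have ne : tug_set p e u x !=set0 by exists (tug_value p e u x nu); exists nu.
split; split => //.
  exists M => _ [mu em <-]; apply: tug_le_cst => // h he.
  by rewrite (le_trans (ler_norm _))// uM.
exists (- M) => _ [mu em <-]; apply: tug_ge_cst => // h he.
by have := uM h he; rewrite ler_norml => /andP[].
Qed.

Lemma tug_le_sup x nu : 0 <= alpha p x <= 1 -> enorm nu = e ->
  tug_value p e u x nu <= sup (tug_set p e u x).
Proof.
move=> a01 en; have [hs hi] := tug_set_bounded a01.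
by apply: sup_upper_bound hs _ _; exists nu.
Qed.

Lemma inf_le_tug x nu : 0 <= alpha p x <= 1 -> enorm nu = e ->
  inf (tug_set p e u x) <= tug_value p e u x nu.
Proof.
move=> a01 en; have [hs hi] := tug_set_bounded a01.
by apply: inf_lbound hi.2 _ _; exists nu.
Qed.

(** A near-infimal direction has a value close to the infimum, and its reply bounds the supremum
    from below; one good reply to each direction is therefore enough. *)
Lemma midrange_ge x c : 0 <= alpha p x <= 1 ->
  (forall nu, enorm nu = e -> exists2 mu, enorm mu = e &
     2 * c <= tug_value p e u x nu + tug_value p e u x mu) -> c <= midrange p e u x.
Proof.
move=> a01 hc; have [hs hi] := tug_set_bounded a01.
rewrite /midrange ler_pdivlMr//; apply/ler_addgt0Pr => d d0.
have [_ [nu en <-] nui] := inf_adherent d0 hi.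
have [mu em] := hc nu en; move: nui.
have := tug_le_sup a01 em.
set a := tug_value _ _ _ _ _; set b := tug_value _ _ _ _ _; set s := sup _; set i := inf _.
move: a b s i => a b s i; lra.
Qed.

Lemma midrange_near_inf x d : 0 <= alpha p x <= 1 -> 0 < d ->
  exists2 nu, enorm nu = e & forall mu, enorm mu = e ->
    tug_value p e u x nu + tug_value p e u x mu <= 2 * midrange p e u x + d.
Proof.
move=> a01 d0; have [hs hi] := tug_set_bounded a01.
have [_ [nu en <-] nui] := inf_adherent d0 hi.
exists nu => // mu em; rewrite /midrange mulrC divfK//.
have := tug_le_sup a01 em; move: nui.
set a := tug_value _ _ _ _ _; set b := tug_value _ _ _ _ _; set s := sup _; set i := inf _.
move: a b s i => a b s i; lra.
Qed.

End midrange_at.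

(** It is applied with [nu] near-optimal for the maximizer at [x] and [nu'] near-optimal for the
    minimizer at [z]; the replies bound the infimum at [x] from above and the supremum at [z] from
    below. This is the form in which the games at two points are coupled. *)
Lemma midrangeB_le p u e x z c : 0 < e -> continuous u ->
  0 <= alpha p x <= 1 -> 0 <= alpha p z <= 1 ->
  (forall nu nu', enorm nu = e -> enorm nu' = e ->
    exists mu mu', [/\ enorm mu = e, enorm mu' = e &
     (tug_value p e u x nu - tug_value p e u z nu') +
     (tug_value p e u x mu - tug_value p e u z mu') <= 2 * c]) ->
  midrange p e u x - midrange p e u z <= c.
Proof.
move=> e0 cu ax az hc.
have [hsx hix] := tug_set_bounded e0 cu ax.
have [hsz hiz] := tug_set_bounded e0 cu az.
rewrite /midrange -mulrBl ler_pdivrMr//; apply/ler_addgt0Pr => d d0.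
have d2 : 0 < d / 2 by rewrite divr_gt0.
have [_ [nu en <-] nus] := sup_adherent d2 hsx.
have [_ [nu' en' <-] nui] := inf_adherent d2 hiz.
have [mu [mu' [em em' h]]] := hc nu nu' en en'.
have := inf_le_tug e0 cu ax em; have := tug_le_sup e0 cu az em'; move: nus nui h.
set a := tug_value _ _ _ _ _; set b := tug_value _ _ _ _ _; set a' := tug_value _ _ _ _ _.
set b' := tug_value _ _ _ _ _; set s := sup _; set i := inf _; set s' := sup _; set i' := inf _.
move: a b a' b' s i s' i' => a b a' b' s i s' i'; lra.
Qed.

(** The change of sign exchanges the two players, so one-sided estimates have mirror images. *)
Lemma midrange_opp p u e x : 0 < e -> continuous u ->
  midrange p e (fun y => - u y) x = - midrange p e u x.
Proof.
move=> e0 cu; rewrite /midrange.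
have -> : tug_set p e (fun y => - u y) x = -%R @` tug_set p e u x.
  have tN nu : enorm nu = e -> tug_value p e (fun y => - u y) x nu = - tug_value p e u x nu.
    move=> en; have nu0 := direction_neq0 e0 en.
    rewrite !tug_valueE// /hmean avgN; first ring.
    exact: (continuous_hyperplane_point (continuous_translate cu)).
  apply/seteqP; split => [_ [nu en <-]|_ [_ [nu en <-] <-]].
    by exists (tug_value p e u x nu); [exists nu|rewrite tN].
  by exists nu => //; rewrite tN.
set S := tug_set p e u x.
have hs : sup (-%R @` S) = - inf S by rewrite /inf opprK.
have hi : inf (-%R @` S) = - sup S.
  rewrite /inf (_ : -%R @` (-%R @` S) = S)//.
  apply/seteqP; split => [_ [_ [y Sy <-] <-]|y Sy]; first by rewrite opprK.
  by exists (- y); [exists y|rewrite opprK].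
by rewrite hs hi; ring.
Qed.

End midrange.

(** * Comparison with barriers *)

Section barrier.
Variables (R : realType) (m : nat).
Local Notation n := m.+1.
Implicit Types (nu x y z h : 'rV[R]_n) (p u g : 'rV[R]_n -> R) (e : R).

Lemma midrange_le p u e x c : 0 < e -> continuous u -> 0 <= alpha p x <= 1 ->
  (forall nu, enorm nu = e -> exists2 nu', enorm nu' = e &
     tug_value p e u x nu + tug_value p e u x nu' <= 2 * c) -> midrange p e u x <= c.
Proof.
move=> e0 cu a01 hc; rewrite -lerN2 -midrange_opp//.
apply: midrange_ge => //; first exact: continuousT_opp.
have tN nu : enorm nu = e -> tug_value p e (fun y => - u y) x nu = - tug_value p e u x nu.
  move=> en; have nu0 := direction_neq0 e0 en.
  rewrite !tug_valueE// /hmean avgN; first ring.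
  exact: (continuous_hyperplane_point (continuous_translate cu)).
move=> nu en; have [nu' en' h] := hc nu en; exists nu' => //.
by rewrite !tN// mulrN -opprD lerN2.
Qed.

Lemma tug_le p u g e x nu : 0 < e -> continuous u -> continuous g ->
  0 <= alpha p x <= 1 -> enorm nu = e ->
  (forall h, enorm h <= e -> u (x + h) <= g (x + h)) ->
  tug_value p e u x nu <= tug_value p e g x nu.
Proof.
move=> e0 cu cg /andP[a0 a1] en ug; have nu0 := direction_neq0 e0 en.
rewrite !tug_valueE// lerD// ler_wpM2l ?subr_ge0//; first by rewrite ug// en.
apply: le_avg => //.
- exact: (continuous_hyperplane_point (continuous_translate cu)).
- exact: (continuous_hyperplane_point (continuous_translate cg)).
- by move=> s se; apply: ug; rewrite enorm_hyperplane_basis// ltW.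
Qed.

Lemma tug_affine p g e x nu c1 c2 : 0 < e -> continuous g -> enorm nu = e ->
  tug_value p e (fun y => c1 - c2 * g y) x nu = c1 - c2 * tug_value p e g x nu.
Proof.
move=> e0 cg en; have nu0 := direction_neq0 e0 en; rewrite !tug_valueE//.
have cg' := continuous_hyperplane_point (nu := nu) (continuous_translate (x := x) cg).
rewrite /hmean avgB ?avg_cst ?avgZ//; first ring.
  exact: cst_continuous.
exact: continuousT_mull.
Qed.

Definition bump (k : R) z x : R := expR (- (k * dotv (x - z) (x - z))).

Lemma bump_gt0 k z x : 0 < bump k z x.
Proof. exact: expR_gt0. Qed.

Lemma continuous_bump k z : continuous (bump k z).
Proof.
apply: (@continuousT_comp _ _ _ _ expR); last exact: continuous_expR.
apply: continuousT_opp; apply: continuousT_mull.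
have c : continuous (fun x => x - z).
  apply: (@lipschitz_continuous_rV _ _ _ _ 1) => x y.
  by rewrite opprB addrA subrK mul1r.
exact: continuous_dotv.
Qed.

Lemma bump_translate k z x h :
  bump k z (x + h) = bump k z x * expR (- (k * (2 * dotv (x - z) h + dotv h h))).
Proof.
rewrite /bump -expRD; congr expR; have -> : x + h - z = (x - z) + h by rewrite addrAC.
by move: (x - z) => w; rewrite !dotvE (dotvC h w); ring.
Qed.

Lemma bump_translate_ge k z x h :
  bump k z x * (1 - k * (2 * dotv (x - z) h + dotv h h)) <= bump k z (x + h).
Proof. by rewrite bump_translate ler_pM2l ?bump_gt0// expR_ge1Dx. Qed.

(** Only 1 + x <= exp x is used: for s >= 0 one has exp s >= (1 + s / 2)^2 and exp (-s) >= 1 - s,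
    and the claim is their sum. *)
Lemma cosh_ge (s : R) : 2 + s ^+ 2 / 4 <= expR s + expR (- s).
Proof.
wlog s0 : s / 0 <= s.
  move=> h; have [s0|s0] := leP 0 s; first exact: h.
  by have := h (- s); rewrite opprK sqrrN [expR s + _]addrC; apply; lra.
have h1 := expR_ge1Dx (s / 2); have h2 := expR_ge1Dx (- s).
have h3 : expR s = expR (s / 2) ^+ 2 by rewrite expr2 -expRD; congr expR; field.
have h4 : (1 + s / 2) ^+ 2 <= expR (s / 2) ^+ 2.
  rewrite ler_pXn2r// nnegrE; last exact: expR_ge0.
  lra.
rewrite h3; lra.
Qed.

Lemma hmean_bump_ge k z e x nu : 0 < e -> 0 < k -> enorm nu = e ->
  bump k z x * (1 - k * e ^+ 2) <= hmean e nu (fun h => bump k z (x + h)).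
Proof.
move=> e0 k0 en; have nu0 := direction_neq0 e0 en.
set B := hyperplane_basis nu; set w := x - z; set b := bump k z x.
have b0 : 0 < b by exact: bump_gt0.
have cl : continuous (fun s : 'rV[R]_m => dotv w (s *m B)).
  by apply: continuous_dotv; [exact: cst_continuous|exact: continuous_mulmx].
have cl' := continuousT_mull (c := b * k * 2) cl.
have -> : b * (1 - k * e ^+ 2) =
    avg e (fun s : 'rV[R]_m => b * (1 - k * e ^+ 2) - (b * k * 2) * dotv w (s *m B)).
  rewrite avgB ?avg_cst ?avgZ//; last exact: cst_continuous.
  by rewrite [avg e _]avg_odd ?mulr0 ?subr0// => s; rewrite mulNmx dotvNr.
apply: le_avg => //.
- by apply: continuousT_sub => //; exact: cst_continuous.
- exact: (continuous_hyperplane_point (continuous_translate (@continuous_bump _ _))).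
- move=> s se; apply: le_trans (bump_translate_ge _ _ _ _).
  rewrite -/b -/w -/B.
  have hs : dotv (s *m B) (s *m B) <= e ^+ 2.
    by rewrite -enorm_le_sqr ?ltW// enorm_hyperplane_basis// ltW.
  have := mulr_ge0 (ltW (mulr_gt0 b0 k0)) (_ : 0 <= e ^+ 2 - dotv (s *m B) (s *m B)).
  rewrite subr_ge0 => /(_ hs); set d := dotv w _; set q := dotv _ _.
  by clearbody b d q; lra.
Qed.

(** Strict subsolution property of the bump, as a reply to each [nu]. If [nu] has a large component
    along x - z, the reply -nu uses the convexity of the exponential along that line; otherwise the
    reply is a step straight towards [z], whose first-order gain exceeds the possible loss from
    [nu]. The numerical hypotheses let either gain outweigh the loss in the means. *)
Lemma bump_response p e k z x nu : 0 < e -> 0 < k -> 0 < alpha p x <= 1 -> enorm nu = e ->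
  k * e ^+ 2 <= 1 / 2 -> 16 <= alpha p x * k * dotv (x - z) (x - z) ->
  8 * e <= alpha p x * enorm (x - z) ->
  exists2 nu', enorm nu' = e & 2 * (bump k z x * (1 + k * e ^+ 2)) <=
    tug_value p e (bump k z) x nu + tug_value p e (bump k z) x nu'.
Proof.
move=> e0 k0 /andP[a0 a1] en ke A16 at8.
have nu0 := direction_neq0 e0 en.
have dn : dotv nu nu = e ^+ 2 by rewrite -sqr_enorm en.
set w := x - z in A16 at8 *; set t := enorm w in at8 *.
have wt : dotv w w = t ^+ 2 by rewrite sqr_enorm.
set a := alpha p x in a0 a1 A16 at8 *.
set b := bump k z x; have b0 : 0 < b by exact: bump_gt0.
have t0 : 0 < t.
  have : 0 < a * t by apply: lt_le_trans at8; rewrite mulr_gt0.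
  by rewrite pmulr_rgt0.
have hm mu : enorm mu = e ->
    b * (a * expR (- (k * (2 * dotv w mu + e ^+ 2))) + (1 - a) * (1 - k * e ^+ 2)) <=
    tug_value p e (bump k z) x mu.
  move=> em; rewrite tug_valueE ?(direction_neq0 e0 em)// -/a mulrDr.
  rewrite bump_translate -/b -/w -sqr_enorm em mulrCA lerD2l mulrCA.
  by rewrite ler_wpM2l ?subr_ge0//; exact: hmean_bump_ge.
have [big|small] := leP (t ^+ 2 * e ^+ 2) (2 * dotv w nu ^+ 2).
  exists (- nu); first by rewrite enormN.
  apply: le_trans (lerD (hm nu en) (hm (- nu) _)); last by rewrite enormN.
  rewrite dotvNr; set d := dotv w nu in big *.
  have E1 : expR (- (k * (2 * d + e ^+ 2))) = expR (- (k * e ^+ 2)) * expR (- (2 * k * d)).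
    by rewrite -expRD; congr expR; ring.
  have E2 : expR (- (k * (2 * - d + e ^+ 2))) = expR (- (k * e ^+ 2)) * expR (2 * k * d).
    by rewrite -expRD; congr expR; ring.
  rewrite -mulrDr addrACA -mulrDr E1 E2 -mulrDr [expR (- (2 * k * d)) + _]addrC.
  have H1 := expR_ge1Dx (- (k * e ^+ 2)).
  have H2 := cosh_ge (2 * k * d).
  have H3 : (1 - k * e ^+ 2) * (2 + (2 * k * d) ^+ 2 / 4) <=
     expR (- (k * e ^+ 2)) * (expR (2 * k * d) + expR (- (2 * k * d))).
    apply: ler_pM => //; first by lra.
    by rewrite addr_ge0// divr_ge0// sqr_ge0.
  have H4 : k ^+ 2 * (t ^+ 2 * e ^+ 2) / 2 <= (2 * k * d) ^+ 2 / 4.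
    rewrite (_ : (2 * k * d) ^+ 2 / 4 = k ^+ 2 * (2 * d ^+ 2) / 2); last by field.
    by rewrite ler_pM2r// ler_pM2l ?exprn_gt0.
  rewrite mulrCA ler_pM2l//.
  apply: (@le_trans _ _ (a * ((1 - k * e ^+ 2) * (2 + k ^+ 2 * (t ^+ 2 * e ^+ 2) / 2)) +
     2 * ((1 - a) * (1 - k * e ^+ 2)))).
    set q := k * e ^+ 2 in ke *.
    have q0 : 0 < q by rewrite mulr_gt0// exprn_gt0.
    have -> : a * ((1 - q) * (2 + k ^+ 2 * (t ^+ 2 * e ^+ 2) / 2)) + 2 * ((1 - a) * (1 - q)) =
      2 * (1 - q) + (1 - q) * q * (a * k * t ^+ 2) / 2 by rewrite /q; ring.
    rewrite wt in A16; set A := a * k * t ^+ 2 in A16 *.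
    clearbody q A => {H1 H2 H3 H4 E1 E2}.
    have h1 : 0 <= (1/2 - q) * q * A by rewrite !mulr_ge0 ?(ltW q0)//; lra.
    have h2 : 0 <= q * (A - 16) by rewrite mulr_ge0 ?(ltW q0)// subr_ge0.
    lra.
  rewrite [X in _ + X <= _](_ : _ = (1 - a) * (1 - k * e ^+ 2) + (1 - a) * (1 - k * e ^+ 2)); last by ring.
  rewrite lerD2r ler_pM2l//; apply: le_trans H3.
  by rewrite ler_pM2l ?lerD2l//; lra.
exists (- (e / t) *: w).
  by rewrite enormZ normrN ger0_norm ?divr_ge0 ?ltW// -/t divfK// gt_eqF.
set mu := - (e / t) *: w.
have em : enorm mu = e by rewrite enormZ normrN ger0_norm ?divr_ge0 ?ltW// -/t divfK// gt_eqF.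
apply: le_trans (lerD (hm nu en) (hm mu em)).
have -> : dotv w mu = - (t * e).
  by rewrite /mu dotvZr wt mulNr expr2 mulrA divfK ?gt_eqF// mulrC.
set d := dotv w nu in small *.
(* In this case d^2 < t^2 e^2 / 2 and 1 / 2 < (3 / 4)^2, so at least a quarter of the first-order
   gain of the step towards [z] survives. *)
have dsmall : d <= 3 / 4 * (t * e).
  rewrite leNgt; apply/negP => h.
  have : (3 / 4 * (t * e)) ^+ 2 < d ^+ 2.
    by rewrite ltr_pXn2r// nnegrE; have := mulr_gt0 t0 e0; lra.
  have := sqr_ge0 (t * e); rewrite !exprMn; lra.
clearbody a d.
have H1 := expR_ge1Dx (- (k * (2 * d + e ^+ 2))).
have H2 := expR_ge1Dx (- (k * (2 * - (t * e) + e ^+ 2))).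
rewrite -mulrDr mulrCA ler_pM2l//.
have A1 := ler_wpM2l (ltW a0) H1; have A2 := ler_wpM2l (ltW a0) H2.
apply: (@le_trans _ _ (a * (1 + - (k * (2 * d + e ^+ 2))) + a * (1 + - (k * (2 * - (t * e) + e ^+ 2))) + 2 * ((1 - a) * (1 - k * e ^+ 2)))); last by lra.
have : 0 <= a * k * (3 / 4 * (t * e) - d) by rewrite !mulr_ge0 ?subr_ge0 ?(ltW a0) ?(ltW k0) ?(ltW e0)//.
have : 0 <= k * e * (a * t - 8 * e) by rewrite !mulr_ge0 ?subr_ge0 ?(ltW a0) ?(ltW k0) ?(ltW e0)//.
lra.
Qed.

(** At a point where u minus the barrier has a positive maximum M, the tug values of u are at most M
    plus those of the barrier, and [bump_response] makes the resulting mid-range too small. The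
    datum [f] is constrained only after multiplication by [d], since nothing is known about it where
    the cutoff vanishes. *)
Lemma barrier_comparison p u e k z c1 c2 (X : set 'rV[R]_n) :
  0 < e -> continuous u -> compact X -> 0 < k -> 0 < c2 -> k * e ^+ 2 <= 1 / 2 ->
  (forall x, X x -> u x <= c1 - c2 * bump k z x \/
     [/\ 0 < alpha p x <= 1, 16 <= alpha p x * k * dotv (x - z) (x - z),
         8 * e <= alpha p x * enorm (x - z),
         forall h, enorm h <= e -> X (x + h) &
         exists d f, [/\ 0 <= d <= 1, u x = (1 - d) * midrange p e u x + d * f &
                         d * f <= d * (c1 - c2 * bump k z x)]]) ->
  forall x, X x -> u x <= c1 - c2 * bump k z x.
Proof.
move=> e0 cu cX k0 c20 ke hX.
pose v x := c1 - c2 * bump k z x.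
have cb := @continuous_bump k z.
have cv : continuous v.
  by apply: continuousT_sub; [exact: cst_continuous|exact: continuousT_mull].
move=> y Xy; have [c Xc cM] : exists2 c, c \in X & forall t, t \in X -> u t - v t <= u c - v c.
  apply: EVT_max_rV => //; first by exists y.
  exact: (continuous_subspaceT (continuousT_sub cu cv)).
rewrite inE in Xc.
suff M0 : u c - v c <= 0.
  by rewrite -subr_le0 (le_trans _ M0)// cM// inE.
have [h|[a01 A16 at8 Xh [d [f [/andP[d0 d1] uE fv]]]]] := hX c Xc.
  by rewrite subr_le0.
have [M ME] : {M | M = u c - v c} by exists (u c - v c).
rewrite -ME in cM *; rewrite leNgt; apply/negP => Mpos.
have [a0 a1] := andP a01.
have a01' : 0 <= alpha p c <= 1 by rewrite ltW.
have hB : midrange p e u c <= M + v c - c2 * (bump k z c * (k * e ^+ 2)).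
  apply: midrange_le => // nu en.
  have [nu' en' h] := bump_response e0 k0 a01 en ke A16 at8.
  exists nu' => //.
  have tu mu : enorm mu = e -> tug_value p e u c mu <= M + c1 - c2 * tug_value p e (bump k z) c mu.
    move=> em; rewrite -tug_affine//; apply: tug_le => //.
      by apply: continuousT_sub; [exact: cst_continuous|exact: continuousT_mull].
    move=> h' he; have : u (c + h') - v (c + h') <= M by apply: cM; rewrite inE; exact: Xh.
    by rewrite lerBlDr /v addrA.
  apply: (le_trans (lerD (tu _ en) (tu _ en'))).
  have := ler_wpM2l (ltW c20) h.
  rewrite /v; move: (tug_value _ _ _ _ _) (tug_value _ _ _ _ _) (bump k z c) => A B b.
  by clear; lra.
have s0 : 0 < c2 * (bump k z c * (k * e ^+ 2)).
  by rewrite !mulr_gt0 ?bump_gt0// exprn_gt0.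
have uM : u c = M + v c by rewrite ME subrK.
move: hB s0 uE fv; rewrite -/(v c) uM.
move: (c2 * _) (midrange p e u c) (v c) => s mid w hB s0 uE fv; clear - hB s0 uE fv d0 d1 Mpos.
have h1 : (1 - d) * mid <= (1 - d) * (M + w - s) by rewrite ler_wpM2l// subr_ge0.
(* For d = 1 the strict gain is multiplied by 0, and the bound on [f] alone contradicts M > 0. *)
have [d1E|dn1] := eqVneq d 1; first by move: uE fv; rewrite d1E; lra.
have d1' : 0 < 1 - d by rewrite subr_gt0 lt_neqAle dn1.
have : 0 < (1 - d) * s by rewrite mulr_gt0.
have : 0 <= d * M by rewrite mulr_ge0// ltW.
lra.
Qed.

End barrier.

(** * Coupling estimate *)

Section fourth_roots.
Variable R : realType.
Implicit Types s r f h c q t : R.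

Lemma le_of_sqr (x y : R) : 0 <= y -> x ^+ 2 <= y ^+ 2 -> x <= y.
Proof.
move=> y0 xy; have [x0|x0] := leP x 0; first exact: le_trans y0.
by rewrite -(@ler_pXn2r _ 2)// nnegrE ltW.
Qed.

(** Tangent inequality of the concave fourth root, in terms of the roots themselves; the defect is
    (q - s)^2 (q^2 + 2 q s + 3 s^2) divided by 4 s^3. *)
Lemma sqrt_sqrt_tangent s q : 0 < s -> 0 <= q -> q <= s + (q ^+ 4 - s ^+ 4) / (4 * s ^+ 3).
Proof.
move=> s0 q0; rewrite -lerBlDl ler_pdivlMr ?mulr_gt0// ?exprn_gt0//.
have h : 0 <= (q - s) ^+ 2 * (q ^+ 2 + 2 * q * s + 3 * s ^+ 2).
  by rewrite mulr_ge0 ?sqr_ge0// !addr_ge0 ?mulr_ge0 ?sqr_ge0// ltW.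
lra.
Qed.

(** Here s, f, h are the square roots of |w|, |w + k|, |w - k|, with c = <w, k>, q = |k|^2 and r = e
    / |w|. The hypothesis on [c] says that [k] points almost along [w] with length near 2 e, and the
    conclusion quantifies strict concavity there. The chain bounds f h, then f^2 + h^2, then (f +
    h)^2, squaring until only fourth powers remain. *)
Lemma fourth_roots_concave s r f h c q : 0 < s -> 0 < r -> r <= 1 / 10 ->
  0 <= f -> 0 <= h -> f ^+ 4 = s ^+ 4 + 2 * c + q -> h ^+ 4 = s ^+ 4 - 2 * c + q ->
  q <= 4 * r ^+ 2 * s ^+ 4 -> 47 / 24 * r * s ^+ 4 <= c ->
  f + h <= s * (2 - r ^+ 2 / 2).
Proof.
move=> s0 r0 r1 f0 h0 fE hE qle cge.
have [y yE] : {y | y = r ^+ 2} by exists (r ^+ 2).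
have y0 : 0 < y by rewrite yE exprn_gt0.
have y1 : y <= 1 / 100.
  have -> : 1 / 100 = (1 / 10) ^+ 2 :> R by clear; field.
  by rewrite yE ler_pXn2r ?nnegrE ?(ltW r0)//; clear; lra.
have S2 : s ^+ 4 = (s ^+ 2) ^+ 2 by clear; ring.
have S0 : 0 < s ^+ 4 by rewrite exprn_gt0.
have [S SE] : {S | S = s ^+ 4} by exists (s ^+ 4).
rewrite -SE -?yE in fE hE qle cge S0 S2 *.
have q0 : 0 <= S + q.
  have : 0 <= f ^+ 4 + h ^+ 4 by rewrite addr_ge0// exprn_ge0.
  by rewrite fE hE; clear; lra.
have rS0 : 0 <= 47 / 24 * r * S by rewrite !mulr_ge0 ?(ltW r0) ?(ltW S0)//; clear; lra.
have c2 : (47 / 24) ^+ 2 * y * S ^+ 2 <= c ^+ 2.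
  rewrite yE -!exprMn ler_pXn2r ?nnegrE//; exact: le_trans cge.
have y4 : 0 <= 1 + 4 * y by clear - y0; lra.
have y36 : 0 <= 1 - 36 / 10 * y by clear - y1; lra.
have q2 : (S + q) ^+ 2 <= (S * (1 + 4 * y)) ^+ 2.
  rewrite ler_pXn2r ?nnegrE ?(mulr_ge0 (ltW S0))//; clear - qle; lra.
have prod : (f * h) ^+ 4 <= (S * (1 - 36 / 10 * y)) ^+ 2.
  have -> : (f * h) ^+ 4 = (S + q) ^+ 2 - 4 * c ^+ 2 by rewrite exprMn fE hE; clear; ring.
  apply: (@le_trans _ _ (S ^+ 2 * ((1 + 4 * y) ^+ 2 - 4 * (47 / 24) ^+ 2 * y))).
    by move: c2 q2; rewrite (exprMn _ S); clear; lra.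
  rewrite (exprMn _ S) ler_pM2l ?exprn_gt0//.
  have : 0 <= y * (1 / 100 - y) by rewrite mulr_ge0 ?(ltW y0)// subr_ge0.
  by clear - y0; lra.
have fh2 : (f * h) ^+ 2 <= S * (1 - 36 / 10 * y).
  apply: le_of_sqr; first by rewrite (mulr_ge0 (ltW S0)).
  by rewrite -exprM.
have yy := sqr_ge0 y.
have fh : f * h <= s ^+ 2 * (1 - 18 / 10 * y).
  apply: le_of_sqr; first by rewrite mulr_ge0 ?sqr_ge0//; clear - y1; lra.
  apply: (le_trans fh2); rewrite exprMn -S2 ler_pM2l//.
  by clear - yy; lra.
have ff : f ^+ 2 + h ^+ 2 <= s ^+ 2 * (2 + 2 / 10 * y).
  apply: le_of_sqr; first by rewrite mulr_ge0 ?sqr_ge0//; clear - y0; lra.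
  have -> : (f ^+ 2 + h ^+ 2) ^+ 2 = f ^+ 4 + h ^+ 4 + 2 * (f * h) ^+ 2 by clear; ring.
  rewrite fE hE [X in _ <= X]exprMn -S2.
  apply: (@le_trans _ _ (S * (4 + 8 / 10 * y))); first by clear - fh2 qle; lra.
  by rewrite ler_pM2l//; clear - yy; lra.
apply: le_of_sqr; first by rewrite mulr_ge0 ?(ltW s0)//; clear - y1; lra.
have -> : (f + h) ^+ 2 = f ^+ 2 + h ^+ 2 + 2 * (f * h) by clear; ring.
apply: (@le_trans _ _ (s ^+ 2 * (4 - 34 / 10 * y))); first by clear - fh ff; lra.
by rewrite exprMn ler_pM2l ?exprn_gt0//; clear - yy y0; lra.
Qed.

Lemma sqrt_subadd (a b : R) : 0 <= a -> 0 <= b -> Num.sqrt (a + b) <= Num.sqrt a + Num.sqrt b.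
Proof.
move=> a0 b0; apply: le_of_sqr; first by rewrite addr_ge0// sqrtr_ge0.
rewrite sqrrD !sqr_sqrtr ?addr_ge0//.
have : 0 <= Num.sqrt a * Num.sqrt b by rewrite mulr_ge0// sqrtr_ge0.
lra.
Qed.

End fourth_roots.

(** * The square root of the Euclidean norm *)

Section sqrt_norm.
Variables (R : realType) (m : nat).
Local Notation n := m.+1.
Implicit Types (w k nu x z : 'rV[R]_n).

(** Its fourth power is [dotv w w], so inequalities about it become polynomial. *)
Definition rootn w : R := Num.sqrt (enorm w).

Lemma rootn_ge0 w : 0 <= rootn w. Proof. exact: sqrtr_ge0. Qed.

Lemma rootn2 w : rootn w ^+ 2 = enorm w.
Proof. by rewrite sqr_sqrtr// enorm_ge0. Qed.

Lemma rootn4 w : rootn w ^+ 4 = dotv w w.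
Proof. by rewrite -sqr_enorm -rootn2 -exprM. Qed.

Lemma rootn_gt0 w : w != 0 -> 0 < rootn w.
Proof. by move=> w0; rewrite sqrtr_gt0 enorm_gt0. Qed.

Lemma rootn_le w w' : enorm w <= enorm w' -> rootn w <= rootn w'.
Proof. by move=> h; rewrite ler_wsqrtr. Qed.

Lemma rootn_tangent w k : w != 0 ->
  rootn (w + k) <= rootn w + (2 * dotv w k + dotv k k) / (4 * rootn w ^+ 3).
Proof.
move=> w0; apply: le_trans (sqrt_sqrt_tangent (rootn_gt0 w0) (rootn_ge0 _)) _.
rewrite !rootn4 lerD2l ler_pM2r; last by rewrite invr_gt0 mulr_gt0// exprn_gt0// rootn_gt0.
by rewrite !dotvE (dotvC k w); lra.
Qed.

Lemma rootn_crude w k (e : R) : enorm k <= 2 * e -> rootn (w + k) <= rootn w + Num.sqrt (2 * e).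
Proof.
move=> ke; have e0 : 0 <= 2 * e by rewrite (le_trans (enorm_ge0 k)).
apply: le_trans (sqrt_subadd (enorm_ge0 w) e0).
by rewrite ler_wsqrtr// (le_trans (ler_enormD _ _))// lerD2l.
Qed.

(** Meant for tangent bounds, whose linear part is odd in the random displacement. *)
Lemma avg_le_odd (e c : R) (f l : 'rV[R]_m -> R) : 0 < e -> continuous f -> continuous l ->
  (forall s, l (- s) = - l s) -> (forall s, enorm s < e -> f s <= c + l s) -> avg e f <= c.
Proof.
move=> e0 cf cl ol fl; rewrite -[leRHS]addr0 -(avg_odd e cl ol).
rewrite -{1}(avg_cst m c e0) -avgD//; last exact: cst_continuous.
apply: le_avg => //; apply: continuousT_add => //; exact: cst_continuous.
Qed.

End sqrt_norm.

(** * One coupled step of two tokens *)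

Section coupled_step.
Variables (R : realType) (m : nat).
Local Notation n := m.+1.
Variables (p u : 'rV[R]_n -> R) (e : R) (x z : 'rV[R]_n).
Hypotheses (e0 : 0 < e) (cu : continuous u).
Hypotheses (ax : 0 <= alpha p x <= 1) (az : 0 <= alpha p z <= 1).
Implicit Types nu h : 'rV[R]_n.
Local Notation mean nu y := (hmean e nu (fun h => u (y + h))).

(** The difference when exactly one token is moved by a player, namely the one with the larger
    [alpha], while the other moves at random. *)
Definition mixed_difference nu nu' : R :=
  if alpha p z <= alpha p x then u (x + nu) - mean nu' z else mean nu x - u (z + nu').

(* With probability min(alpha x, alpha z) both points are moved by the players,
   with probability |alpha x - alpha z| exactly one is, and otherwise both
   points move at random. *)
Lemma tug_difference_le nu nu' A1 A2 A3 : enorm nu = e -> enorm nu' = e ->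
  u (x + nu) - u (z + nu') <= A1 -> mixed_difference nu nu' <= A2 ->
  mean nu x - mean nu' z <= A3 ->
  let a := Num.min (alpha p x) (alpha p z) in
  let d := `|alpha p x - alpha p z| in
  tug_value p e u x nu - tug_value p e u z nu' <= a * A1 + d * A2 + (1 - a - d) * A3.
Proof.
move=> en en' h1 h2 h3 /=; rewrite !tug_valueE ?(direction_neq0 e0)//.
move: h1 h2 h3; rewrite /mixed_difference.
move: (u _) (u _) (mean _ _) (mean _ _) ax az => U V M N.
move: (alpha p x) (alpha p z) => a a' /andP[a0 a1] /andP[a0' a1'].
move=> h1 + h3; case: (leP a' a) => aa h2.
  have H1 := ler_wpM2l a0' h1.
  have da : 0 <= a - a' by rewrite subr_ge0.
  have H2 := ler_wpM2l da h2.
  have a1a : 0 <= 1 - a by rewrite subr_ge0.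
  have H3 := ler_wpM2l a1a h3.
  by rewrite ger0_norm//; clear - H1 H2 H3; lra.
have H1 := ler_wpM2l a0 h1.
have da : 0 <= a' - a by rewrite subr_ge0 ltW.
have H2 := ler_wpM2l da h2.
have a1a : 0 <= 1 - a' by rewrite subr_ge0.
have H3 := ler_wpM2l a1a h3.
by rewrite ltr0_norm ?subr_lt0//; clear - H1 H2 H3; lra.
Qed.

Let cH nu y : continuous (fun s : 'rV[R]_m => u (y + s *m hyperplane_basis nu)).
Proof. exact: (continuous_hyperplane_point (continuous_translate cu)). Qed.

Section crude.
Variable c : R.
Hypothesis uc : forall h h', enorm h <= e -> enorm h' <= e -> u (x + h) - u (z + h') <= c.

Lemma mixed_difference_crude nu nu' : enorm nu = e -> enorm nu' = e ->
  mixed_difference nu nu' <= c.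
Proof.
move=> en en'; rewrite /mixed_difference; case: ifP => _.
  rewrite lerBlDr -lerBlDl; apply: avg_ge => // s se.
  rewrite lerBlDr -lerBlDl; apply: uc; rewrite ?en//.
  by rewrite enorm_hyperplane_basis ?(direction_neq0 e0)// ltW.
rewrite lerBlDr; apply: avg_le => // s se.
rewrite -lerBlDr; apply: uc; rewrite ?en'//.
by rewrite enorm_hyperplane_basis ?(direction_neq0 e0)// ltW.
Qed.

Lemma mean_difference_crude nu nu' : enorm nu = e -> enorm nu' = e ->
  mean nu x - mean nu' z <= c.
Proof.
move=> en en'; rewrite /hmean -avgB//; apply: avg_le => //.
  exact: continuousT_sub.
by move=> s se; apply: uc; rewrite enorm_hyperplane_basis ?(direction_neq0 e0)// ltW.
Qed.

End crude.

Section tangent.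
Variables B C : R.
Hypotheses (C0 : 0 <= C) (w0 : x - z != 0).
Hypothesis uB : forall h h', enorm h <= e -> enorm h' <= e ->
  u (x + h) - u (z + h') <= B + C * rootn (x - z + (h - h')).
Local Notation w := (x - z).
Local Notation s0 := (rootn (x - z)).

(** The linear part is kept as a separate summand, to be averaged away; the quadratic part enters
    only through a bound [q], which each coupling supplies in its own way. *)
Let uT h h' q : enorm h <= e -> enorm h' <= e -> dotv (h - h') (h - h') <= q ->
  u (x + h) - u (z + h') <= B + C * (s0 + q / (4 * s0 ^+ 3)) + C / (2 * s0 ^+ 3) * dotv w (h - h').
Proof.
move=> he he' hq; apply: (le_trans (uB he he')).
rewrite -(addrA B) lerD2l; have rt := rootn_tangent (h - h') w0.
apply: (le_trans (ler_wpM2l C0 rt)).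
have s00 : 0 < s0 by exact: rootn_gt0.
have s3 : 0 < 4 * s0 ^+ 3 by rewrite mulr_gt0// exprn_gt0.
have -> : C * (s0 + q / (4 * s0 ^+ 3)) + C / (2 * s0 ^+ 3) * dotv w (h - h') =
   C * (s0 + (2 * dotv w (h - h') + q) / (4 * s0 ^+ 3)).
  by move: s00; move: (dotv w (h - h')) (rootn w) => t s s00; field; rewrite gt_eqF.
by rewrite ler_wpM2l// lerD2l ler_pM2r ?invr_gt0// lerD2l.
Qed.

Lemma dotvB_le_sqr h h' : enorm h <= e -> enorm h' <= e ->
  dotv (h - h') (h - h') <= 4 * e ^+ 2.
Proof.
move=> he he'; have -> : 4 * e ^+ 2 = (2 * e) ^+ 2 by ring.
rewrite -enorm_le_sqr; last by rewrite mulr_ge0// ltW.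
by rewrite (le_trans (ler_enormB _ _))// mulr_natl mulr2n lerD.
Qed.

(** The token moving at random contributes an odd linear term; what remains is the first-order
    effect of the single player's step and the crude bound 4 e^2 on the squared relative
    displacement. *)
Lemma mixed_difference_tangent nu nu' : enorm nu = e -> enorm nu' = e ->
  mixed_difference nu nu' <= B + C * (s0 + (2 *
    (if alpha p z <= alpha p x then dotv w nu else - dotv w nu') + 4 * e ^+ 2) / (4 * s0 ^+ 3)).
Proof.
move=> en en'; have s00 : 0 < s0 by exact: rootn_gt0.
have cl (t : R) nu1 : continuous (fun s : 'rV[R]_m => t * dotv w (s *m hyperplane_basis nu1)).
  apply: continuousT_mull; apply: continuous_dotv; [exact: cst_continuous|exact: continuous_mulmx].
have ol (t : R) nu1 (s : 'rV[R]_m) :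
    t * dotv w (- s *m hyperplane_basis nu1) = - (t * dotv w (s *m hyperplane_basis nu1)).
  by rewrite mulNmx dotvNr mulrN.
have eq t : B + C * (s0 + (2 * t + 4 * e ^+ 2) / (4 * s0 ^+ 3)) =
   B + C * (s0 + (4 * e ^+ 2) / (4 * s0 ^+ 3)) + C / (2 * s0 ^+ 3) * t.
  by move: s00; move: (rootn w) => s s00; field; rewrite gt_eqF.
rewrite /mixed_difference; case: ifP => _; rewrite eq.
  rewrite /hmean -[X in X - _](avg_cst m (u (x + nu)) e0) -avgB//; last exact: cst_continuous.
  apply: (avg_le_odd (l := fun s => (- (C / (2 * s0 ^+ 3))) * dotv w (s *m hyperplane_basis nu'))) => //.
    by apply: continuousT_sub => //; exact: cst_continuous.
  move=> s se; have he : enorm (s *m hyperplane_basis nu') <= e.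
    by rewrite enorm_hyperplane_basis ?(direction_neq0 e0)// ltW.
  have he' : enorm nu <= e by rewrite en.
  apply: (le_trans (uT he' he (dotvB_le_sqr he' he))).
  rewrite dotvDr dotvNr; move: (C / _) (dotv w nu) (dotv w _) (B + _) => a b c d; lra.
rewrite /hmean -[X in _ - X](avg_cst m (u (z + nu')) e0) -avgB//; last exact: cst_continuous.
apply: (avg_le_odd (l := fun s => (C / (2 * s0 ^+ 3)) * dotv w (s *m hyperplane_basis nu))) => //.
  by apply: continuousT_sub => //; exact: cst_continuous.
move=> s se; have he : enorm (s *m hyperplane_basis nu) <= e.
  by rewrite enorm_hyperplane_basis ?(direction_neq0 e0)// ltW.
have he' : enorm nu' <= e by rewrite en'.
apply: (le_trans (uT he he' (dotvB_le_sqr he he'))).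
rewrite dotvDr dotvNr; move: (C / _) (dotv w nu') (dotv w _) (B + _) => a b c d; lra.
Qed.

(** Both random displacements are driven by the same variable through [hyperplane_coupling]. The
    first alternative on [q] is the trivial bound on the relative displacement, the second is that
    of the reflection, good when [nu] and [nu'] are nearly opposite. *)
Lemma mean_difference_tangent nu nu' q : enorm nu = e -> enorm nu' = e ->
  (4 * e ^+ 2 <= q \/ 0 < dotv (nu - nu') (nu - nu') /\
     4 * e ^+ 2 * (4 * e ^+ 2 - dotv (nu - nu') (nu - nu')) <= dotv (nu - nu') (nu - nu') * q) ->
  mean nu x - mean nu' z <= B + C * (s0 + q / (4 * s0 ^+ 3)).
Proof.
move=> en en' hq; have [H' [HE Hn Hd Hk]] := hyperplane_coupling e0 en en'.
have nu0 := direction_neq0 e0 en.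
rewrite -(HE (fun h => u (z + h))); last exact: continuous_translate.
have cH' : continuous (fun s : 'rV[R]_m => u (z + s *m H')).
  exact: (continuousT_comp (@continuous_mulmx _ _ _ _) (continuous_translate cu)).
rewrite /hmean -avgB//.
apply: (avg_le_odd (l := fun s => (C / (2 * s0 ^+ 3)) * dotv w (s *m hyperplane_basis nu - s *m H'))) => //.
- exact: continuousT_sub.
- apply: continuousT_mull; under eq_fun do rewrite -mulmxBr.
  by apply: continuous_dotv; [exact: cst_continuous|exact: continuous_mulmx].
- by move=> s; rewrite !mulNmx -opprD dotvNr mulrN.
move=> s se; apply: uT.
- by rewrite enorm_hyperplane_basis// ltW.
- by rewrite Hn ltW.
have h4 : dotv (s *m hyperplane_basis nu - s *m H') (s *m hyperplane_basis nu - s *m H') <= 4 * e ^+ 2.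
  by apply: dotvB_le_sqr; rewrite ?enorm_hyperplane_basis ?Hn// ltW.
case: hq => [hq|[k0 hq]]; first exact: le_trans hq.
rewrite -(ler_pM2l k0) -(sqr_enorm (s *m hyperplane_basis nu - s *m H')); apply: (le_trans (Hk s)); apply: le_trans hq.
have k4 : 0 <= 4 * e ^+ 2 - dotv (nu - nu') (nu - nu').
  by rewrite subr_ge0; apply: dotvB_le_sqr; rewrite ?en ?en'.
rewrite ler_wpM2r// ler_pM2l// ler_pXn2r ?nnegrE ?enorm_ge0 ?ltW//.
Qed.

End tangent.

End coupled_step.

(** * Scalar inequalities behind the three regimes *)

Section coupling_arithmetic.
Variable R : realType.
Implicit Types (a d y S f h C B K J Theta sig k kl v cs rr e r t c kk E : R).

(** Here and in [near_arith], [cs] is C |x - z|^(1/2), [rr] the crude increment C (2 e)^(1/2), [k]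
    the exponential term of the gauge, and [Theta] the excess over the gauge; in [near_arith], [kl]
    is the exponential term at a distance smaller by [e]. *)
Lemma meeting_arith a a0J J K k cs rr sig Theta : k <= K -> a0J <= a * (J + cs + rr) ->
  2 * rr + 2 * K + 2 * sig <= a0J ->
  (Theta + J + (cs + rr)) + (a * Theta + (1 - a) * (Theta + J + (cs + rr))) <=
  2 * (Theta + (J + cs - k) - sig).
Proof. lra. Qed.

Lemma near_arith a J k kl cs rr sig Theta : 4 * k <= a * kl -> rr + sig <= k ->
  0 <= a -> 0 <= rr ->
  (Theta + J + (cs + rr)) + (a * (Theta + J + cs - kl) + (1 - a) * (Theta + J + (cs + rr))) <=
  2 * (Theta + (J + cs - k) - sig).
Proof.
move=> h1 h2 a0 r0; have : 0 <= a * rr by rewrite mulr_ge0.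
lra.
Qed.

(** The improved exponential term [kl] pays for [k] and [sig]; what remains is C times an inequality
    between square roots, supplied by [aligned_arith] or [misaligned_arith]. *)
Lemma far_arith a d C f1 f2 g1 g2 h1 h2 S J k kl sig Theta : 0 <= C ->
  a * (f1 + f2 - 2 * S) + d * (g1 + g2) + (1 - a - d) * (h1 + h2) <= 0 ->
  4 * k <= a * kl -> sig <= k -> 0 <= k ->
  a * (Theta + J + C * f1) + d * (Theta + J + C * (S + g1)) +
    (1 - a - d) * (Theta + J + C * (S + h1)) +
  (a * (Theta + J + C * f2 - kl) + d * (Theta + J + C * (S + g2)) +
    (1 - a - d) * (Theta + J + C * (S + h2))) <=
  2 * (Theta + (J + C * S - k) - sig).
Proof.
move=> C0 st hk hs k0; have := ler_wpM2l C0 st; rewrite mulr0; lra.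
Qed.

(** The mixed terms have opposite first-order parts because the reply reverses both directions. The
    gain from concavity, at least a0 y / 2, covers the two costs: 2 y times a0 / 8 from the mixed
    terms and a0 y / 4 from the random ones. This fixes the threshold a0 / 8 for the variation of
    [alpha]. *)
Lemma aligned_arith a0 a d f h S g y : 0 < a0 -> a0 <= a -> 0 <= d -> d <= a0 / 8 -> a + d <= 1 ->
  0 <= y -> f + h <= 2 * S - y / 2 ->
  a * (f + h - 2 * S) + d * ((g + y) + (- g + y)) + (1 - a - d) * (a0 * y / 8 + a0 * y / 8) <= 0.
Proof.
move=> a00 a0a d0 d8 ad y0 fh.
have aa : 0 <= a by lra.
have H1 : a * (f + h - 2 * S) <= a * (- (y / 2)) by rewrite ler_wpM2l//; lra.
have H2 := ler_wpM2r y0 d8; have H3 := ler_wpM2r y0 a0a.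
have H4 : (1 - a - d) * (a0 * y) <= 1 * (a0 * y).
  by rewrite ler_wpM2r ?mulr_ge0 ?(ltW a00)//; lra.
lra.
Qed.

(** The opponents' step falls short of [v] by a0 v / 48, and this counts with probability at least
    a0. The second-order costs add up to at most 2 y, whence the condition y <= a0^2 v / 96. *)
Lemma misaligned_arith a0 a d f h S g g' v y : 0 < a0 -> a0 <= 1 -> a0 <= a -> 0 <= d -> a + d <= 1 ->
  0 <= y -> 0 <= v -> y <= a0 ^+ 2 * v / 96 -> f <= S + ((1 - a0 / 48) * v + y) -> h <= S - v ->
  g <= v / 2 -> g' <= - (v / 2) ->
  a * (f + h - 2 * S) + d * ((g + y) + (g' + y)) + (1 - a - d) * (y + 0) <= 0.
Proof.
move=> a00 a01 a0a d0 ad y0 v0 yv fS hS gv gv'.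
have aa : 0 <= a by lra.
have H1 : a * (f + h - 2 * S) <= a * (- (a0 / 48) * v + y) by rewrite ler_wpM2l//; lra.
have H2 : d * ((g + y) + (g' + y)) <= d * (2 * y) by rewrite ler_wpM2l//; lra.
have H3 : a0 * (a0 * v) <= a * (a0 * v) by rewrite ler_wpM2r// mulr_ge0// ltW.
have H4 : d * y <= 1 * y by rewrite ler_wpM2r//; lra.
have H5 : a * y <= 1 * y by rewrite ler_wpM2r//; lra.
lra.
Qed.

Lemma slope_ge (a0 : R) : a0 <= 1 -> 47 / 24 <= 2 - a0 / 24.
Proof. lra. Qed.

Lemma slope_gt0 (a0 : R) : a0 <= 1 -> 0 < 2 - a0 / 24.
Proof. lra. Qed.

(** With E = e^2 and kk = |nu - nu'|^2 close to its maximum 4 E, displacements coupled by reflection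
    differ in square by at most a0 e^2 / 2. *)
Lemma rotation_cost_le (a0 E kk : R) : 0 < a0 -> a0 <= 1 -> 0 < E -> (2 - a0 / 24) ^+ 2 * E <= kk ->
  4 * E * (4 * E - kk) <= kk * (a0 / 2 * E).
Proof.
move=> a00 a01 E0 hk.
have -> : kk * (a0 / 2 * E) = E * (kk * a0 / 2) by ring.
have -> : 4 * E * (4 * E - kk) = E * (4 * (4 * E - kk)) by ring.
rewrite ler_pM2l//.
have B0 : (4 - a0 / 6) * E <= (2 - a0 / 24) ^+ 2 * E.
  by rewrite ler_wpM2r ?(ltW E0)//; have := sqr_ge0 a0; lra.
have B1 : 0 <= a0 * E by rewrite mulr_ge0 ?(ltW a00) ?(ltW E0).
have B2 : a0 * (a0 * E) <= 1 * (a0 * E) by rewrite ler_wpM2r.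
have B3 : 0 <= a0 * (kk - (4 - a0 / 6) * E).
  by rewrite mulr_ge0 ?(ltW a00)// subr_ge0 (le_trans B0).
lra.
Qed.

Lemma approach_sqr_le (a0 e r c kk : R) : 0 < e -> a0 <= 1 -> (2 - a0 / 24) * e * r <= c ->
  kk <= 4 * e ^+ 2 -> 96 * e <= r -> r ^+ 2 + 2 * - c + kk <= (r - e) ^+ 2.
Proof.
move=> e0 a01 cA k4 te.
have r0 : 0 <= r by lra.
have h1 : 47 / 24 * (e * r) <= (2 - a0 / 24) * (e * r).
  by rewrite ler_wpM2r ?mulr_ge0 ?(ltW e0)//; lra.
have h2 : 96 * e * e <= r * e by rewrite ler_wpM2r// ltW.
have h3 : 0 < e * e by rewrite mulr_gt0.
lra.
Qed.

Lemma far_facts (e t : R) : 0 < e -> 96 * e <= t ->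
  [/\ 0 <= t - e, 2 * e <= t, e <= t, e <= 1 / 10 * t & t - 2 * e <= t - e].
Proof. by move=> e0 te; split; lra. Qed.

End coupling_arithmetic.

(** * Improvement of the comparison function in one coupled step *)

Section coupling_improvement.
Variables (R : realType) (m : nat).
Local Notation n := m.+2.
Implicit Types (w k nu : 'rV[R]_n).

(* The step is matched to the three regimes of |x - z|: below 2e the two points
   can be made to meet; up to N e the exponential term, which is strictly concave
   at scale e, pays for everything; beyond, the square root is concave enough. *)
Definition coupling_gauge (C K J lam e : R) w : R :=
  if w == 0 then 0 else J + C * rootn w - K * expR (- (lam * enorm w / e)).

(** The common point is the apex of an isosceles triangle with base from [z] to [x] and legs [e].
    Its altitude [c] needs a direction orthogonal to the base, hence dimension at least 2. *)
Lemma meeting_directions (e : R) (x z : 'rV[R]_n) : 0 < e -> x - z != 0 -> enorm (x - z) <= 2 * e ->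
  exists mu mu' : 'rV[R]_n, [/\ enorm mu = e, enorm mu' = e & x + mu = z + mu'].
Proof.
move=> e0 w0 we; have [s s1] : exists s : 'rV[R]_m.+1, enorm s = 1 by exact: exists_enorm.
pose v := s *m hyperplane_basis (x - z).
have vv : dotv v v = 1 by rewrite -sqr_enorm enorm_hyperplane_basis// s1 expr1n.
have vw : dotv v (x - z) = 0 by exact: dotv_hyperplane_basis.
clearbody v; have xz : x = z + (x - z) by rewrite addrC subrK.
move: (x - z) w0 we vw xz => w w0 we vw ->.
pose c := Num.sqrt (e ^+ 2 - enorm w ^+ 2 / 4).
have c2 : c ^+ 2 = e ^+ 2 - enorm w ^+ 2 / 4.
  rewrite sqr_sqrtr// subr_ge0 ler_pdivrMr//.
  have -> : e ^+ 2 * 4 = (2 * e) ^+ 2 by ring.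
  by rewrite ler_pXn2r ?nnegrE ?enorm_ge0// mulr_ge0// ltW.
have nE (d : R) : d ^+ 2 = 1 / 4 -> enorm (d *: w + c *: v) = e.
  move=> d2; apply/eqP; rewrite -(@eqrXn2 _ 2)// ?enorm_ge0 ?(ltW e0)//.
  rewrite sqr_enorm !dotvE vv vw (dotvC w v) vw !mulr0 addr0 add0r mulr1 !mulrA -!expr2 d2 c2.
  by rewrite -sqr_enorm; apply/eqP; lra.
exists ((- (1 / 2)) *: w + c *: v), ((1 / 2) *: w + c *: v); split.
- by apply: nE; field.
- by apply: nE; field.
rewrite !addrA; congr (_ + _); rewrite -addrA; congr (_ + _).
by rewrite -{1}(scale1r w) -scalerDl; congr (_ *: _); field.
Qed.

Variables (p u : 'rV[R]_n -> R) (e : R) (x z : 'rV[R]_n).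
Variables (a0 C K J lam sig r1 Theta : R).
Hypotheses (e0 : 0 < e) (cu : continuous u) (a00 : 0 < a0) (a01 : a0 <= 1).
Hypotheses (ax : a0 <= alpha p x <= 1) (az : a0 <= alpha p z <= 1).
Hypothesis axz : `|alpha p x - alpha p z| <= a0 / 8.
Hypotheses (C0 : 0 <= C) (K0 : 0 <= K) (KJ : K <= J) (lam0 : 0 <= lam).
Hypotheses (T0 : 0 <= Theta) (aL : 4 <= a0 * expR lam).
Hypotheses (w0 : x - z != 0) (wr : enorm (x - z) <= r1).
Hypothesis h1 : 2 * (C * Num.sqrt (2 * e)) + 2 * K + 2 * sig <= a0 * J.
Hypothesis h2 : C * Num.sqrt (2 * e) + sig <= K * expR (- (lam * (96 / a0 ^+ 2))).
Hypothesis h3 : sig <= K * expR (- (lam * r1 / e)).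
Local Notation G := (coupling_gauge C K J lam e).
Hypothesis uG : forall h h', enorm h <= e -> enorm h' <= e ->
  u (x + h) - u (z + h') <= Theta + G (x - z + (h - h')).

Local Notation w := (x - z).
Local Notation t := (enorm w).
Local Notation s := (rootn w).
Local Notation Et := (expR (- (lam * t / e))).
Local Notation B := (Theta + J).
Local Notation a := (Num.min (alpha p x) (alpha p z)).
Local Notation d := (`|alpha p x - alpha p z|).

Let t0 : 0 < t. Proof. by rewrite enorm_gt0. Qed.
Let s0 : 0 < s. Proof. exact: rootn_gt0. Qed.

Let gauge_le (w' : 'rV[R]_n) : G w' <= J + C * rootn w'.
Proof.
rewrite /coupling_gauge; case: ifP => [/eqP ->|_].
  by rewrite addr_ge0 ?(le_trans K0 KJ)// mulr_ge0// rootn_ge0.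
by rewrite gerBl mulr_ge0// expR_ge0.
Qed.

Let uB h h' : enorm h <= e -> enorm h' <= e ->
  u (x + h) - u (z + h') <= B + C * rootn (w + (h - h')).
Proof. by move=> he he'; apply: (le_trans (uG he he')); rewrite -(addrA Theta) lerD2l. Qed.

Let crude h h' : enorm h <= e -> enorm h' <= e ->
  u (x + h) - u (z + h') <= B + C * (s + Num.sqrt (2 * e)).
Proof.
move=> he he'; rewrite (le_trans (uB he he'))// lerD2l ler_wpM2l// rootn_crude//.
by rewrite (le_trans (ler_enormB _ _))// mulr_natl mulr2n lerD.
Qed.

(** A decrease of the distance by at least [e] multiplies the exponential term by at least exp lam.
    If the tokens meet, the gauge is 0 and K <= J covers the claim. *)
Let toward h h' : enorm h <= e -> enorm h' <= e -> enorm (w + (h - h')) <= t - e ->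
  u (x + h) - u (z + h') <= B + C * rootn (w + (h - h')) - K * (expR lam * Et).
Proof.
move=> he he' wte; apply: (le_trans (uG he he')).
rewrite -(addrA Theta J) -(addrA Theta) lerD2l.
have -> : expR lam * Et = expR (- (lam * (t - e) / e)).
  by rewrite -expRD; congr expR; field; rewrite gt_eqF.
rewrite /coupling_gauge; case: ifP => [/eqP w'0|_].
  rewrite w'0 /rootn enorm0 sqrtr0 mulr0 addr0 subr_ge0 (le_trans _ KJ)//.
  rewrite -[leRHS]mulr1 ler_wpM2l// -[leRHS]expR0 ler_expR oppr_le0.
  by rewrite divr_ge0 ?(ltW e0)// mulr_ge0// (le_trans (enorm_ge0 _) wte).
rewrite lerD2l lerN2 ler_wpM2l// ler_expR lerN2.
by rewrite ler_pM2r ?invr_gt0// ler_wpM2l.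
Qed.

Let a0a : a0 <= a.
Proof. by rewrite le_min; case/andP: ax => -> _; case/andP: az. Qed.

Let ad_le1 : a + d <= 1.
Proof.
move: ax az; case: (leP (alpha p x) (alpha p z)) => h /andP[_ x1] /andP[_ z1].
  by rewrite ler0_norm ?subr_le0// opprB addrC subrK.
by rewrite gtr0_norm ?subr_gt0// addrC subrK.
Qed.

Let ax' : 0 <= alpha p x <= 1.
Proof. by case/andP: ax => h ->; rewrite (le_trans (ltW a00)). Qed.

Let az' : 0 <= alpha p z <= 1.
Proof. by case/andP: az => h ->; rewrite (le_trans (ltW a00)). Qed.

Let aLE : 4 * (K * Et) <= a * (K * (expR lam * Et)).
Proof.
have -> : a * (K * (expR lam * Et)) = (a * expR lam) * (K * Et) by ring.
rewrite ler_wpM2r ?mulr_ge0 ?expR_ge0//.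
by rewrite (le_trans aL)// ler_wpM2r// expR_ge0.
Qed.

Local Notation tugd nu nu' := (tug_value p e u x nu - tug_value p e u z nu').

Let crude_step nu nu' : enorm nu = e -> enorm nu' = e ->
  tugd nu nu' <= B + C * (s + Num.sqrt (2 * e)).
Proof.
move=> en en'; have hn : enorm nu <= e by rewrite en.
have hn' : enorm nu' <= e by rewrite en'.
have := tug_difference_le e0 ax' az' en en' (crude hn hn')
  (mixed_difference_crude p e0 cu crude en en') (mean_difference_crude e0 cu crude en en').
move/le_trans; apply; rewrite -!mulrDl.
by rewrite (_ : a + d + (1 - a - d) = 1) ?mul1r//; ring.
Qed.

Let crude_response nu nu' A1 : enorm nu = e -> enorm nu' = e ->
  u (x + nu) - u (z + nu') <= A1 ->
  tugd nu nu' <= a * A1 + (1 - a) * (B + C * (s + Num.sqrt (2 * e))).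
Proof.
move=> en en' hA; have := tug_difference_le e0 ax' az' en en' hA
  (mixed_difference_crude p e0 cu crude en en') (mean_difference_crude e0 cu crude en en').
move/le_trans; apply; rewrite -addrA -mulrDl.
by rewrite (_ : d + (1 - a - d) = 1 - a)//; ring.
Qed.

(** The opponents' step is bounded crudely. In the reply the tokens meet with probability at least
    a0, and by [h1] the jump [J] saved there pays for two crude steps. *)
Let improvement_meeting : t < 2 * e -> midrange p e u x - midrange p e u z <= Theta + G w - sig.
Proof.
move=> te; apply: midrangeB_le => // nu nu' en en'.
have [mu [mu' [em em' xz]]] := meeting_directions e0 w0 (ltW te).
exists mu, mu'; split => //.
have hA : u (x + mu) - u (z + mu') <= Theta by rewrite xz subrr.
apply: (le_trans (lerD (crude_step en en') (crude_response em em' hA))).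
rewrite /coupling_gauge (negPf w0).
have r0 : 0 <= C * Num.sqrt (2 * e) by rewrite mulr_ge0// sqrtr_ge0.
have KE : K * Et <= K.
  rewrite -[leRHS]mulr1 ler_wpM2l// -[leRHS]expR0 ler_expR oppr_le0.
  by rewrite divr_ge0 ?(ltW e0)// mulr_ge0// enorm_ge0.
have Cs : 0 <= C * s by rewrite mulr_ge0// ltW.
have aQ : a0 * J <= a * (J + C * s + C * Num.sqrt (2 * e)).
  by apply: ler_pM; rewrite ?(ltW a00) ?(le_trans K0)//; move: KJ K0 Cs r0; lra.
rewrite (mulrDr C); exact: (meeting_arith _ KE aQ h1).
Qed.

Let toward_directions : exists mu mu' : 'rV[R]_n,
  [/\ enorm mu = e, enorm mu' = e, dotv w mu = - (e * t), dotv w mu' = e * t &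
   w + (mu - mu') = (1 - 2 * e / t) *: w].
Proof.
have wt : dotv w w = t ^+ 2 by rewrite sqr_enorm.
have nE : enorm ((e / t) *: w) = e.
  by rewrite enormZ ger0_norm ?divr_ge0 ?ltW// divfK// gt_eqF.
exists (- ((e / t) *: w)), ((e / t) *: w); rewrite enormN; split => //.
- by rewrite dotvNr dotvZr wt; move: t0; move: (enorm w) => r r0; field; rewrite gt_eqF.
- by rewrite dotvZr wt; move: t0; move: (enorm w) => r r0; field; rewrite gt_eqF.
rewrite -opprD -scalerDl -{1}(scale1r w) -scalerBl; congr (_ *: _).
by move: t0; move: (enorm w) => r r0; field; rewrite gt_eqF.
Qed.

Let toward_norm (mu mu' : 'rV[R]_n) : 2 * e <= t -> w + (mu - mu') = (1 - 2 * e / t) *: w ->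
  enorm (w + (mu - mu')) = t - 2 * e.
Proof.
move=> te ->; rewrite enormZ ger0_norm.
  by move: t0; move: (enorm w) => r r0; field; rewrite gt_eqF.
by rewrite subr_ge0 ler_pdivrMr// mul1r.
Qed.

Let improvement_near : 2 * e <= t -> t <= 96 / a0 ^+ 2 * e ->
  midrange p e u x - midrange p e u z <= Theta + G w - sig.
Proof.
move=> te tN; apply: midrangeB_le => // nu nu' en en'.
have [mu [mu' [em em' _ _ wmu]]] := toward_directions.
exists mu, mu'; split => //.
have nw := toward_norm te wmu.
have hA : u (x + mu) - u (z + mu') <= B + C * s - K * (expR lam * Et).
  apply: (le_trans (toward _ _ _)); rewrite ?em ?em' ?nw//.
    by rewrite lerD2l lerN2 ler_peMl// ?ler1n// ltW.
  rewrite lerD2r lerD2l ler_wpM2l// rootn_le// nw.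
  by rewrite gerBl mulr_ge0// ltW.
apply: (le_trans (lerD (crude_step en en') (crude_response em em' hA))).
rewrite /coupling_gauge (negPf w0) (mulrDr C).
apply: near_arith => //.
- apply: (le_trans h2); rewrite ler_wpM2l// ler_expR lerN2 -mulrA ler_wpM2l//.
  by rewrite ler_pdivrMr.
- by rewrite (le_trans (ltW a00)).
- by rewrite mulr_ge0// sqrtr_ge0.
Qed.

(** [v] is the first-order change of the square root when the distance changes by 2 e, and [y] is
    the size of the second-order change. *)
Local Notation y := (e ^+ 2 / s ^+ 3).
Local Notation v := (e / s).

Let tangent_frac (D : R) : (2 * D + 4 * e ^+ 2) / (4 * s ^+ 3) = D / (2 * s ^+ 3) + y.
Proof. by move: s0; move: (rootn w) => r r0; field; rewrite gt_eqF. Qed.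

Let y0 : 0 <= y. Proof. by rewrite divr_ge0 ?sqr_ge0// exprn_ge0// ltW. Qed.

Let sig_le : sig <= K * Et.
Proof.
apply: (le_trans h3); rewrite ler_wpM2l// ler_expR lerN2 ler_pM2r ?invr_gt0//.
by rewrite ler_wpM2l.
Qed.

(** Two cases for the opponents' relative step nu - nu'. If it is nearly parallel to x - z and
    nearly of full length, the reply reverses both directions, linear terms cancel and concavity
    wins. Otherwise the reply moves the tokens straight towards each other and wins at first order.
    The lower bound 96 e / a0^2 on the distance makes [y] small against [v]. *)
Let improvement_far : 96 / a0 ^+ 2 * e < t ->
  midrange p e u x - midrange p e u z <= Theta + G w - sig.
Proof.
move=> tN.
have a2 : 0 < a0 ^+ 2 by rewrite exprn_gt0.
have a21 : a0 ^+ 2 <= 1 by rewrite expr_le1// ltW.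
have ea : 96 * e <= t * a0 ^+ 2.
  by rewrite -ler_pdivrMr// mulrAC ltW.
have te : 96 * e <= t by rewrite (le_trans ea)// ger_pMr.
have [te1 te2 te3 te10 tee] := far_facts e0 te.
have ts : t = s ^+ 2 by rewrite rootn2.
have wt : dotv w w = t ^+ 2 by rewrite sqr_enorm.
have KE0 : 0 <= K * Et by rewrite mulr_ge0// expR_ge0.
apply: midrangeB_le => // nu nu' en en'.
have hn : enorm nu <= e by rewrite en.
have hn' : enorm nu' <= e by rewrite en'.
have fB := uB hn hn'.
have gB := mixed_difference_tangent p e0 cu C0 w0 uB en en'.
rewrite tangent_frac in gB.
rewrite /coupling_gauge (negPf w0).
have s4 : s ^+ 4 = t ^+ 2 by rewrite ts -exprM.
have dE (b c : 'rV[R]_n) : dotv (b + c) (b + c) = dotv b b + 2 * dotv b c + dotv c c.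
  by rewrite !dotvE (dotvC c b); ring.
have en4 := dotvB_le_sqr e0 hn hn'.
have fracE (q : R) : 4 * e ^+ 2 / (4 * s ^+ 3) = y.
  by move: s0; move: (rootn w) => r r0; field; rewrite gt_eqF.
have [cA|cA] := leP ((2 - a0 / 24) * e * t) (dotv w (nu - nu')).
  have en2 : enorm (- nu) = e by rewrite enormN.
  have en2' : enorm (- nu') = e by rewrite enormN.
  exists (- nu), (- nu'); split => //.
  have kN : - nu - - nu' = - (nu - nu') by rewrite opprB opprK addrC.
  have [c cE] : {c | c = dotv w (nu - nu')} by exists (dotv w (nu - nu')).
  have [kk kkE] : {kk | kk = dotv (nu - nu') (nu - nu')} by exists (dotv (nu - nu') (nu - nu')).
  (* Cauchy-Schwarz turns alignment into a lower bound on |nu - nu'|, which makes the reflection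
     coupling cheap. *)
  have kk2 : ((2 - a0 / 24) * e) ^+ 2 <= kk.
    have nn : 0 <= (2 - a0 / 24) * e by rewrite mulr_ge0 ?(ltW e0) ?(ltW (slope_gt0 a01)).
    rewrite kkE -sqr_enorm ler_pXn2r ?nnegrE ?nn ?enorm_ge0//.
    rewrite -(ler_pM2r t0); apply: (le_trans cA); rewrite mulrC; exact: dotv_le.
  have kk0 : 0 < kk.
    by apply: lt_le_trans kk2; rewrite exprn_gt0// mulr_gt0// slope_gt0.
  have cond : 4 * e ^+ 2 * (4 * e ^+ 2 - kk) <= kk * (a0 / 2 * e ^+ 2).
    by apply: rotation_cost_le => //; [rewrite exprn_gt0|rewrite -exprMn].
  have qE : a0 / 2 * e ^+ 2 / (4 * s ^+ 3) = a0 * y / 8.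
    by move: s0; move: (rootn w) => r r0; field; rewrite gt_eqF.
  have m1 := mean_difference_tangent (q := a0 / 2 * e ^+ 2) e0 cu C0 w0 uB en en'.
  rewrite -kkE qE in m1; have {}m1 := m1 (or_intror (conj kk0 cond)).
  have m2 := mean_difference_tangent (q := a0 / 2 * e ^+ 2) e0 cu C0 w0 uB en2 en2'.
  rewrite kN dotvNl dotvNr opprK -kkE qE in m2; have {}m2 := m2 (or_intror (conj kk0 cond)).
  have gB2 := mixed_difference_tangent p e0 cu C0 w0 uB en2 en2'.
  rewrite tangent_frac !dotvNr -fun_if mulNr in gB2.
  (* The reversed step also shortens the distance by at least [e], so the exponential term improves
     here too. *)
  have wk : enorm (w + - (nu - nu')) <= t - e.
    rewrite enorm_le_sqr//.
    rewrite dE dotvNr dotvNl dotvNr opprK wt; exact: approach_sqr_le cA en4 te.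
  have hA : u (x + - nu) - u (z + - nu') <= B + C * rootn (w + - (nu - nu')) - K * (expR lam * Et).
    by rewrite -kN; apply: toward; rewrite ?en2 ?en2'// kN.
  have S1 := tug_difference_le e0 ax' az' en en' fB gB m1.
  have S2 := tug_difference_le e0 ax' az' en2 en2' hA gB2 m2.
  apply: (le_trans (lerD S1 S2)).
  apply: far_arith => //.
  apply: aligned_arith => //.
  have r96 : e / s ^+ 2 <= 1 / 10.
    by rewrite -ts ler_pdivrMr.
  have -> : 2 * s - y / 2 = s * (2 - (e / s ^+ 2) ^+ 2 / 2).
    by move: s0; move: (rootn w) => r r0; field; rewrite gt_eqF.
  apply: (@fourth_roots_concave _ s (e / s ^+ 2) _ _ c kk) => //.
  - by rewrite divr_gt0// exprn_gt0.
  - exact: rootn_ge0.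
  - exact: rootn_ge0.
  - by rewrite !rootn4 dE -cE -kkE.
  - by rewrite !rootn4 dE dotvNr dotvNl dotvNr opprK -cE -kkE mulrN.
  - rewrite kkE (le_trans en4)// exprMn exprVn -exprM -mulrA -mulrA mulVf ?mulr1//.
    by rewrite expf_neq0// gt_eqF.
  rewrite cE; apply: le_trans cA.
  have -> : 47 / 24 * (e / s ^+ 2) * s ^+ 4 = 47 / 24 * e * t.
    rewrite ts; by move: s0; move: (rootn w) => r r0; field; rewrite gt_eqF.
  by rewrite ler_wpM2r ?(ltW t0)// ler_wpM2r ?(ltW e0)// slope_ge.
have [mu [mu' [em em' wm wm' wmu]]] := toward_directions.
exists mu, mu'; split => //.
have nw := toward_norm te2 wmu.
have hA : u (x + mu) - u (z + mu') <= B + C * rootn (w + (mu - mu')) - K * (expR lam * Et).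
  by apply: toward; rewrite ?em ?em' ?nw.
have m1 := mean_difference_tangent (q := 4 * e ^+ 2) e0 cu C0 w0 uB en en' (or_introl (lexx _)).
rewrite fracE in m1 => //.
(* The replies are opposite vectors with a common orthogonal hyperplane; the coupled displacements
   agree and q = 0 is allowed. *)
have m2 := mean_difference_tangent (q := 0) e0 cu C0 w0 uB em em'.
have dmu : dotv (mu - mu') (mu - mu') = 4 * e ^+ 2.
  have -> : mu - mu' = (- (2 * e / t)) *: w.
    by apply: (addrI w); rewrite wmu scalerBl scale1r scaleNr.
  rewrite dotvZl dotvZr wt; move: t0; move: (enorm w) => r r0.
  by field; rewrite gt_eqF.
rewrite dmu subrr !mulr0 mul0r in m2.
have {}m2 := m2 (or_intror (conj (mulr_gt0 (ltr0n _ 4) (exprn_gt0 2 e0)) (lexx _))).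
have gB2 := mixed_difference_tangent p e0 cu C0 w0 uB em em'.
rewrite tangent_frac wm wm' if_same in gB2.
have S1 := tug_difference_le e0 ax' az' en en' fB gB m1.
have S2 := tug_difference_le e0 ax' az' em em' hA gB2 m2.
apply: (le_trans (lerD S1 S2)).
apply: far_arith => //.
have v0 : 0 <= v by rewrite divr_ge0 ?(ltW e0) ?(ltW s0).
have s30 : 0 < (2 * s ^+ 3)^-1 by rewrite invr_gt0 mulr_gt0// exprn_gt0.
have v2 : v / 2 = e * t * (2 * s ^+ 3)^-1.
  by rewrite ts; move: s0; move: (rootn w) => r r0; field; rewrite gt_eqF.
apply: (@misaligned_arith _ a0 _ _ _ _ _ _ _ v) => //.
- have -> : y = v * (e / s ^+ 2).
    by move: s0; move: (rootn w) => r r0; field; rewrite gt_eqF.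
  rewrite (_ : a0 ^+ 2 * v / 96 = v * (a0 ^+ 2 / 96)); last by ring.
  rewrite ler_wpM2l//.
  by rewrite -ts ler_pdivrMr// mulrAC ler_pdivlMr// mulrC [a0 ^+ 2 * _]mulrC.
- have := rootn_tangent (nu - nu') w0; move/le_trans; apply; rewrite lerD2l.
  have -> : (1 - a0 / 48) * v + y = (2 * ((2 - a0 / 24) * e * t) + 4 * e ^+ 2) / (4 * s ^+ 3).
    by rewrite ts; move: s0; move: (rootn w) => r r0; field; rewrite gt_eqF.
  rewrite ler_pM2r ?invr_gt0 ?mulr_gt0 ?exprn_gt0// lerD// ler_wpM2l//.
  exact: ltW.
- apply: le_of_sqr.
    by rewrite subr_ge0 ler_pdivrMr// -expr2 -ts.
  rewrite rootn2 nw ts.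
  have -> : (s - v) ^+ 2 = s ^+ 2 - 2 * e + v ^+ 2.
    by move: s0; move: (rootn w) => r r0; field; rewrite gt_eqF.
  by rewrite lerDl sqr_ge0.
- rewrite v2 ler_pM2r//; case: ifP => _.
    by rewrite mulrC -en; exact: dotv_le.
  by rewrite -dotvNr mulrC -en' -(enormN nu'); exact: dotv_le.
- by rewrite v2 mulNr.
Qed.

(** [h1], [h2] and [h3] serve the meeting, near and far regimes respectively. The gain [sig] does
    not depend on the pair, so it can be subtracted from a supremum over pairs. *)
Lemma coupling_improvement : midrange p e u x - midrange p e u z <= Theta + G w - sig.
Proof.
have [te|te] := ltP t (2 * e); first exact: improvement_meeting.
have [tN|tN] := leP t (96 / a0 ^+ 2 * e); first exact: improvement_near.
exact: improvement_far.
Qed.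

End coupling_improvement.

(** * Geometry of the domain *)

Section domain_geometry.
Variables (R : realType) (m : nat).
Local Notation n := m.+1.
Implicit Types (x y z b h : 'rV[R]_n) (A Omega : set 'rV[R]_n) (e r : R).

Lemma edist_ge0 x A : 0 <= Defs.edist x A.
Proof.
have [A0|/set0P A0] := eqVneq A set0.
  by rewrite /Defs.edist A0 image_set0 inf0.
apply: lb_le_inf; first by case: A0 => b Ab; exists (enorm (x - b)); exists b.
by move=> _ [b _ <-]; exact: enorm_ge0.
Qed.

Lemma edist_le x A b : A b -> Defs.edist x A <= enorm (x - b).
Proof.
move=> Ab; apply: inf_lbound; last by exists b.
by exists 0 => _ [c _ <-]; exact: enorm_ge0.
Qed.

Lemma edist_lt x A r : A !=set0 -> Defs.edist x A < r -> exists2 b, A b & enorm (x - b) < r.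
Proof.
move=> [b Ab] xr.
have hi : has_inf [set enorm (x - y) | y in A].
  split; first by exists (enorm (x - b)); exists b.
  by exists 0 => _ [c _ <-]; exact: enorm_ge0.
have d0 : 0 < r - Defs.edist x A by rewrite subr_gt0.
have [_ [c Ac <-]] := inf_adherent d0 hi.
by rewrite -/(Defs.edist x A) [X in _ < X]addrC subrK => h; exists c.
Qed.

Lemma open_eballP Omega x : open Omega -> Omega x -> exists2 r, 0 < r & eball x r `<=` Omega.
Proof. by move=> oO Ox; apply/nbhs_eballP; exact: open_nbhs_nbhs. Qed.

Lemma boundaryP Omega x : open Omega -> boundary Omega x <-> closure Omega x /\ ~ Omega x.
Proof.
move=> oO; split=> -[cO nO]; split => // h; apply: nO; last exact: interior_subset.
exact: open_nbhs_nbhs.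
Qed.

(** The crossing parameter is the infimum of the t >= 0 with x + t h outside [Omega]: openness makes
    it positive and keeps its point outside, while the points just before it are inside. *)
Lemma boundary_crossing Omega x h : open Omega -> Omega x -> ~ Omega (x + h) ->
  exists2 t, 0 < t <= 1 & boundary Omega (x + t *: h).
Proof.
move=> oO Ox Oxh.
have h0 : 0 < enorm h.
  by rewrite enorm_gt0; apply/eqP => h0; move: Oxh; rewrite h0 addr0.
pose N := [set t : R | 0 <= t /\ ~ Omega (x + t *: h)].
have N1 : N 1 by split => //; rewrite scale1r.
have hi : has_inf N by split; [exists 1|exists 0 => t []].
pose t0 := inf N.
have t00 : 0 <= t0 by apply: lb_le_inf; [exists 1|move=> t []].
have t01 : t0 <= 1 by apply: inf_lbound => //; case: hi.
have dist s t : enorm (x + s *: h - (x + t *: h)) = `|s - t| * enorm h.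
  by rewrite opprD addrACA subrr add0r -scalerBl enormZ.
have nb : ~ Omega (x + t0 *: h).
  move=> Ob; have [r r0 rO] := open_eballP oO Ob.
  have d0 : 0 < r / enorm h by rewrite divr_gt0.
  have [t [tt0 tN] tlt] := inf_adherent d0 hi.
  have le : t0 <= t by apply: inf_lbound; [case: hi|].
  apply: tN; apply: rO; rewrite /eball/= dist -ltr_pdivlMr//.
  by rewrite ger0_norm ?subr_ge0// ltrBlDl.
have t0p : 0 < t0.
  by rewrite lt_neqAle t00 andbT; apply/eqP => e; apply: nb; rewrite -e scale0r addr0.
exists t0; first by rewrite t0p.
apply/boundaryP => //; split => //; apply/closure_eballP => r r0.
pose t := Num.max 0 (t0 - r / enorm h / 2).
have d0 : 0 < r / enorm h by rewrite divr_gt0.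
have tt : 0 <= t by rewrite le_max lexx.
have tt0 : t < t0 by rewrite gt_max t0p; lra.
have tge : t0 - r / enorm h / 2 <= t by rewrite le_max lexx orbT.
exists (x + t *: h).
  apply: contrapT => nO; have : t0 <= t by apply: inf_lbound; [case: hi|].
  by rewrite leNgt tt0.
rewrite dist -ltr_pdivlMr// distrC gtr0_norm ?subr_gt0//.
by move: tge d0; move: (r / enorm h) => q; lra.
Qed.

Section bounded_domain.
Variable Omega : set 'rV[R]_n.
Hypotheses (O0 : Omega !=set0) (oO : open Omega) (bO : bounded_set Omega).
Local Notation bd := (boundary Omega).
Local Notation X e := (closure (Defs.extended Omega e)).

Lemma enorm_bounded : exists2 M, 0 < M & forall x, Omega x -> enorm x <= M.
Proof.
have [M [_ hM]] := bO; exists (n%:R * (`|M| + 1)); first by rewrite mulr_gt0// ltr_wpDl.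
move=> x Ox; apply: (le_trans (enorm_le_norm x)); rewrite ler_wpM2l//.
by apply: hM => //; rewrite ltr_pwDr// ler_norm.
Qed.

Lemma enorm_bounded_closure A M r : (forall x, A x -> enorm x <= M) -> 0 < r ->
  forall x, closure A x -> enorm x <= M + r.
Proof.
move=> AM r0 x /closure_eballP/(_ r r0)[y Ay yx].
rewrite -(subrK y x) (le_trans (ler_enormD _ _))// addrC lerD ?AM// enormB.
exact: ltW.
Qed.

Lemma boundary_nonempty : bd !=set0.
Proof.
have [x Ox] := O0; have [M M0 hM] := enorm_bounded.
have [v v1] := @exists_enorm R m (enorm x + M + 1) ltac:(by rewrite !addr_ge0 ?enorm_ge0// ltW).
have nO : ~ Omega (x + v).
  move=> /hM h; have : enorm v <= enorm (x + v) + enorm x.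
    by rewrite -{1}(addKr x v) addrC (ler_enormB (x + v) x).
  by rewrite v1; move: (enorm x) (enorm (x + v)) h => a b; lra.
by have [t _ tb] := boundary_crossing oO Ox nO; exists (x + t *: v).
Qed.

Lemma boundary_closure x : bd x -> closure Omega x.
Proof. by case. Qed.

Lemma extended_bounded e M : 0 < e < 1 -> (forall x, Omega x -> enorm x <= M) ->
  forall x, X e x -> enorm x <= M + 3.
Proof.
move=> /andP[e0 e1] hM x Xx.
have cl := enorm_bounded_closure hM ltr01.
(* One unit each for the closure of the domain, the width of the outer strip and the closure of the
   union. *)
have -> : M + 3 = M + 1 + 1 + 1 by ring.
apply: (enorm_bounded_closure _ ltr01 Xx) => y [Oy|[_ yd]].
  by rewrite (le_trans (cl _ Oy))// lerDl.
have [b bb yb] := edist_lt boundary_nonempty yd.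
rewrite -(subrK b y) (le_trans (ler_enormD _ _))// addrC lerD//.
  by apply: cl; exact: boundary_closure.
by rewrite (le_trans (ltW yb))// ltW.
Qed.

Lemma bounded_enorm A M : (forall x, A x -> enorm x <= M) -> bounded_set A.
Proof.
move=> AM; exists M; split; first exact: num_real.
by move=> y My x Ax; rewrite /= (le_trans (norm_le_enorm x))// (le_trans (AM _ Ax))// ltW.
Qed.

Lemma compact_extended e : 0 < e < 1 -> compact (X e).
Proof.
move=> e01; have [M _ hM] := enorm_bounded.
apply: bounded_closed_compact; last exact: closed_closure.
exact: bounded_enorm (extended_bounded e01 hM).
Qed.

Lemma compact_closure_domain : compact (closure Omega).
Proof.
have [M _ hM] := enorm_bounded.
apply: bounded_closed_compact; last exact: closed_closure.
exact: bounded_enorm (enorm_bounded_closure hM ltr01).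
Qed.

Lemma compact_strip : compact (strip Omega 1).
Proof.
have [M _ hM] := enorm_bounded.
apply: bounded_closed_compact; last by apply: closedU; exact: closed_closure.
apply: (@bounded_enorm _ (M + 1 + 1 + 1)).
have h A : (forall y, A y -> enorm y <= M + 1 + 1) ->
   forall y, closure A y -> enorm y <= M + 1 + 1 + 1.
  by move=> hA; exact: enorm_bounded_closure hA ltr01.
move=> x [] ; apply: h => y [Oy yd].
  by rewrite (le_trans (hM _ Oy))// -addrA lerDl.
have [b bb yb] := edist_lt boundary_nonempty yd.
rewrite -(subrK b y) (le_trans (ler_enormD _ _))// addrC lerD//; last exact: ltW.
by apply: (enorm_bounded_closure hM ltr01); exact: boundary_closure.
Qed.

Lemma closure_sub_extended e x : closure Omega x -> X e x.
Proof. by move=> Ox; apply: subset_closure; left. Qed.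

Lemma domain_sub_extended e x : Omega x -> X e x.
Proof. by move=> Ox; apply: closure_sub_extended; exact: subset_closure. Qed.

(** If the endpoint is not in the closure of [Omega], the segment crosses the boundary at a
    parameter t > 0, and the remaining length (1 - t) |h| is strictly below [e], as the outer strip
    demands. *)
Lemma translate_extended e x h : 0 < e -> Omega x -> enorm h <= e -> X e (x + h).
Proof.
move=> e0 Ox he; have [Oxh|nO] := pselect (closure Omega (x + h)).
  exact: closure_sub_extended.
apply: subset_closure; right; split => //.
have [|t /andP[t0 t1] bt] := @boundary_crossing _ x h oO Ox.
  by move=> O; apply: nO; exact: subset_closure.
apply: (le_lt_trans (edist_le _ bt)).
rewrite opprD addrACA subrr add0r -{1}(scale1r h) -scalerBl enormZ ger0_norm ?subr_ge0//.
have [h0|h0] := eqVneq (enorm h) 0; first by rewrite h0 mulr0.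
have hp : 0 < enorm h by rewrite lt_def h0 enorm_ge0.
by apply: lt_le_trans he; rewrite gtr_pMl// ltrBlDr ltrDl.
Qed.

(** The factor 2 leaves room for passing to the closure of the outer strip. *)
Lemma near_boundary_of_extended e x : X e x -> ~ Omega x -> 0 < e ->
  exists2 b, bd b & enorm (x - b) < 2 * e.
Proof.
move=> Xx nO e0; have [cO|ncO] := pselect (closure Omega x).
  by exists x; [apply/boundaryP|rewrite subrr enorm0 mulr_gt0].
have [r r0 rO] : exists2 r, 0 < r & forall y, closure Omega y -> r <= enorm (y - x).
  have oC : open (~` closure Omega) by rewrite openC; exact: closed_closure.
  have [r r0 rO] := open_eballP oC ncO; exists r => // y Oy.
  by rewrite leNgt; apply/negP => h; exact: (rO y h).
pose q := Num.min r e.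
have q0 : 0 < q by rewrite lt_min r0.
have [y Ey yx] := (closure_eballP _ _).1 Xx q q0.
have yr : enorm (y - x) < r by rewrite (lt_le_trans yx)// ge_min lexx.
case: Ey => [Oy|[_ yd]]; first by have := rO _ Oy; rewrite leNgt yr.
have [b bb yb] := edist_lt boundary_nonempty yd.
exists b => //; apply: (le_lt_trans (ler_enorm_dist _ y _)); rewrite enormB mulr_natl mulr2n ltrD//.
by rewrite (lt_le_trans yx)// ge_min lexx orbT.
Qed.

Lemma near_boundary_of_inner e x : inner_strip Omega e x ->
  exists2 b, bd b & enorm (x - b) < e.
Proof. by move=> [_ xd]; exact: edist_lt boundary_nonempty xd. Qed.

Lemma inner_sub_strip e x : e <= 1 -> inner_strip Omega e x -> strip Omega 1 x.
Proof.
by move=> e1 [Ox xd]; left; apply: subset_closure; split => //; exact: lt_le_trans e1.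
Qed.

Lemma boundary_sub_strip x : bd x -> strip Omega 1 x.
Proof.
move=> bx; left; apply/closure_eballP => r r0.
have r1 : 0 < Num.min r 1 by rewrite lt_min r0/=.
have [y Oy yx] := (closure_eballP _ _).1 (boundary_closure bx) _ r1.
exists y; last by rewrite (lt_le_trans yx)// ge_min lexx.
split => //; apply: (le_lt_trans (edist_le _ bx)).
by rewrite (lt_le_trans yx)// ge_min lexx orbT.
Qed.

Lemma outside_sub_strip e x : e <= 1 -> X e x -> ~ Omega x -> strip Omega 1 x.
Proof.
move=> e1 Xx nO; have [cO|ncO] := pselect (closure Omega x).
  by apply: boundary_sub_strip; apply/boundaryP.
right; apply/closure_eballP => r r0.
have oC : open (~` closure Omega) by rewrite openC; exact: closed_closure.
have [q q0 qO] := open_eballP oC ncO.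
have rq : 0 < Num.min r q by rewrite lt_min r0.
have [y Ey yx] := (closure_eballP _ _).1 Xx _ rq.
have ny : ~ closure Omega y.
  by apply: qO; rewrite /eball/= (lt_le_trans yx)// ge_min lexx orbT.
exists y; last by rewrite (lt_le_trans yx)// ge_min lexx.
by case: Ey => // -[_ yd]; split => //; exact: lt_le_trans e1.
Qed.

Lemma cutoff_bounds e x : 0 < e -> 0 <= cutoff Omega e x <= 1.
Proof.
move=> e0; rewrite /cutoff; case: ifP => _; last by rewrite ler01 lexx.
case: ifP => [/set_mem [_ xd]|_]; last by rewrite lexx ler01.
rewrite subr_ge0 gerBl mulr_ge0 ?edist_ge0 ?invr_ge0 ?(ltW e0)// andbT.
by rewrite mulrC ler_pdivrMr// mul1r ltW.
Qed.

Lemma cutoff_inner e x : Omega x -> cutoff Omega e x = 0 \/ inner_strip Omega e x.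
Proof.
move=> Ox; rewrite /cutoff; case: ifP => [_|/negP]; last by rewrite inE.
by case: ifP => [/set_mem h|_]; [right|left].
Qed.

Lemma cutoff_far e x r : 0 < e -> e <= r -> eball x r `<=` Omega -> cutoff Omega e x = 0.
Proof.
move=> e0 er rO; have Ox : Omega x.
  by apply: rO; rewrite /eball/= subrr enorm0 (lt_le_trans e0).
case: (@cutoff_inner e x Ox) => // /near_boundary_of_inner [b bb xb].
have /boundaryP := bb => /(_ oO) [_ []]; apply: rO.
by rewrite /eball/= enormB (lt_le_trans xb).
Qed.

End bounded_domain.
End domain_geometry.

(** * Globally continuous representatives of solutions *)

Section dpp.
Variables (R : realType) (m : nat).
Local Notation n := m.+1.
Implicit Types (x y z b h nu : 'rV[R]_n) (p F u : 'rV[R]_n -> R) (e r : R).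

Lemma bounded_on_compact (K : set 'rV[R]_n) (f : 'rV[R]_n -> R) :
  compact K -> {within K, continuous f} -> exists2 M, 0 < M & forall x, K x -> `|f x| <= M.
Proof.
move=> cK cf; have [M [_ hM]] := compact_bounded (continuous_compact cf cK).
exists (`|M| + 1); first by rewrite ltr_wpDl.
move=> x Kx; apply: hM; first by rewrite ltr_pwDr// ler_norm.
by exists x.
Qed.

(** Tietze's theorem. With functions continuous on the whole space, averages can be handled without
    tracking domains. *)
Lemma compact_extension (K : set 'rV[R]_n) (f : 'rV[R]_n -> R) :
  compact K -> {within K, continuous f} ->
  exists2 g : 'rV[R]_n -> R, continuous g & forall x, K x -> g x = f x.
Proof.
move=> cK cf; have [M M0 hM] := bounded_on_compact cK cf.
have clK : closed K by apply: compact_closed => //; exact: norm_hausdorff.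
have [g [gE cg _]] := continuous_bounded_extension (@pseudometric_normal _ _) clK M0 cf hM.
by exists g => // x Kx; rewrite gE// inE.
Qed.

Lemma uniform_on_compact (K : set 'rV[R]_n) (f : 'rV[R]_n -> R) eta :
  compact K -> {within K, continuous f} -> 0 < eta ->
  exists2 r, 0 < r & forall x y, K x -> K y -> enorm (x - y) < r -> `|f x - f y| < eta.
Proof.
move=> cK cf eta0; have [g cg gE] := compact_extension cK cf.
have [|r /= r0 hr] := (compact_near_coveringP K).1 cK R (0^'+)
    (fun r x => forall y, enorm (x - y) < r -> `|g x - g y| < eta) _.
  move=> x Kx.
  have eta2 : 0 < eta / 2 by rewrite divr_gt0.
  have /nbhs_eballP[r r0 rg] : nbhs x [set y | `|g x - g y| < eta / 2].
    by have /cvgrPdist_lt := cg x; apply.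
  have r2 : 0 < r / 2 by rewrite divr_gt0.
  exists (eball x (r / 2), [set q : R | q < r / 2]).
    by split; [exact: nbhs_eball|exact: nbhs_right_lt].
  move=> [x' q] [/= xx' qr] y x'y.
  have h1 : `|g x - g x'| < eta / 2.
    by apply: rg; rewrite /eball/= (lt_le_trans xx')// ler_pdivrMr// ler_peMr// ?ler1n// ltW.
  have h2 : `|g x - g y| < eta / 2.
    apply: rg; rewrite /eball/= (splitr r) enormB (le_lt_trans (ler_enorm_dist x x' y))//.
    by rewrite enormB ltrD// (lt_trans x'y).
  rewrite (splitr eta) (le_lt_trans (ler_distD (g x) _ _))// ltrD//.
  by rewrite distrC.
exists (r / 2); first by rewrite divr_gt0.
move=> x y Kx Ky xy; rewrite -!gE//; apply: (hr (r / 2)) => //=.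
  by rewrite sub0r normrN gtr0_norm ?divr_gt0// ltr_pdivrMr// ltr_pMr// ltr1n.
by rewrite divr_gt0.
Qed.

(** For x in [Omega] the operator only sees points of the closed extended domain, so a continuous
    extension changes no tug value. On the boundary the cutoff is 1, and beyond the closure of
    [Omega] the operator is [F]. *)
Lemma dpp_extension (Omega : set 'rV[R]_n) p F e (ue : 'rV[R]_n -> R) :
  Omega !=set0 -> open Omega -> bounded_set Omega -> 0 < e < 1 ->
  dpp_solution Omega p F e ue ->
  exists u, [/\ continuous u,
    forall x, closure (Defs.extended Omega e) x -> u x = ue x,
    forall x, Omega x ->
      u x = (1 - cutoff Omega e x) * midrange p e u x + cutoff Omega e x * F x &
    forall x, closure (Defs.extended Omega e) x -> ~ Omega x -> u x = F x].
Proof.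
move=> O0 oO bO e01 [cue ueE].
have [e0 e1] := andP e01.
have cX := compact_extended O0 oO bO e01.
have [u cu uE] := compact_extension cX cue.
exists u; split => // [x Ox|x Xx nO].
  have Xx := domain_sub_extended e Ox.
  rewrite uE// ueE// /dpp_operator (_ : x \in closure Omega); last first.
    by rewrite inE; exact: subset_closure.
  have -> : [set tug_value p e ue x nu | nu in [set nu | enorm nu = e]] = tug_set p e u x.
    have tE nu : enorm nu = e -> tug_value p e ue x nu = tug_value p e u x nu.
      move=> en; rewrite /tug_value uE; last by apply: translate_extended => //; rewrite en.
      congr (_ + _ * (_ * _)); apply: eq_Rintegral => t /set_mem [tb _].
      by rewrite uE//; apply: translate_extended => //; exact: ltW.
    by apply/seteqP; split => _ [nu en <-]; exists nu => //; rewrite tE.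
  by rewrite /midrange; ring.
rewrite uE// ueE// /dpp_operator; case: ifP => // _.
have -> : cutoff Omega e x = 1.
  by rewrite /cutoff ifF//; apply/negP; rewrite inE.
by rewrite subrr mul0r mul0r add0r mul1r.
Qed.

End dpp.

(** * Boundary estimate *)

Section boundary_arithmetic.
Variables (R : realType) (a b c d e r : R).

Lemma step_le_quarter : 0 < d -> e <= d / 16 -> d <= b -> 4 * e <= b.
Proof. lra. Qed.

Lemma step_le_eighth : 0 < d -> e <= d / 16 -> 8 * e <= d.
Proof. lra. Qed.

Lemma quarter_le_half : a <= 1 * b -> 0 < b -> a / 4 <= 1 / 2 * b.
Proof. lra. Qed.

Lemma add_le4 : a < 3 * r -> b < r -> a + b <= 4 * r.
Proof. lra. Qed.

Lemma add_le2 : a <= r -> b < r -> a + b <= 2 * r.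
Proof. lra. Qed.

Lemma half_le_dist : c < 2 * e -> d <= a -> a <= c + b -> 4 * e <= d -> d / 2 <= b.
Proof. lra. Qed.

End boundary_arithmetic.

Section boundary_estimate.
Variables (R : realType) (m : nat).
Local Notation n := m.+1.
Implicit Types (x y z b h nu : 'rV[R]_n) (p F u : 'rV[R]_n -> R) (e r : R).

(** Outside the closed extended domain only continuity is asked of [u]. *)
Definition dpp_representative (Omega : set 'rV[R]_n) p F e u : Prop :=
  [/\ continuous u,
      forall x, Omega x ->
        u x = (1 - cutoff Omega e x) * midrange p e u x + cutoff Omega e x * F x &
      forall x, closure (Defs.extended Omega e) x -> ~ Omega x -> u x = F x].

Lemma dpp_representative_opp Omega p F e u : 0 < e ->
  dpp_representative Omega p F e u ->
  dpp_representative Omega p (fun x => - F x) e (fun x => - u x).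
Proof.
move=> e0 [cu uE uF]; split; first exact: continuousT_opp.
  by move=> x Ox; rewrite midrange_opp// {1}uE//; ring.
by move=> x Xx nO; rewrite uF.
Qed.

Variables (Omega : set 'rV[R]_n) (p : 'rV[R]_n -> R) (a0 : R).
Hypotheses (O0 : Omega !=set0) (oO : open Omega) (bO : bounded_set Omega).
Hypotheses (a00 : 0 < a0) (a01 : a0 <= 1).
Hypothesis pa : forall x, Omega x -> a0 <= alpha p x <= 1.
Local Notation X e := (closure (Defs.extended Omega e)).
Local Notation bd := (boundary Omega).

Let pa' x : Omega x -> 0 < alpha p x <= 1.
Proof. by move=> /pa /andP[h ->]; rewrite (lt_le_trans a00). Qed.

(** The barrier is centred so far away that [barrier_comparison] applies on the whole extended
    domain with rate 1 / 2; its amplitude [k] is arbitrarily small. *)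
Lemma dpp_le_max F M e u : 0 < e < 1 -> dpp_representative Omega p F e u ->
  (forall x, strip Omega 1 x -> F x <= M) -> forall x, X e x -> u x <= M.
Proof.
move=> e01 [cu uE uF] FM x Xx; have [e0 e1] := andP e01.
have [M' M'0 hM'] := enorm_bounded bO.
(* M' + 3 bounds the extended domain, and at distance 32 / a0 from it both numerical conditions of
   the barrier hold. *)
have [z zE] := @exists_enorm R m (M' + 3 + 32 / a0)
  ltac:(by rewrite !addr_ge0 ?(ltW M'0)// divr_ge0// ltW).
have far y : X e y -> 32 / a0 <= enorm (y - z).
  move=> Xy; have h := extended_bounded O0 oO bO e01 hM' Xy.
  have : enorm z <= enorm y + enorm (y - z).
    by rewrite -{1}(subKr y z) ler_enormB.
  by rewrite zE; move: (enorm y) (enorm (y - z)) h => a b; lra.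
apply/ler_addgt0Pr => k k0.
have bump1 y : bump (1 / 2) z y <= 1.
  by rewrite /bump -[leRHS]expR0 ler_expR oppr_le0 mulr_ge0 ?dotvv_ge0.
suff h : u x <= (M + k) - k * bump (1 / 2) z x.
  by rewrite (le_trans h)// gerBl mulr_ge0 ?(ltW k0)// ltW// bump_gt0.
have vM y : M <= (M + k) - k * bump (1 / 2) z y.
  by rewrite -addrA lerDl subr_ge0 -[leRHS]mulr1 ler_wpM2l// ltW.
have cX := compact_extended O0 oO bO e01.
apply: (barrier_comparison (p := p) e0 cu cX _ k0 _ _ Xx) => //.
  by rewrite ger_pMr// expr_le1// ltW.
move=> y Xy; have [Oy|nOy] := pselect (Omega y); last first.
  by left; rewrite uF// (le_trans (FM _ _))//; exact: outside_sub_strip (ltW e1) Xy nOy.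
right; have /andP[pa0 pa1] := pa Oy.
have t32 := far _ Xy.
have at32 : 32 <= alpha p y * enorm (y - z).
  by rewrite (le_trans _ (ler_pM (ltW a00) _ pa0 t32)) ?divr_ge0 ?(ltW a00)// mulrC divfK// gt_eqF.
have t1 : 1 <= enorm (y - z).
  by apply: le_trans t32; rewrite ler_pdivlMr// mul1r (le_trans a01)// ler1n.
split.
- exact: pa'.
- have -> : alpha p y * (1 / 2) * dotv (y - z) (y - z) =
      alpha p y * enorm (y - z) * enorm (y - z) / 2 by rewrite -sqr_enorm; ring.
  have h : 32 * 1 <= alpha p y * enorm (y - z) * enorm (y - z) by apply: ler_pM.
  by rewrite ler_pdivlMr// -natrM (le_trans _ h)// mulr1.
- apply: le_trans at32; rewrite (@le_trans _ _ 8)//; last by rewrite ler_nat.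
  by rewrite -[leRHS]mulr1 ler_wpM2l// ltW.
- by move=> h he; exact: translate_extended.
exists (cutoff Omega e y), (F y); split.
- exact: cutoff_bounds.
- exact: uE.
case: (cutoff_inner e Oy) => [->|iy]; first by rewrite !mul0r.
apply: ler_wpM2l; first by case/andP: (cutoff_bounds Omega y e0).
by apply: le_trans (vM y); apply: FM; exact: inner_sub_strip (ltW e1) iy.
Qed.

Section corkscrew.
Variable s : R.
Hypotheses (s0 : 0 < s) (s1 : s < 1).

(** With k = [barrier_rate] / r^2 one has a0 k (s r)^2 = 64, above the 16 that the barrier
    requires. *)
Definition barrier_rate : R := 64 / (a0 * s ^+ 2).
(** The exponentials are the values of the bump at distances s r / 2, 2 r and 3 r from its centre:
    the barrier is normalized on the first and last spheres, and the quotient is its relative height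
    on the middle one. *)
Definition decay_factor : R :=
  (expR (- (barrier_rate * (s ^+ 2 / 4))) - expR (- (barrier_rate * 4))) /
  (expR (- (barrier_rate * (s ^+ 2 / 4))) - expR (- (barrier_rate * 9))).

Let K0 : 0 < barrier_rate.
Proof. by rewrite divr_gt0// mulr_gt0// exprn_gt0. Qed.

Let e12 : expR (- (barrier_rate * 9)) < expR (- (barrier_rate * 4)).
Proof. by rewrite ltr_expR ltrN2 ltr_pM2l// ltr_nat. Qed.

Let e20 : expR (- (barrier_rate * 4)) < expR (- (barrier_rate * (s ^+ 2 / 4))).
Proof.
rewrite ltr_expR ltrN2 ltr_pM2l// ltr_pdivrMr//.
by rewrite (@lt_trans _ _ 1) ?exprn_ilt1 ?(ltW s0)// -natrM ltr1n.
Qed.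

Lemma decay_factor_bounds : 0 < decay_factor < 1.
Proof.
have h : 0 < expR (- (barrier_rate * (s ^+ 2 / 4))) - expR (- (barrier_rate * 9)).
  by rewrite subr_gt0 (lt_trans e12).
rewrite divr_gt0 ?subr_gt0//=; last by rewrite (lt_trans e12).
by rewrite ltr_pdivrMr// mul1r ltrD2l ltrN2.
Qed.

(* One step of the oscillation decay at the boundary point y: the barrier is
   centred at the centre z of the exterior ball. *)
Lemma boundary_decay F e u r y z f1 L : 0 < e < 1 -> dpp_representative Omega p F e u ->
  0 < r -> bd y -> enorm (z - y) < r -> eball z (s * r) `<=` ~` Omega ->
  e <= a0 * s * r / 16 -> 0 <= L ->
  (forall x, strip Omega 1 x -> enorm (x - y) <= 5 * r -> F x <= f1) ->
  (forall x, X e x -> enorm (x - y) <= 5 * r -> u x <= f1 + L) ->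
  forall x, X e x -> enorm (x - y) <= r -> u x <= f1 + decay_factor * L.
Proof.
move=> e01 [cu uE uF] r0 by_ zy zO esr L0 Ff uL x Xx xy; have [e0 e1] := andP e01.
(* For L = 0 the barrier would have amplitude 0, while [barrier_comparison] needs a positive
   [c2]. *)
have [L00|Ln0] := eqVneq L 0.
  have xy5 : enorm (x - y) <= 5 * r by rewrite (le_trans xy)// ler_peMl ?ler1n// ltW.
  by rewrite L00 mulr0 -{1}L00 uL.
have Lp : 0 < L by rewrite lt_def Ln0.
have as1 : a0 * s <= 1 by rewrite mulr_ile1 ?(ltW a00) ?(ltW s0) ?(ltW s1).
have r20 : 0 < r ^+ 2 by rewrite exprn_gt0.
have [d [d0 dE]] : exists d, 0 < d /\ d = a0 * s * r by exists (a0 * s * r); rewrite !mulr_gt0.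
have er : e <= r.
  apply: (le_trans esr); rewrite ler_pdivrMr//.
  by rewrite (@le_trans _ _ r) ?ger_pMl// ler_peMr ?ler1n// ltW.
have esr4 : 4 * e <= s * r.
  have : a0 * s * r <= s * r by rewrite -mulrA ger_pMl// mulr_gt0.
  by rewrite -dE; rewrite -dE in esr; exact: step_le_quarter.
pose k := barrier_rate / r ^+ 2.
have k0 : 0 < k by rewrite divr_gt0.
have := e20; have := e12.
set E0 := expR (- (barrier_rate * (s ^+ 2 / 4))).
set E1 := expR (- (barrier_rate * 9)).
set E2 := expR (- (barrier_rate * 4)) => h12 h20.
have E01 : 0 < E0 - E1 by rewrite subr_gt0 (lt_trans h12).
have kq q : k * (q * r) ^+ 2 = barrier_rate * q ^+ 2.
  by rewrite /k exprMn mulrCA [_ / _ * _]divfK ?gt_eqF// mulrC.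
have bump_le w q : 0 <= q -> q * r <= enorm (w - z) -> bump k z w <= expR (- (barrier_rate * q ^+ 2)).
  move=> q0 h; rewrite /bump ler_expR lerN2 -kq ler_pM2l// -sqr_enorm.
  by rewrite ler_pXn2r ?nnegrE ?enorm_ge0// mulr_ge0// ltW.
have bump_ge w q : 0 <= q -> enorm (w - z) <= q * r -> expR (- (barrier_rate * q ^+ 2)) <= bump k z w.
  move=> q0 h; rewrite /bump ler_expR lerN2 -kq ler_pM2l// -sqr_enorm.
  by rewrite ler_pXn2r ?nnegrE ?enorm_ge0// mulr_ge0// ltW.
(* The barrier takes the value f1 at distance s r / 2 from [z] and f1 + L at distance 3 r. *)
pose c2 := L / (E0 - E1); pose c1 := f1 + c2 * E0.
have c20 : 0 < c2 by rewrite divr_gt0.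
have c2E : c2 * (E0 - E1) = L by rewrite divfK// gt_eqF.
have v_inner w : s / 2 * r <= enorm (w - z) -> f1 <= c1 - c2 * bump k z w.
  move=> h; rewrite /c1 -addrA lerDl -mulrBr mulr_ge0 ?(ltW c20)// subr_ge0.
  have := bump_le w (s / 2); rewrite (_ : (s / 2) ^+ 2 = s ^+ 2 / 4); last by field.
  by apply => //; rewrite divr_ge0// ltW.
have v_outer w : 3 * r <= enorm (w - z) -> f1 + L <= c1 - c2 * bump k z w.
  move=> h; rewrite /c1 -c2E mulrBr addrA lerD2l lerN2 ler_pM2l//.
  have := bump_le w 3; rewrite (_ : 3 ^+ 2 = 9); last by rewrite -natrX.
  exact.
pose X' := X e `&` [set w | enorm (w - y) <= 5 * r].
have cX' : compact X'.
  apply: compact_closedI; first exact: compact_extended.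
  have ce : continuous (fun w : 'rV[R]_n => enorm (w - y)).
    apply: continuous_enorm; apply: (@lipschitz_continuous_rV _ _ _ _ 1) => a b.
    by rewrite opprB addrA subrK mul1r.
  exact: (closed_comp (fun x _ => ce x) (@closed_le _ (5 * r))).
have ball_closure w : closure Omega w -> s * r <= enorm (w - z).
  move=> cw; rewrite leNgt; apply/negP => wz.
  have q0 : 0 < s * r - enorm (w - z) by rewrite subr_gt0.
  have [w' Ow' w'w] := (closure_eballP _ _).1 cw _ q0.
  apply: zO Ow'; rewrite /eball/= (le_lt_trans (ler_enorm_dist _ w _))//.
  by rewrite -ltrBrDr.
have vx : u x <= c1 - c2 * bump k z x.
  have X'x : X' x by split => //=; rewrite (le_trans xy)// ler_peMl ?ler1n// ltW.
  apply: (barrier_comparison (p := p) e0 cu cX' k0 c20 _ _ X'x).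
    rewrite /k mulrAC ler_pdivrMr//.
    have e2 : e ^+ 2 <= (a0 * s * r / 16) ^+ 2.
      by rewrite ler_pXn2r ?nnegrE ?(ltW e0)// divr_ge0// -dE ltW.
    apply: (le_trans (ler_wpM2l (ltW K0) e2)).
    have -> : barrier_rate * (a0 * s * r / 16) ^+ 2 = a0 * r ^+ 2 / 4.
      by rewrite /barrier_rate; field; rewrite !gt_eqF.
    have : a0 * r ^+ 2 <= 1 * r ^+ 2 by rewrite ler_wpM2r// ltW.
    by move/quarter_le_half; apply.
  (* Beyond 3 r the outer bound suffices. Closer to [z], the point is within 4 r of [y], and a step
     of length e <= r stays in the ball of radius 5 r. *)
  move=> w [Xw wy]; have [far|near] := leP (3 * r) (enorm (w - z)).
    by left; rewrite (le_trans (uL w Xw wy))// v_outer.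
  have wy4 : enorm (w - y) <= 4 * r.
    rewrite (le_trans (ler_enorm_dist _ z _))//.
    exact: add_le4.
  (* Outside [Omega] the point is within 2 e of the boundary, hence at distance at least s r - 2 e
     >= s r / 2 from [z]. *)
  have [Ow|nOw] := pselect (Omega w); last first.
    left; have Fw := Ff w (outside_sub_strip oO (ltW e1) Xw nOw) wy.
    rewrite uF// (le_trans Fw)// v_inner//.
    have [b bb wb] := near_boundary_of_extended O0 oO bO Xw nOw e0.
    have h1 := ball_closure b (boundary_closure bb).
    have h2 := ler_enorm_dist b w z.
    rewrite enormB in wb; rewrite mulrAC; exact: half_le_dist wb h1 h2 esr4.
  right; have /andP[pa0 pa1] := pa Ow.
  have wz := ball_closure w (@subset_closure _ _ _ Ow).
  split.
  - exact: pa'.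
  - have h1 : (s * r) ^+ 2 <= dotv (w - z) (w - z).
      by rewrite -sqr_enorm ler_pXn2r ?nnegrE ?enorm_ge0// ltW// mulr_gt0.
    have h2 : a0 * k * (s * r) ^+ 2 <= alpha p w * k * dotv (w - z) (w - z).
      have h3 : a0 * k <= alpha p w * k by rewrite ler_wpM2r// ltW.
      have h4 : 0 <= a0 * k by rewrite mulr_ge0// ltW.
      by rewrite (ler_pM h4 (sqr_ge0 _) h3 h1).
    apply: le_trans h2; rewrite -mulrA kq.
    rewrite (_ : a0 * (barrier_rate * s ^+ 2) = 64); first by rewrite ler_nat.
    by rewrite /barrier_rate; field; rewrite !gt_eqF.
  - apply: (@le_trans _ _ (a0 * (s * r))).
      by rewrite mulrA -dE; rewrite -dE in esr; exact: step_le_eighth.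
    by rewrite ler_pM// ltW// mulr_gt0.
  - move=> h he; split; first exact: translate_extended.
    rewrite /=; have -> : w + h - y = (w - y) + h by rewrite addrAC.
    rewrite (le_trans (ler_enormD _ _))//.
    rewrite (_ : 5 * r = 4 * r + r); last by ring.
    by rewrite lerD// (le_trans he).
  exists (cutoff Omega e w), (F w); split.
  - exact: cutoff_bounds.
  - exact: uE.
  case: (cutoff_inner e Ow) => [->|iw]; first by rewrite !mul0r.
  apply: ler_wpM2l; first by case/andP: (cutoff_bounds Omega w e0).
  rewrite (le_trans (Ff w _ wy))//; first exact: inner_sub_strip (ltW e1) iw.
  apply: v_inner; apply: le_trans wz; rewrite ler_pM2r//.
  by rewrite ler_pdivrMr// ler_peMr ?ler1n// ltW.
apply: (le_trans vx); rewrite /c1 -addrA lerD2l -mulrBr /decay_factor -/E0 -/E1 -/E2.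
rewrite (_ : (E0 - E2) / (E0 - E1) * L = c2 * (E0 - E2)); last by rewrite /c2; ring.
rewrite ler_pM2l// lerD2l lerN2.
have xz : enorm (x - z) <= 2 * r.
  rewrite (le_trans (ler_enorm_dist _ y _))// [enorm (y - z)]enormB.
  exact: add_le2.
have := bump_ge x 2; rewrite (_ : 2 ^+ 2 = 4 :> R); last by rewrite -natrX.
exact.
Qed.

End corkscrew.

Hypothesis rO : boundary_regular Omega.

(** [boundary_decay] is iterated on radii shrinking by the factor 5, starting from the excess 2 M.
    The term eta / 2 absorbs the oscillation of [F] near [y], and the decay makes the rest at most
    eta / 2. The radius and the bound on [e] after k steps do not depend on [u] or [y]. *)
Lemma boundary_modulus_le F eta : {within strip Omega 1, continuous F} -> 0 < eta ->
  exists rho eps : R, [/\ 0 < rho, 0 < eps <= 1 & forall e u y x, 0 < e < eps ->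
    dpp_representative Omega p F e u -> bd y -> X e x -> enorm (x - y) <= rho ->
    u x <= F y + eta].
Proof.
move=> cF eta0; have cS := compact_strip O0 oO bO.
have eta2 : 0 < eta / 2 by rewrite divr_gt0.
have [rF rF0 hF] := uniform_on_compact cS cF eta2.
have [M M0 FM] := bounded_on_compact cS cF.
have [r0 [s [/andP[r00 r01] /andP[s0 s1] cork]]] := rO.
pose th := decay_factor s; have /andP[th0 th1] := decay_factor_bounds s0 s1.
have step k : exists rho eps : R, [/\ 0 < rho, rho <= r0, 5 * rho < 5 * rF, 0 < eps <= 1 &
    forall e u y x, 0 < e < eps ->
    dpp_representative Omega p F e u -> bd y -> X e x -> enorm (x - y) <= rho ->
    u x <= (F y + eta / 2) + th ^+ k * (2 * M)].
  elim: k => [|k [rho [eps [rho0 rhor rhoF /andP[eps0 eps1] IH]]]].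
    exists (Num.min r0 (rF / 2)), 1; split.
    - by rewrite lt_min r00 divr_gt0.
    - by rewrite ge_min lexx.
    - rewrite ltr_pM2l// gt_min; apply/orP; right.
      by rewrite ltr_pdivrMr// ltr_pMr// ltr1n.
    - by rewrite ltr01 lexx.
    move=> e u y x e01 du by_ Xx _; rewrite expr0 mul1r.
    have uM : u x <= M.
      apply: (dpp_le_max e01 du) => // w sw; exact: le_trans (ler_norm _) (FM w sw).
    have : - M <= F y.
      by have := FM y (boundary_sub_strip by_); rewrite ler_norml => /andP[].
    by move: uM eta2; move: (u x) (F y) => a b; lra.
  pose r := rho / 5; have r_0 : 0 < r by rewrite divr_gt0.
  have r5 : 5 * r = rho by rewrite mulrC divfK.
  have rle : r <= rho by rewrite -r5 ler_peMl ?ler1n// ltW.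
  exists r, (Num.min eps (a0 * s * r / 16)); split => //.
  - exact: le_trans rhor.
  - by apply: le_lt_trans rhoF; rewrite ler_pM2l.
  - rewrite lt_min eps0 ge_min eps1 andbT/= divr_gt0// !mulr_gt0//.
  move=> e u y x /andP[e0]; rewrite lt_min => /andP[ee es] du by_ Xx xy.
  have e01 : 0 < e < 1 by rewrite e0 (lt_le_trans ee).
  have r_r0 : 0 < r <= r0 by rewrite r_0 (le_trans rle).
  have [z [zy _] zb] := cork r y r_r0 by_.
  rewrite exprS -mulrA; apply: (boundary_decay s0 s1 e01 du r_0 by_ zy _ (ltW es) _ _ _ Xx xy).
  - by move=> w /zb [].
  - by rewrite mulr_ge0 ?exprn_ge0 ?(ltW th0)// mulr_ge0// ltW.
  - move=> w sw wy; rewrite -lerBlDl (le_trans (ler_norm _))// ltW// hF//.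
      exact: boundary_sub_strip.
    rewrite (le_lt_trans wy)// r5.
    by move: rhoF; rewrite ltr_pM2l.
  - move=> w Xw; rewrite r5 => wy; apply: (IH e) => //; by rewrite e0 ee.
have [k hk] : exists k, th ^+ k * (2 * M) <= eta / 2.
  have M2 : 0 < 2 * M by rewrite mulr_gt0.
  have q0 : 0 < eta / 2 / (2 * M) by rewrite divr_gt0.
  have : th ^+ k @[k --> \oo] --> (0 : R) by apply: cvg_expr; rewrite gtr0_norm.
  move=> /cvgrPdist_lt/(_ _ q0)[k _ hk]; exists k; rewrite -ler_pdivlMr//.
  by have := hk k (leqnn k); rewrite /= sub0r normrN => /ltW; apply: le_trans; exact: ler_norm.
have [rho [eps [rho0 _ _ eps01 h]]] := step k.
exists rho, eps; split => // e u y x e01 du by_ Xx xy.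
apply: (le_trans (h e u y x e01 du by_ Xx xy)).
by rewrite -addrA lerD2l; apply: (le_trans (lerD (lexx _) hk)); rewrite -splitr.
Qed.

Lemma boundary_modulus F eta : {within strip Omega 1, continuous F} -> 0 < eta ->
  exists rho eps : R, [/\ 0 < rho, 0 < eps <= 1 & forall e u y x, 0 < e < eps ->
    dpp_representative Omega p F e u -> bd y -> X e x -> enorm (x - y) <= rho ->
    `|u x - F y| <= eta].
Proof.
move=> cF eta0; have [r1 [e1 [r10 /andP[e10 e11] h1]]] := boundary_modulus_le cF eta0.
have cNF : {within strip Omega 1, continuous (fun x => - F x)}.
  by move=> x; apply: continuousN; exact: cF.
have [r2 [e2 [r20 /andP[e20 e21] h2]]] := boundary_modulus_le cNF eta0.
exists (Num.min r1 r2), (Num.min e1 e2); split.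
- by rewrite lt_min r10.
- by rewrite lt_min e10 e20 ge_min e11.
move=> e u y x /andP[e0]; rewrite lt_min => /andP[ee1 ee2] du by_ Xx.
rewrite le_min => /andP[xy1 xy2].
have H1 := h1 e u y x _ du by_ Xx xy1; rewrite e0 ee1 in H1.
have H2 := h2 e (fun x => - u x) y x _ (dpp_representative_opp e0 du) by_ Xx xy2.
rewrite e0 ee2 in H2; rewrite ler_norml lerBlDl H1// andbT lerBrDl.
by rewrite -lerN2 opprB addrC; exact: H2.
Qed.

End boundary_estimate.

(** * Asymptotic equicontinuity and compactness *)

Section gauge_arithmetic.
Variable R : realType.

(** [K] is such that K EN = 2 qe, and [J] exceeds 2 q1 by enough for the meeting regime; the bound
    on [qe] keeps this excess at most q1, since 4 qe + 2 K = qe (4 + 4 / EN). *)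
Lemma gauge_constants (a0 q1 qe K EN sig J : R) : 0 < a0 -> a0 <= 1 -> 0 < q1 -> 0 <= qe -> 0 < EN ->
  K = 2 * qe / EN -> sig <= qe -> qe <= q1 * a0 / (4 + 4 / EN) ->
  J = 2 * q1 + (4 * qe + 2 * K) / a0 ->
  0 <= K /\ [/\ K <= J, 2 * qe + 2 * K + 2 * sig <= a0 * J, qe + sig <= K * EN,
      2 * q1 <= J - K & J <= 3 * q1].
Proof.
move=> a00 a01 q10 qe0 EN0 KE sq qeb JE.
have K0 : 0 <= K by rewrite KE divr_ge0 ?mulr_ge0// ltW.
have P : 2 * K <= (4 * qe + 2 * K) / a0.
  rewrite ler_pdivlMr//; have : 2 * K * a0 <= 2 * K * 1 by rewrite ler_wpM2l// mulr_ge0.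
  by move: qe0; lra.
have aJ : a0 * J = 2 * (a0 * q1) + 4 * qe + 2 * K by rewrite JE; field; rewrite gt_eqF.
have aq : 0 < a0 * q1 by rewrite mulr_gt0.
have KEN : K * EN = 2 * qe by rewrite KE divfK// gt_eqF.
split; [exact: K0|split].
- by rewrite JE; move: P K0 q10; lra.
- by rewrite aJ; move: aq sq; lra.
- by rewrite KEN; move: sq; lra.
- by rewrite JE; move: P K0; lra.
have c0 : 0 < 4 + 4 / EN by rewrite addr_gt0// divr_gt0.
have : (4 * qe + 2 * K) / a0 <= q1.
  rewrite ler_pdivrMr//; move: qeb; rewrite ler_pdivlMr//.
  by rewrite KE (_ : 4 * qe + 2 * (2 * qe / EN) = qe * (4 + 4 / EN)); last by ring.
by rewrite JE; move: q10; lra.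
Qed.

Lemma mul_sqrt_le (C Q e : R) : 0 < C -> 0 <= Q -> 0 <= e -> e <= (Q / C) ^+ 2 / 2 ->
  C * Num.sqrt (2 * e) <= Q.
Proof.
move=> C0 Q0 e0; rewrite ler_pdivlMr// => eQ.
rewrite mulrC -ler_pdivlMr// le_of_sqr ?divr_ge0 ?(ltW C0)// sqr_sqrtr ?mulr_ge0//.
by rewrite mulrC.
Qed.

End gauge_arithmetic.

(** * Domination by the gauge and asymptotic equicontinuity *)

Section equicontinuity.
Variables (R : realType) (m : nat).
Local Notation n := m.+2.
Implicit Types (x y z b h w : 'rV[R]_n) (p F u : 'rV[R]_n -> R) (e r : R).
Variables (Omega : set 'rV[R]_n) (p F : 'rV[R]_n -> R) (a0 : R).
Hypotheses (O0 : Omega !=set0) (oO : open Omega) (bO : bounded_set Omega).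
Hypotheses (a00 : 0 < a0) (a01 : a0 <= 1).
Hypothesis pa : forall x, Omega x -> a0 <= alpha p x <= 1.
Hypothesis pu : forall q, 0 < q -> exists2 r, 0 < r &
  forall x z, Omega x -> Omega z -> enorm (x - z) < r -> `|alpha p x - alpha p z| < q.
Hypothesis rO : boundary_regular Omega.
Hypothesis cF : {within strip Omega 1, continuous F}.
Local Notation X e := (closure (Defs.extended Omega e)).
Local Notation bd := (boundary Omega).

Lemma gauge_ge (C K J lam e : R) w : 0 <= lam -> 0 < e -> 0 <= K -> w != 0 ->
  J - K + C * rootn w <= coupling_gauge C K J lam e w.
Proof.
move=> l0 e0 K0 w0; rewrite /coupling_gauge (negPf w0) addrAC lerD2l lerN2.
rewrite -[leRHS]mulr1 ler_wpM2l// -[leRHS]expR0 ler_expR oppr_le0.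
by rewrite divr_ge0 ?(ltW e0)// mulr_ge0// enorm_ge0.
Qed.

(** Let T be the supremum of u x - u z - G (x - z). Pairs at distance at least r1 are settled by the
    size of [C], pairs with a point near the boundary by 2 q <= J - K. On the other pairs the cutoff
    vanishes at both points and [coupling_improvement] with Theta = T yields T - sig. So a positive
    T would satisfy T <= max (0, T - sig), which is absurd; no maximizing pair is needed. *)
Lemma dominated_by_gauge u e (C K J lam sig r1 M q rho : R) :
  0 < e < 1 -> dpp_representative Omega p F e u ->
  0 <= C -> 0 <= K -> K <= J -> 0 <= lam -> 4 <= a0 * expR lam -> 0 < sig ->
  2 * (C * Num.sqrt (2 * e)) + 2 * K + 2 * sig <= a0 * J ->
  C * Num.sqrt (2 * e) + sig <= K * expR (- (lam * (96 / a0 ^+ 2))) ->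
  sig <= K * expR (- (lam * r1 / e)) ->
  (forall x z, Omega x -> Omega z -> enorm (x - z) < r1 -> `|alpha p x - alpha p z| <= a0 / 8) ->
  (forall x, X e x -> `|u x| <= M) -> 2 * M <= C * Num.sqrt r1 ->
  2 * e + r1 <= rho -> 2 * q <= J - K ->
  (forall b x, bd b -> X e x -> enorm (x - b) <= rho -> `|u x - F b| <= q) ->
  forall x z, X e x -> X e z -> u x - u z <= coupling_gauge C K J lam e (x - z).
Proof.
move=> e01 [cu uE uF] C0 K0 KJ l0 aL sig0 h1 h2 h3 hal uM CM erho qJ hb x z Xx Xz.
have [e0 e1] := andP e01.
pose G : 'rV[R]_n -> R := coupling_gauge C K J lam e.
have G0 : G 0 = 0 by rewrite /G /coupling_gauge eqxx.
have Gge w : w != 0 -> J - K + C * rootn w <= G w by exact: gauge_ge.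
have Gnn w : 0 <= G w.
  have [->|w0] := eqVneq w 0; first by rewrite G0.
  apply: le_trans (Gge w w0); apply: addr_ge0; first by rewrite subr_ge0.
  by rewrite mulr_ge0 ?rootn_ge0.
pose S := [set v : R | exists x z, [/\ X e x, X e z & v = u x - u z - G (x - z)]].
have S0 : S !=set0 by exists (u x - u z - G (x - z)); exists x, z.
have uM2 a b : X e a -> X e b -> u a - u b <= 2 * M.
  move=> /uM; rewrite ler_norml => /andP[_ ha] /uM; rewrite ler_norml => /andP[hb' _].
  by rewrite mulr_natl mulr2n lerD// lerNl.
have hS : has_sup S.
  split => //; exists (2 * M) => _ [a [b [Xa Xb ->]]].
  by rewrite (le_trans _ (uM2 a b Xa Xb))// gerBl.
have [T TE] : {T | T = sup S} by exists (sup S).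
have leT a b : X e a -> X e b -> u a - u b <= T + G (a - b).
  move=> Xa Xb; rewrite -lerBlDr TE; apply: sup_upper_bound => //.
  by exists a, b.
suff T0 : T <= 0.
  by rewrite (le_trans (leT x z Xx Xz))// gerDr.
rewrite leNgt; apply/negP => T0.
suff : T <= Num.max 0 (T - sig).
  by rewrite le_max => /orP[]; rewrite leNgt ?T0// gtrBl sig0.
rewrite {1}TE; apply: sup_le_ub => // _ [a [b [Xa Xb ->]]].
rewrite le_max; have [->|ab] := eqVneq a b; first by rewrite !subrr G0 subr0 lexx.
have w0 : a - b != 0 by rewrite subr_eq0.
have [far|near] := leP r1 (enorm (a - b)).
  apply/orP; left; rewrite subr_le0 (le_trans (uM2 a b Xa Xb))// (le_trans CM)//.
  apply: le_trans (Gge _ w0); rewrite -[leLHS]add0r lerD ?subr_ge0//.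
  by rewrite ler_wpM2l// ler_wsqrtr.
have bdc c : bd c -> enorm (a - c) < 2 * e \/ enorm (b - c) < 2 * e ->
    (u a - u b - G (a - b) <= 0) || (u a - u b - G (a - b) <= T - sig).
  move=> bc hc; apply/orP; left.
  have [ac bc'] : enorm (a - c) <= rho /\ enorm (b - c) <= rho.
    have ha := ler_enorm_dist a b c; have hb2 := ler_enorm_dist b a c.
    rewrite [enorm (b - a)]enormB in hb2.
    have r10 : 0 <= r1 by rewrite (le_trans (enorm_ge0 _) (ltW near)).
    split; case: hc => hc; apply: le_trans erho.
    - by rewrite (le_trans (ltW hc))// lerDl.
    - by rewrite (le_trans ha)// addrC lerD// ltW.
    - by rewrite (le_trans hb2)// addrC lerD// ltW.
    - by rewrite (le_trans (ltW hc))// lerDl.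
  have := hb c a bc Xa ac; have := hb c b bc Xb bc'.
  rewrite !ler_norml => /andP[hb1 _] /andP[_ ha1].
  rewrite subr_le0; apply: le_trans (Gge _ w0).
  rewrite (le_trans _ (_ : J - K <= _))//; last by rewrite lerDl mulr_ge0 ?rootn_ge0.
  apply: le_trans qJ; rewrite (_ : u a - u b = (u a - F c) - (u b - F c)); last by ring.
  by rewrite mulr_natl mulr2n lerD// lerNl.
have inO c : X e c -> c = a \/ c = b -> (Omega c /\ cutoff Omega e c = 0) \/
    ((u a - u b - G (a - b) <= 0) || (u a - u b - G (a - b) <= T - sig)).
  move=> Xc cab; have [Oc|nOc] := pselect (Omega c).
    case: (cutoff_inner e Oc) => [c0|ic]; first by left.
    have [d bd_ cd] := near_boundary_of_inner O0 oO bO ic.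
    have {}cd : enorm (c - d) < 2 * e by rewrite (lt_trans cd)// ltr_pMl// ltr1n.
    right; apply: (bdc d) => //; by case: cab => <-; [left|right].
  have [d bd_ cd] := near_boundary_of_extended O0 oO bO Xc nOc e0.
  right; apply: (bdc d) => //; by case: cab => <-; [left|right].
case: (inO a Xa (or_introl erefl)) => [[Oa ca]|//].
case: (inO b Xb (or_intror erefl)) => [[Ob cb]|//].
apply/orP; right; rewrite lerBlDr (addrAC T).
have ua : u a = midrange p e u a by rewrite {1}uE// ca subr0 mul1r mul0r addr0.
have ub : u b = midrange p e u b by rewrite {1}uE// cb subr0 mul1r mul0r addr0.
rewrite ua ub; apply: (@coupling_improvement R m p u e a b a0 C K J lam sig r1 T) => //.
- exact: pa.
- exact: pa.
- exact: hal.
- exact: ltW.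
- exact: ltW.
- move=> h h' he he'; have -> : a - b + (h - h') = (a + h) - (b + h') by rewrite opprD addrACA.
  by apply: leT; exact: translate_extended.
Qed.

(** [rho], [r1], [C] and [lam] are fixed independently of [e]; then [e] is taken so small that C (2
    e)^(1/2) <= Q0, which keeps J <= 3 q1. [K], [sig] and [J] depend on [e], harmlessly, as the
    final bound does not. *)
Lemma asymptotic_equicontinuity eta : 0 < eta ->
  exists r eps : R, [/\ 0 < r, 0 < eps <= 1 & forall e u x z, 0 < e < eps ->
    dpp_representative Omega p F e u -> X e x -> X e z -> enorm (x - z) < r ->
    `|u x - u z| <= eta].
Proof.
(* Three quarters of [eta] are for the jump [J], one for the square-root term. *)
move=> eta0; pose q1 := eta / 4; have q10 : 0 < q1 by rewrite divr_gt0.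
have [rho [eps0 [rho0 /andP[eps00 eps01] hb]]] := boundary_modulus O0 oO bO a00 a01 pa rO cF q10.
have a8 : 0 < a0 / 8 by rewrite divr_gt0.
have [ra ra0 hra] := pu a8.
pose r1 := Num.min (rho / 2) ra.
have r10 : 0 < r1 by rewrite lt_min ra0 divr_gt0.
have [M M0 FM] := bounded_on_compact (compact_strip O0 oO bO) cF.
have sr0 : 0 < Num.sqrt r1 by rewrite sqrtr_gt0.
pose C := 2 * M / Num.sqrt r1.
have C0 : 0 < C by rewrite divr_gt0// mulr_gt0.
(* Then exp lam >= 1 + lam >= 4 / a0. *)
pose lam := 4 / a0; have lam0 : 0 < lam by rewrite divr_gt0.
have aL : 4 <= a0 * expR lam.
  rewrite mulrC -ler_pdivrMr// -/lam (le_trans _ (expR_ge1Dx _))//.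
  by rewrite lerDr.
pose EN := expR (- (lam * (96 / a0 ^+ 2))).
have EN0 : 0 < EN by exact: expR_gt0.
pose Q0 := q1 * a0 / (4 + 4 / EN).
have Q00 : 0 < Q0 by rewrite divr_gt0 ?mulr_gt0// addr_gt0// divr_gt0.
pose r := Num.min r1 ((q1 / C) ^+ 2).
pose eps := Num.min eps0 (Num.min (rho / 4) ((Q0 / C) ^+ 2 / 2)).
exists r, eps; split.
- by rewrite lt_min r10 exprn_gt0// divr_gt0.
- have rho4 : 0 < rho / 4 by rewrite divr_gt0.
  have QC : 0 < (Q0 / C) ^+ 2 / 2 by rewrite divr_gt0// exprn_gt0// divr_gt0.
  by rewrite !lt_min eps00 rho4 QC ge_min eps01.
suff main e u x z : 0 < e < eps -> dpp_representative Omega p F e u -> X e x -> X e z ->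
    enorm (x - z) < r -> u x - u z <= eta.
  move=> e u x z he du Xx Xz xz; rewrite ler_norml (main e u x z he du Xx Xz xz) andbT lerNl opprB.
  by apply: (main e u z x he du Xz Xx); rewrite enormB; exact: xz.
move=> /andP[e0]; rewrite !lt_min => /andP[ee0 /andP[erho eQ]] du Xx Xz xz.
have e01 : 0 < e < 1 by rewrite e0 (lt_le_trans ee0).
pose qe := C * Num.sqrt (2 * e).
have qe0 : 0 < qe by rewrite mulr_gt0// sqrtr_gt0 mulr_gt0.
have qeQ : qe <= Q0.
  exact: (mul_sqrt_le C0 (ltW Q00) (ltW e0) (ltW eQ)).
pose K := 2 * qe / EN; pose sig := Num.min qe (K * expR (- (lam * r1 / e))).
have K0' : 0 < K by rewrite divr_gt0// mulr_gt0.
have sig0 : 0 < sig by rewrite lt_min qe0 mulr_gt0// expR_gt0.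
have sigq : sig <= qe by rewrite ge_min lexx.
pose J := 2 * q1 + (4 * qe + 2 * K) / a0.
have [K0 [KJ h1 h2 qJ J3]] := gauge_constants a00 a01 q10 (ltW qe0) EN0 (erefl K) sigq qeQ (erefl J).
have uM y : X e y -> `|u y| <= M.
  move=> Xy; rewrite ler_norml lerNl; apply/andP; split.
    apply: (dpp_le_max O0 oO bO a00 a01 pa e01 (dpp_representative_opp e0 du)) => // w sw.
    by rewrite (le_trans _ (FM w sw))// -normrN ler_norm.
  apply: (dpp_le_max O0 oO bO a00 a01 pa e01 du) => // w sw.
  by rewrite (le_trans _ (FM w sw))// ler_norm.
have h3 : sig <= K * expR (- (lam * r1 / e)) by rewrite ge_min lexx orbT.
have hal a b : Omega a -> Omega b -> enorm (a - b) < r1 -> `|alpha p a - alpha p b| <= a0 / 8.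
  by move=> Oa Ob; rewrite lt_min => /andP[_ ab]; rewrite ltW// hra.
have CM : 2 * M <= C * Num.sqrt r1 by rewrite divfK// gt_eqF.
have er : 2 * e + r1 <= rho.
  rewrite (splitr rho) lerD ?ge_min ?lexx//.
  have -> : rho / 2 = 2 * (rho / 4) by field.
  by rewrite ler_pM2l// ltW.
have hb' b y : bd b -> X e y -> enorm (y - b) <= rho -> `|u y - F b| <= q1.
  by move=> bb Xy yb; apply: (hb e) => //; rewrite e0.
have := dominated_by_gauge e01 du (ltW C0) K0 KJ (ltW lam0) aL sig0 h1 h2 h3 hal uM CM er qJ hb' Xx Xz.
move/le_trans; apply; rewrite /coupling_gauge; case: ifP => [_|_]; first exact: ltW.
have eta4 : eta = 3 * q1 + q1 by rewrite /q1; field.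
rewrite eta4 -addrA lerD// (@le_trans _ _ (C * rootn (x - z)))//.
  by rewrite gerBl mulr_ge0 ?expR_ge0.
rewrite mulrC -ler_pdivlMr//; apply: le_of_sqr.
  exact: (divr_ge0 (ltW q10) (ltW C0)).
by rewrite rootn2 ltW//; case/andP: xz.
Qed.

End equicontinuity.

(** * Compactness of an asymptotically equicontinuous family *)

Section asymptotic_arzela_ascoli.
Variables (R : realType) (m : nat).
Local Notation n := m.+1.
Implicit Types (x y z : 'rV[R]_n).

Lemma ultra_bounded_cvg (T : Type) (G : set_system T) (UG : UltraFilter G) (f : T -> R) M :
  G [set t | `|f t| <= M] ->
  exists c, forall d, 0 < d -> G [set t | `|f t - c| < d].
Proof.
move=> fM; have PG : ProperFilter G by exact: ultra_proper.
have fMG : (f @ G) [set` `[(- M), M]].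
  have : G (f @^-1` [set` `[(- M), M]]) by apply: filterS fM => t /=; rewrite in_itv /= ler_norml.
  exact: id.
have [c [_ cc]] := @segment_compact R (- M) M (f @ G) _ fMG.
exists c => d d0.
have [//|nG] := in_ultra_setVsetC [set t | `|f t - c| < d] UG.
have nG' : (f @ G) [set y | d <= `|y - c|].
  have : G (f @^-1` [set y | d <= `|y - c|]) by apply: filterS nG => t /= /negP; rewrite -leNgt.
  exact: id.
have [y [/= dy]] := cc _ (ball c d) nG' (nbhsx_ballx _ _ d0).
by rewrite /ball /= distrC ltNge dy.
Qed.

Variables (A : set 'rV[R]_n) (f : R -> 'rV[R]_n -> R) (M : R).
Hypothesis cA : compact A.
Hypothesis fM : forall e x, 0 < e < 1 -> A x -> `|f e x| <= M.
Hypothesis ec : forall eta, 0 < eta -> exists r eps : R, [/\ 0 < r, 0 < eps <= 1 &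
  forall e x z, 0 < e < eps -> A x -> A z -> enorm (x - z) < r -> `|f e x - f e z| <= eta].

(** The ultrafilter gives a limit at all points of [A] at once, without diagonal extraction;
    equicontinuity and compactness make the convergence along it uniform. A sequence is extracted
    only at the end, one parameter from each of countably many sets of the ultrafilter. *)
Lemma asymptotic_arzela_ascoli : exists (u : 'rV[R]_n -> R) (e : nat -> R),
  [/\ forall i, 0 < e i < 1, e @ \oo --> (0 : R),
      {uniform A, (fun i => f (e i)) @ \oo --> u},
      forall d, 0 < d -> \forall k \near \oo, forall x, A x -> `|f (e k) x - u x| <= d &
      forall eta, 0 < eta -> exists2 r : R, 0 < r &
        forall x z, A x -> A z -> enorm (x - z) < r -> `|u x - u z| <= eta].
Proof.
have [G [UG GF]] := ultraFilterLemma (at_right_proper_filter (0 : R)).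
have PG : ProperFilter G by exact: ultra_proper.
have Gsmall d : 0 < d -> G [set e | 0 < e < d].
  move=> d0; apply: GF; near=> e => /=; apply/andP; split; first by near: e; exact: nbhs_right_gt.
  by near: e; exact: nbhs_right_lt.
have [u uE] : exists u : 'rV[R]_n -> R, forall x, A x ->
    forall d, 0 < d -> G [set e | `|f e x - u x| < d].
  suff /choice[u hu] : forall x, exists c, A x -> forall d, 0 < d -> G [set e | `|f e x - c| < d].
    by exists u.
  move=> x; have [Ax|nAx] := pselect (A x); last by exists 0.
  have [|c hc] := @ultra_bounded_cvg _ G UG (f^~ x) M; last by exists c.
  by apply: filterS (Gsmall _ ltr01) => e /= e01; exact: fM.
have um eta : 0 < eta -> exists2 r : R, 0 < r &
    forall x z, A x -> A z -> enorm (x - z) < r -> `|u x - u z| <= eta.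
  move=> eta0; have eta3 : 0 < eta / 3 by rewrite divr_gt0.
  have [r [eps [r0 /andP[eps0 _] h]]] := ec eta3.
  exists r => // x z Ax Az xz.
  have [e [[/= he hx] hz]] := filter_ex (filterI (filterI (Gsmall _ eps0) (uE _ Ax _ eta3)) (uE _ Az _ eta3)).
  have := h e x z he Ax Az xz; move: hx hz => /=.
  move: (f e x) (f e z) (u x) (u z) => a b c d.
  by rewrite !ltr_norml !ler_norml => /andP[? ?] /andP[? ?] /andP[? ?]; apply/andP; split; lra.
have cvu eta : 0 < eta -> G [set e | forall x, A x -> `|f e x - u x| <= eta].
  move=> eta0; have eta3 : 0 < eta / 3 by rewrite divr_gt0.
  suff H : forall x, A x -> \forall x' \near x & e \near G, A x' -> `|f e x' - u x'| <= eta.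
    have := (compact_near_coveringP A).1 cA R G (fun e x => A x -> `|f e x - u x| <= eta) (@ultra_proper _ _ UG) H.
    by move/filterS; apply => e /= h x Ax; exact: h.
  move=> x Ax.
  have [r [eps [r0 /andP[eps0 _] h]]] := ec eta3.
  have [s s0 hs] := um _ eta3.
  exists (eball x (Num.min r s), [set e | 0 < e < eps] `&` [set e | `|f e x - u x| < eta / 3]).
    split => /=; first by apply: nbhs_eball; rewrite lt_min r0.
    by apply: filterI; [exact: Gsmall|exact: uE].
  move=> [y e] /= [yx [he hx]] Ay; move: yx; rewrite /eball /= lt_min => /andP[yr ys].
  have := h e y x he Ay Ax yr; have := hs y x Ay Ax ys; move: hx.
  move: (f e x) (f e y) (u x) (u y) => a b c d.
  by rewrite !ltr_norml !ler_norml => /andP[? ?] /andP[? ?] /andP[? ?]; apply/andP; split; lra.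
have /choice[e he] : forall k, exists e : R, 0 < e < k.+2%:R^-1 /\
    forall x, A x -> `|f e x - u x| <= k.+2%:R^-1.
  move=> k; have k0 : 0 < k.+2%:R^-1 :> R by rewrite invr_gt0.
  by have [e [? ?]] := filter_ex (filterI (Gsmall _ k0) (cvu _ k0)); exists e.
have small (d : R) : 0 < d -> \forall k \near \oo, k.+2%:R^-1 < d.
  move=> d0; near=> k; rewrite invf_plt ?posrE//.
  apply: lt_trans (_ : k%:R < _); last by rewrite ltr_nat ltnW.
  by near: k; exact: nbhs_infty_gtr.
exists u, e; split.
- move=> i; have [/andP[-> h2] _] := he i; rewrite (lt_trans h2)//.
  by rewrite invf_lt1// ltr1n.
- apply/cvgrPdist_lt => d d0; near=> k.
  have [/andP[h1 h2] _] := he k.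
  rewrite sub0r normrN gtr0_norm// (lt_trans h2)//.
  by near: k; exact: small.
- move=> P /uniform_nbhs[E [/= entE EP]].
  have [d d0 dE] : exists2 d : R, 0 < d & forall a b : R, `|a - b| < d -> E (a, b).
    move: entE; rewrite -entourage_ballE => -[d d0 dE]; exists d => // a b ab.
    by apply: dE.
  rewrite /nbhs /=; near=> k; apply: EP => y Ay /=; apply: dE.
  have [_ h] := he k; rewrite distrC (le_lt_trans (h y Ay))//.
  by near: k; exact: small.
- move=> d d0; near=> k => x Ax; have [_ h] := he k; apply: (le_trans (h x Ax)).
  by apply: ltW; near: k; exact: small.
- exact: um.
Unshelve. all: by end_near. Qed.

End asymptotic_arzela_ascoli.

(** * Second-order expansions *)

Section mean_value.
Variable R : realType.

Lemma mean_value_bound (f df : R -> R) (b C : R) : 0 <= b ->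
  (forall t, 0 <= t <= b -> is_derive t 1 f (df t)) -> (forall t, 0 <= t <= b -> `|df t| <= C) ->
  `|f b - f 0| <= C * b.
Proof.
move=> b0 fd dfC; have [||c] := @MVT_segment R f df 0 b b0.
- by move=> t; rewrite in_itv /= => /andP[t0 tb]; apply: fd; rewrite !ltW.
- apply: derivable_within_continuous => t; rewrite in_itv /= => tb.
  by have [] := fd t tb.
rewrite in_itv /= => cb ->; rewrite subr0 normrM (ger0_norm b0).
by rewrite ler_wpM2r// dfC.
Qed.

Lemma is_derive_quadratic (a b c t : R) :
  is_derive t (1 : R) (fun s : R => a * s ^+ 2 + b * s + c) (2 * a * t + b).
Proof.
pose P : {poly R} := a *: 'X^2 + b *: 'X + c%:P.
have -> : (fun s : R => a * s ^+ 2 + b * s + c) = horner P.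
  by apply/funext => s; rewrite !hornerE.
have -> : 2 * a * t + b = (deriv P).[t]; last exact: is_derive_poly.
by rewrite /P !poly.derivE !hornerE; ring.
Qed.

(** Subtracting the quadratic polynomial with slope [f1 0] at 0 and second derivative [Q] leaves a
    function to which the mean value bound applies twice. The constant C instead of C / 2 is good
    enough. *)
Lemma taylor_segment (f f1 f2 : R -> R) (Q C : R) :
  (forall t : R, 0 <= t <= 1 -> is_derive t (1 : R) f (f1 t)) ->
  (forall t : R, 0 <= t <= 1 -> is_derive t (1 : R) f1 (f2 t)) ->
  (forall t, 0 <= t <= 1 -> `|f2 t - Q| <= C) ->
  `|f 1 - f 0 - f1 0 - 2^-1 * Q| <= C.
Proof.
move=> df df1 f2Q.
have C0 : 0 <= C by apply: le_trans (f2Q 0 _); rewrite ?lexx ?ler01.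
pose g1 t := f1 t - (0 * t ^+ 2 + Q * t + f1 0).
have g1C t : 0 <= t <= 1 -> `|g1 t| <= C.
  move=> /andP[t0 t1]; have g10 : g1 0 = 0 by rewrite /g1; ring.
  rewrite -[g1 t]subr0 -g10 (le_trans (_ : _ <= C * t))//; last by rewrite ler_piMr.
  apply: (@mean_value_bound g1 (fun s => f2 s - (2 * 0 * s + Q))) => // s /andP[s0 st].
    by apply: is_deriveB; [apply: df1; rewrite s0 (le_trans st)|exact: is_derive_quadratic].
  by rewrite mulr0 mul0r add0r f2Q// s0 (le_trans st).
pose g t := f t - (2^-1 * Q * t ^+ 2 + f1 0 * t + 0).
have -> : f 1 - f 0 - f1 0 - 2^-1 * Q = g 1 - g 0 by rewrite /g; ring.
rewrite -[C]mulr1; apply: (@mean_value_bound g (fun s => f1 s - (2 * (2^-1 * Q) * s + f1 0))) => // s s01.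
  by apply: is_deriveB; [exact: df|exact: is_derive_quadratic].
by have := g1C s s01; rewrite /g1 mul0r add0r mulrA divff// mul1r.
Qed.

Lemma signed_mean_value (g dg : R -> R) s :
  (forall t, `|t| <= `|s| -> is_derive t (1 : R) g (dg t)) ->
  exists2 c, `|c| <= `|s| & g s - g 0 = s * dg c.
Proof.
move=> gd; have [s0|s0] := leP 0 s.
  have ab t : t \in `[0, s] -> `|t| <= `|s|.
    by rewrite in_itv /= => /andP[t0 ts]; rewrite !ger0_norm.
  have [||c cs ->] := @MVT_segment R g dg 0 s s0.
  - by move=> t ts; apply: gd; apply: ab; exact: subset_itv_oo_cc ts.
  - by apply: derivable_within_continuous => t /ab/gd[].
  - by exists c; [exact: ab|rewrite subr0 mulrC].
have ab t : t \in `[s, 0] -> `|t| <= `|s|.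
  by rewrite in_itv /= => /andP[t0 ts]; rewrite !ler0_norm ?(ltW s0)// lerN2.
have [||c cs E] := @MVT_segment R g dg s 0 (ltW s0).
- by move=> t ts; apply: gd; apply: ab; exact: subset_itv_oo_cc ts.
- by apply: derivable_within_continuous => t /ab/gd[].
- by exists c; [exact: ab|rewrite -opprB E sub0r mulrN opprK mulrC].
Qed.

Variable V : normedModType R.
Implicit Types (f : V -> R) (a v : V).

Lemma is_derive_line f a v t : derivable f (a + t *: v) v ->
  is_derive t 1 (fun s => f (a + s *: v)) ('D_v f (a + t *: v)).
Proof.
move=> fd.
have E : (fun h : R => h^-1 *: (((fun s => f (a + s *: v)) \o shift t) (h *: 1) - f (a + t *: v))) =
    (fun h => h^-1 *: ((f \o shift (a + t *: v)) (h *: v) - f (a + t *: v))).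
  by apply/funext => h /=; rewrite [h *: 1]mulr1 scalerDl addrCA.
by apply: DeriveDef; [rewrite /derivable E|rewrite /derive E].
Qed.

Lemma line_mean_value f a v s : (forall t, `|t| <= `|s| -> derivable f (a + t *: v) v) ->
  exists2 c, `|c| <= `|s| & f (a + s *: v) - f a = s * 'D_v f (a + c *: v).
Proof.
move=> fd.
have [t /fd/is_derive_line//|c cs] := @signed_mean_value (fun s => f (a + s *: v)) (fun s => 'D_v f (a + s *: v)) s.
by rewrite scale0r addr0; exists c.
Qed.

End mean_value.

(** * Functions with continuous partial derivatives *)

Section partial_derivatives.
Variables (R : realType) (m : nat).
Local Notation n := m.+1.
Implicit Types (x y a h v w : 'rV[R]_n) (f phi : 'rV[R]_n -> R).
Local Notation d i := (delta_mx 0 i : 'rV[R]_n).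

Lemma enorm_delta i : enorm (d i) = 1.
Proof.
rewrite /enorm (_ : dotv _ _ = 1) ?sqrtr1// /dotv (bigD1 i)//= !mxE !eqxx mulr1 big1 ?addr0//.
by move=> j ji; rewrite mxE (negPf ji) andbF mul0r.
Qed.

Lemma enorm_le_coord x y : (forall i, `|x 0 i| <= `|y 0 i|) -> enorm x <= enorm y.
Proof.
move=> xy; rewrite /enorm ler_sqrt ?dotvv_ge0// ler_sum// => i _.
by rewrite -!expr2 -[leLHS]real_normK ?num_real// -[leRHS]real_normK ?num_real// lerXn2r ?nnegrE.
Qed.

Lemma continuous_near_dist f x q : {for x, continuous f} -> 0 < q ->
  \forall y \near x, `|f y - f x| <= q.
Proof. by move=> /cvgrPdist_le fc /fc; apply: filterS => y; rewrite distrC. Qed.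

(** [C2_on] speaks of partial derivatives only. The increment is split along the truncations [c k]
    of [h], one coordinate at a time; all intermediate points stay in the ball because truncation
    does not increase the norm. *)
Lemma partial_increment f x r : (forall y, enorm (y - x) < r -> forall i, derivable f y (d i)) ->
  forall q, (forall y, enorm (y - x) < r -> forall i, `|partial i f y - partial i f x| <= q) ->
  forall h, enorm h < r -> `|f (x + h) - f x - dotv (gradient f x) h| <= q * n%:R * enorm h.
Proof.
move=> fd q fq h hr.
pose c k : 'rV[R]_n := \row_i (if (i < k)%N then h 0 i else 0).
have c0 : c 0%N = 0 by apply/rowP => i; rewrite !mxE.
have cn : c n = h by apply/rowP => i; rewrite !mxE ltn_ord.
have q0 : 0 <= q by apply: le_trans (fq x _ ord0); rewrite ?subrr ?enorm0 ?(le_lt_trans (enorm_ge0 h)).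
suff H k : (k <= n)%N -> `|f (x + c k) - f x - \sum_(i < n | (i < k)%N) partial i f x * h 0 i|
    <= q * k%:R * enorm h.
  have := H n (leqnn _); rewrite cn (_ : \sum_(_ < n | _) _ = dotv (gradient f x) h)//.
  by rewrite /dotv big_mkcond; apply: eq_bigr => i _; rewrite ltn_ord mxE.
elim: k => [_|k IH kn]; first by rewrite c0 addr0 subrr big1 ?subrr ?normr0 ?mulr0 ?mul0r.
pose i := Ordinal kn.
have cS : c k.+1 = c k + h 0 i *: d i.
  apply/rowP => j; rewrite !mxE /= ltnS leq_eqVlt.
  have [ji|ji] := eqVneq j i; first by rewrite ji eqxx ltnn /= mulr1 add0r.
  rewrite (_ : (val j == k) = false) ?mulr0 ?addr0//.
  by apply/negbTE; apply: contra ji => /eqP ji; apply/eqP; exact: val_inj.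
have small t : `|t| <= `|h 0 i| -> enorm (x + c k + t *: d i - x) < r.
  move=> th; rewrite addrAC (addrAC x) subrr add0r; apply: le_lt_trans hr; apply: enorm_le_coord => j.
  rewrite !mxE eqxx /=; have [->|ji] := eqVneq j i; first by rewrite ltnn add0r mulr1.
  by rewrite mulr0 addr0; case: ifP => // _; rewrite normr0.
have [|t th E] := @line_mean_value R _ f (x + c k) (d i) (h 0 i).
  by move=> t /small H; exact: fd.
have {}IH := IH (ltnW kn).
rewrite (bigD1 i)//= (_ : \sum_(_ < n | _) _ = \sum_(j < n | (j < k)%N) partial j f x * h 0 j); last first.
  apply: eq_bigl => j; rewrite ltnS leq_eqVlt.
  have [ji|ji] := eqVneq j i; first by rewrite ji ltnn andbF.
  rewrite andbT (_ : (val j == k) = false)//.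
  by apply/negbTE; apply: contra ji => /eqP ji; apply/eqP; exact: val_inj.
rewrite cS addrA.
have -> : f (x + c k + h 0 i *: d i) = h 0 i * partial i f (x + c k + t *: d i) + f (x + c k).
  by apply/eqP; rewrite -subr_eq E.
have := fq _ (small t th) i; move: IH.
have hi := norm_coord_le_enorm h i.
move: (partial i f _) (partial i f x) (f (x + c k)) (f x) (\sum_(_ < _ | _) _) => P Q A B S IH PQ.
rewrite (_ : h 0 i * P + A - B - _ = (A - B - S) + h 0 i * (P - Q)); last by ring.
rewrite -natr1 (_ : q * (k%:R + 1) * enorm h = q * k%:R * enorm h + q * enorm h); last by ring.
rewrite (le_trans (ler_normD _ _))// lerD// normrM mulrC.
by rewrite ler_pM.
Qed.

Lemma frechet_of_partials f x : (\forall y \near x, forall i, derivable f y (d i)) ->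
  (forall i, {for x, continuous (partial i f)}) -> forall q, 0 < q ->
  exists2 r, 0 < r & forall h, enorm h < r -> `|f (x + h) - f x - dotv (gradient f x) h| <= q * enorm h.
Proof.
move=> fd fc q q0; pose q' := q / n%:R.
have q'0 : 0 < q' by rewrite divr_gt0.
have fc' : \forall y \near x, forall i, `|partial i f y - partial i f x| <= q'.
  apply: (@filter_forall _ _ (fun i y => `|partial i f y - partial i f x| <= q') (nbhs x)) => i.
  exact: continuous_near_dist (fc i) q'0.
have [r r0 rf] := (nbhs_eballP _ _).1 (filterI fd fc').
exists r => // h hr; rewrite -[X in X * _](divfK (_ : n%:R != 0)) ?pnatr_eq0//.
apply: (@partial_increment f x r (fun y yx => (rf y yx).1) q' (fun y yx => (rf y yx).2)).
exact: hr.
Qed.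

Lemma is_derive_along f a h t : (\forall y \near a + t *: h, forall i, derivable f y (d i)) ->
  (forall i, {for a + t *: h, continuous (partial i f)}) ->
  is_derive t 1 (fun s => f (a + s *: h)) (dotv (gradient f (a + t *: h)) h).
Proof.
move=> fd fc; suff H : (fun s : R => s^-1 *: ((f \o shift (a + t *: h)) (s *: h) - f (a + t *: h)))
    @ 0^' --> dotv (gradient f (a + t *: h)) h.
  have D : derivable f (a + t *: h) h by apply/cvg_ex; exists (dotv (gradient f (a + t *: h)) h).
  have E : 'D_h f (a + t *: h) = dotv (gradient f (a + t *: h)) h by apply: cvg_lim H; exact: norm_hausdorff.
  by have := is_derive_line D; rewrite E.
apply/cvgrPdist_le => q q0; have hn : 0 < enorm h + 1 by rewrite ltr_wpDl ?enorm_ge0.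
have [r r0 hr] := frechet_of_partials fd fc (divr_gt0 q0 hn).
near=> s; have s0 : s != 0 by near: s; exact: nbhs_dnbhs_neq.
have sn : 0 < `|s| by rewrite normr_gt0.
have sr : enorm (s *: h) < r.
  rewrite enormZ; apply: (@le_lt_trans _ _ (`|s| * (enorm h + 1))).
    by rewrite ler_wpM2l// lerDl.
  rewrite -ltr_pdivlMr//; near: s; apply: dnbhs0_lt; exact: divr_gt0.
have /= := hr _ sr; rewrite dotvZr [a + _ + _ in X in X -> _]addrC enormZ => E.
rewrite distrC -(ler_pM2l sn) -normrM mulrBr [s^-1 *: _]/GRing.scale /= mulVKf//.
rewrite (le_trans E)// mulrCA ler_wpM2l// mulrAC ler_pdivrMr// ler_wpM2l ?(ltW q0)//.
by rewrite lerDl.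
Unshelve. all: by end_near. Qed.

End partial_derivatives.

(** * Symmetry of the Hessian and Taylor expansion *)

Section second_order.
Variables (R : realType) (m : nat).
Local Notation n := m.+1.
Implicit Types (x y a h v w : 'rV[R]_n) (f phi : 'rV[R]_n -> R).
Local Notation d i := (delta_mx 0 i : 'rV[R]_n).
Lemma hessianE f x i j : hessian f x i j = partial j (partial i f) x.
Proof. exact: mxE. Qed.

Lemma dotv_mulmx_sum v w (A : 'M[R]_n) :
  dotv (v *m A) w = \sum_i v 0 i * (\sum_j A i j * w 0 j).
Proof.
rewrite /dotv (eq_bigr (fun j => \sum_i v 0 i * (A i j * w 0 j))).
  by rewrite exchange_big; apply: eq_bigr => i _; rewrite mulr_sumr.
by move=> j _; rewrite mxE mulr_suml; apply: eq_bigr => i _; rewrite mulrA.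
Qed.

Lemma quadratic_form_dist v (A B : 'M[R]_n) q : (forall i j, `|A i j - B i j| <= q) ->
  `|dotv (v *m A) v - dotv (v *m B) v| <= q * (n%:R * n%:R) * enorm v ^+ 2.
Proof.
move=> AB; rewrite !dotv_mulmx_sum -sumrB.
apply: (@le_trans _ _ (\sum_(i < n) \sum_(j < n) q * enorm v ^+ 2)).
  apply: (le_trans (ler_norm_sum _ _ _)); apply: ler_sum => i _.
  rewrite -mulrBr -sumrB mulr_sumr.
  apply: (le_trans (ler_norm_sum _ _ _)); apply: ler_sum => j _.
  rewrite -mulrBl mulrCA normrM ler_pM// normrM expr2.
  by rewrite ler_pM ?norm_coord_le_enorm.
have nn (y : R) : y *+ n *+ n = y * (n%:R * n%:R) by rewrite mulrA !mulr_natr.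
by rewrite !sumr_const !card_ord nn mulrAC.
Qed.

Let double_quarter_lt (M : R) : 0 < M -> 2 * `|M / 4| < M.
Proof. by move=> M0; rewrite gtr0_norm ?divr_gt0//; lra. Qed.

Let swap_difference (A B C D P Q : R) : A - B - (C - D) = P -> A - C - (B - D) = Q -> P = Q.
Proof. by move=> <- <-; ring. Qed.

Let dist_le_split (A B C q : R) : `|C - A| <= q / 2 -> `|C - B| <= q / 2 -> `|A - B| <= q.
Proof.
move=> h1 h2; rewrite (splitr q) (le_trans (ler_distD C _ _))// lerD//.
by rewrite distrC.
Qed.

Variables (Omega : set 'rV[R]_n) (phi : 'rV[R]_n -> R).
Hypotheses (oO : open Omega) (C2 : C2_on Omega phi).

Let near_C2 x : Omega x -> \forall y \near x, Omega y.
Proof. by move=> Ox; exact: open_nbhs_nbhs. Qed.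

Lemma second_difference_partial x i j s : (forall y, enorm (y - x) <= 2 * `|s| -> Omega y) ->
  exists2 y, enorm (y - x) <= 2 * `|s| &
    phi (x + s *: d j + s *: d i) - phi (x + s *: d i) - (phi (x + s *: d j) - phi x) =
    s * (s * partial j (partial i phi) y).
Proof.
move=> sO.
have in1 t t' : `|t| <= `|s| -> `|t'| <= `|s| -> enorm (x + t *: d i + t' *: d j - x) <= 2 * `|s|.
  move=> ts ts'; rewrite addrAC (addrAC x) subrr add0r (le_trans (ler_enormD _ _))//.
  by rewrite !enormZ !enorm_delta !mulr1 mulr_natl mulr2n lerD.
have in0 t : `|t| <= `|s| -> Omega (x + t *: d i).
  move=> ts; apply: sO; have := @in1 t 0 ts; rewrite normr0 scale0r addr0; exact.
pose g t : R := phi (x + s *: d j + t *: d i) - phi (x + t *: d i).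
pose dg t : R := partial i phi (x + s *: d j + t *: d i) - partial i phi (x + t *: d i).
have [t ts|c cs] := @signed_mean_value R g dg s.
  apply: is_deriveB; apply: is_derive_line; [rewrite addrAC|].
    by have [_ /(_ i)[]] := C2 (sO _ (in1 t s ts (lexx _))).
  by have [_ /(_ i)[]] := C2 (in0 t ts).
have [t ts|c' cs' E] := @line_mean_value R _ (partial i phi) (x + c *: d i) (d j) s.
  by have [_ _ /(_ i j)[]] := C2 (sO _ (in1 c t cs ts)).
rewrite /g /dg scale0r !addr0 (addrAC x (s *: d j) (c *: d i)) E => ->.
by exists (x + c *: d i + c' *: d j); first exact: in1.
Qed.

(** The second difference is symmetric in the two directions and equals s^2 times either mixed
    derivative at points close to [x]; continuity concludes. Symmetry is required by
    [lambda_min_le]. *)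
Lemma hessian_sym x : Omega x -> (hessian phi x)^T = hessian phi x.
Proof.
move=> Ox; apply/matrixP => i j; rewrite !mxE; apply/eqP; rewrite -subr_eq0 -normr_le0.
apply/ler_addgt0Pl => q q0; rewrite addr0.
have q2 : 0 < q / 2 by rewrite divr_gt0.
have hc k l : exists2 r, 0 < r & forall y, enorm (y - x) < r ->
    `|partial k (partial l phi) y - partial k (partial l phi) x| <= q / 2.
  have [_ _ /(_ l k)[_ kc]] := C2 Ox.
  have [r r0 rh] := (nbhs_eballP _ _).1 (continuous_near_dist kc q2).
  exists r; [exact: r0|exact: rh].
have [r r0 rO] := open_eballP oO Ox; have [r1 r10 h1] := hc i j; have [r2 r20 h2] := hc j i.
have [s s0 /and3P[sr sr1 sr2]] : exists2 s : R, s != 0 & [&& 2 * `|s| < r, 2 * `|s| < r1 & 2 * `|s| < r2].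
  have M0 : 0 < Num.min r (Num.min r1 r2) by rewrite !lt_min r0 r10.
  exists (Num.min r (Num.min r1 r2) / 4); first by rewrite gt_eqF// divr_gt0.
  by have := double_quarter_lt M0; rewrite !lt_min.
have sO y : enorm (y - x) <= 2 * `|s| -> Omega y.
  by move=> ys; apply: rO; exact: le_lt_trans sr.
have [y ys Ey] := second_difference_partial j i sO; have [z zs Ez] := second_difference_partial i j sO.
have E : partial i (partial j phi) y = partial j (partial i phi) z.
  rewrite (addrAC x (s *: d j)) in Ez.
  by apply: (mulfI s0); apply: (mulfI s0); exact: swap_difference Ey Ez.
have := h2 z (le_lt_trans zs sr2); rewrite -E.
exact: dist_le_split (h1 y (le_lt_trans ys sr1)).
Qed.

(** The base point varies while the Hessian is frozen at [x0], because the expansion is used at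
    contact points that are only near [x0]. *)
Lemma second_order_taylor x0 eta : Omega x0 -> 0 < eta ->
  exists2 r, 0 < r & forall x h, enorm (x - x0) < r -> enorm h < r ->
    Omega (x + h) /\
    `|phi (x + h) - phi x - dotv (gradient phi x) h - 2^-1 * dotv (h *m hessian phi x0) h|
      <= eta * enorm h ^+ 2.
Proof.
move=> Ox0 eta0; pose q := eta / (n%:R * n%:R).
have nn0 : 0 < n%:R * n%:R :> R by rewrite mulr_gt0.
have q0 : 0 < q by rewrite divr_gt0.
have hc i j : \forall y \near x0, `|partial j (partial i phi) y - partial j (partial i phi) x0| <= q.
  have [_ _ /(_ i j)[_ kc]] := C2 Ox0.
  exact: (continuous_near_dist kc q0).
pose D i j y := `|partial j (partial i phi) y - partial j (partial i phi) x0| <= q.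
have hc' := @filter_forall _ _ (fun i y => forall j, D i j y) (nbhs x0) (nbhs_filter x0)
  (fun i => @filter_forall _ _ (fun j y => D i j y) (nbhs x0) (nbhs_filter x0) (hc i)).
have [r r0 rf] := (nbhs_eballP _ _).1 (filterI hc' (near_C2 Ox0)).
exists (r / 2); first by rewrite divr_gt0.
move=> x h xr hr.
have line t : 0 <= t <= 1 -> enorm (x + t *: h - x0) < r.
  move=> /andP[t0 t1]; rewrite addrAC (le_lt_trans (ler_enormD _ _))// (splitr r) ltrD//.
  by rewrite enormZ ger0_norm// (le_lt_trans _ hr)// ler_piMl// enorm_ge0.
have lO t : 0 <= t <= 1 -> Omega (x + t *: h) by move=> /line/rf[].
split; first by rewrite -[h]scale1r; apply: lO; rewrite ler01 lexx.
have d1 (t : R) : 0 <= t <= 1 ->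
    is_derive t (1 : R) (fun s => phi (x + s *: h)) (dotv (gradient phi (x + t *: h)) h).
  move=> /lO Ot; apply: is_derive_along; last by move=> i; have [_ /(_ i)[]] := C2 Ot.
  by apply: filterS (near_C2 Ot) => y Oy i; have [_ /(_ i)[]] := C2 Oy.
have d2 i (t : R) : 0 <= t <= 1 -> is_derive t (1 : R) (fun s => partial i phi (x + s *: h))
    (dotv (gradient (partial i phi) (x + t *: h)) h).
  move=> /lO Ot; apply: is_derive_along; last by move=> j; have [_ _ /(_ i j)[]] := C2 Ot.
  by apply: filterS (near_C2 Ot) => y Oy j; have [_ _ /(_ i j)[]] := C2 Oy.
have d3 (t : R) : 0 <= t <= 1 -> is_derive t (1 : R) (fun s => dotv (gradient phi (x + s *: h)) h)
    (dotv (h *m hessian phi (x + t *: h)) h).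
  move=> t01.
  have -> : (fun s => dotv (gradient phi (x + s *: h)) h) =
      \sum_(i < n) h 0 i \*: (fun s : R => partial i phi (x + s *: h)).
    by apply/funext => s; rewrite fct_sumE; apply: eq_bigr => i _; rewrite mxE mulrC.
  have -> : dotv (h *m hessian phi (x + t *: h)) h =
      \sum_i h 0 i *: dotv (gradient (partial i phi) (x + t *: h)) h.
    rewrite dotv_mulmx_sum; apply: eq_bigr => i _; congr (_ * _).
    by apply: eq_bigr => j _; rewrite !mxE.
  by apply: is_derive_sum => i; apply: is_deriveZ; exact: d2.
have := taylor_segment d1 d3 (_ : forall t, 0 <= t <= 1 ->
  `|_ - dotv (h *m hessian phi x0) h| <= eta * enorm h ^+ 2).
rewrite scale1r scale0r addr0; apply => t /line/rf[hb _].
have -> : eta = q * (n%:R * n%:R) by rewrite divfK// gt_eqF.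
apply: quadratic_form_dist => i j.
by have := hb i j; rewrite /D -!hessianE.
Qed.

End second_order.

(** * Viscosity inequalities *)

Section rayleigh.
Variables (R : realType) (m : nat).
Local Notation n := m.+1.
Implicit Types (v w nu : 'rV[R]_n) (S : 'M[R]_n).

Lemma quadratic_form_bounded S : exists2 B : R, 0 < B &
  forall v, `|dotv (v *m S) v| <= B * enorm v ^+ 2.
Proof.
pose q := \sum_i \sum_j `|S i j|.
have q0 : 0 <= q by rewrite sumr_ge0// => i _; rewrite sumr_ge0.
exists (q * (n%:R * n%:R) + 1); first by rewrite ltr_wpDl// !mulr_ge0.
move=> v; have := @quadratic_form_dist R m v S 0 q.
rewrite mulmx0 dotv0l subr0 => H; apply: (le_trans (H _)).
  move=> i j; rewrite mxE subr0 /q (bigD1 i)//= (bigD1 j)//= -addrA lerDl addr_ge0//.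
    by rewrite sumr_ge0.
  by rewrite sumr_ge0// => k _; rewrite sumr_ge0.
by rewrite ler_wpM2r ?sqr_ge0// lerDl.
Qed.

Lemma compact_enorm_closed (A : set 'rV[R]_n) M : closed A -> (forall x, A x -> enorm x <= M) -> compact A.
Proof. by move=> cA AM; apply: bounded_closed_compact => //; exact: bounded_enorm AM. Qed.

Lemma continuous_quadratic_form S : continuous (fun v => dotv (v *m S) v).
Proof. by apply: continuous_dotv; [exact: continuous_mulmx|move=> x; exact: cvg_id]. Qed.

Lemma dotv_mulmx_sym S v w : S^T = S -> dotv (v *m S) w = dotv v (w *m S).
Proof.
move=> SS; have : (v *m S) *m w^T = v *m (w *m S)^T by rewrite trmx_mul SS mulmxA.
by rewrite !mul_trmx_dotv => /matrixP/(_ 0 0); rewrite !mxE eqxx !mulr1n.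
Qed.

Let linear_term_vanishes (b c : R) : (forall t, 0 <= 2 * t * b + t ^+ 2 * c) -> 0 <= c -> b = 0.
Proof.
move=> H c0; have c1 : 0 < c + 1 by rewrite ltr_wpDl.
(* Dividing by c + 1 rather than c covers c = 0. *)
have := H (- b / (c + 1)).
rewrite (_ : _ + _ = - (b / (c + 1)) ^+ 2 * (c + 2)); last by field; rewrite gt_eqF.
rewrite mulNr oppr_ge0 pmulr_lle0 ?ltr_wpDl// => h.
have /eqP : (b / (c + 1)) ^+ 2 = 0 by apply: le_anti; rewrite h sqr_ge0.
by rewrite sqrf_eq0 mulf_eq0 invr_eq0 (gt_eqF c1) orbF => /eqP.
Qed.

(** [lambda_min] is an infimum over eigenvalues, so an eigenvalue below the quotient has to be
    produced: a minimizer of the form on the unit sphere is an eigenvector, by the first variation.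
    Its minimum also bounds all eigenvalues from below. *)
Lemma lambda_min_le S nu : S^T = S -> enorm nu = 1 -> lambda_min S <= dotv (nu *m S) nu.
Proof.
move=> SS n1; pose A : set 'rV[R]_n := [set v | enorm v = 1].
have ce : continuous (fun x : 'rV[R]_n => enorm x).
  by apply: (@continuous_enorm _ _ _ id) => x; exact: cvg_id.
have cA : compact A.
  apply: (@compact_enorm_closed _ 1); last by move=> x ->.
  exact: (closed_comp (fun x _ => ce x) (@closed_eq _ 1)).
have [v] := EVT_min_rV (ex_intro _ nu n1) cA (continuous_subspaceT (@continuous_quadratic_form S)).
rewrite inE => v1 vmin; pose l := dotv (v *m S) v.
have Sl w : l * dotv w w <= dotv (w *m S) w.
  have [->|w0] := eqVneq w 0; first by rewrite dotv0r dotv0r mulr0.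
  have nw : 0 < enorm w by rewrite enorm_gt0.
  have Aw : (enorm w)^-1 *: w \in A.
    by rewrite inE /A/= enormZ gtr0_norm ?invr_gt0// mulVf// gt_eqF.
  have := vmin _ Aw.
  rewrite -scalemxAl dotvZl dotvZr mulrA -expr2 exprVn sqr_enorm -ler_pdivrMl ?invr_gt0 -?sqr_enorm ?exprn_gt0//.
  by rewrite invrK mulrC.
have vv : dotv v v = 1 by rewrite -sqr_enorm v1 expr1n.
have critical w : dotv (v *m S) w - l * dotv v w = 0.
  apply: (@linear_term_vanishes _ (dotv (w *m S) w - l * dotv w w)); last by rewrite subr_ge0.
  move=> t; have := Sl (v + t *: w).
  rewrite mulmxDl -scalemxAl !dotvDl !dotvDr !dotvZl !dotvZr (dotv_mulmx_sym w v SS).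
  rewrite (dotvC w (v *m S)) (dotvC w v) vv -/l.
  move: (dotv (v *m S) w) (dotv v w) (dotv (w *m S) w) (dotv w w) => a b c e.
  by rewrite -subr_ge0 (_ : _ - _ = 2 * t * (a - l * b) + t ^+ 2 * (c - l * e)); last by ring.
have vS : v *m S = l *: v.
  apply/eqP; rewrite -subr_eq0 -dotvv_eq0; apply/eqP.
  by rewrite dotvDl dotvNl dotvZl critical.
apply: (@le_trans _ _ l); last first.
  by have := Sl nu; rewrite -sqr_enorm n1 expr1n mulr1.
apply: ge_inf; last first.
  by apply/eigenvalueP; exists v => //; rewrite -enorm_gt0 v1.
exists l => a /= /eigenvalueP[w wS w0]; have := Sl w; rewrite wS dotvZl ler_pM2r//.
by rewrite -sqr_enorm exprn_gt0// enorm_gt0.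
Qed.

Lemma lambda_maxN S : lambda_max S = - lambda_min (- S).
Proof.
rewrite /lambda_max /lambda_min /inf opprK; congr sup; apply/seteqP; split => a /=.
  move=> /eigenvalueP[v vS v0]; exists (- a); last by rewrite opprK.
  by apply/eigenvalueP; exists v => //; rewrite mulmxN vS scaleNr.
move=> [b /eigenvalueP[v vS v0] <-]; apply/eigenvalueP; exists v => //.
by rewrite scaleNr -vS mulmxN opprK.
Qed.

End rayleigh.

(** * Tug values of quadratic polynomials *)

Section quadratic_tug.
Variables (R : realType) (m : nat).
Local Notation n := m.+1.
Implicit Types (x y h g nu mu : 'rV[R]_n) (p v : 'rV[R]_n -> R) (e : R) (S : 'M[R]_n).

(** The value of [alpha] matters here: for a = (P - 1) / (P + N) one has (1 - a) / (N + 1) = 1 / (P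
    + N), so the coefficients of [q] add up to (P - 2) / (P + N). The first-order term [b] cancels
    against that of the opposite direction. *)
Let diffusion_arith (P N q T eta e : R) : 1 < P -> 0 < N -> 0 < e -> forall b,
  let a := (P - 1) / (P + N) in
  a * (b + 2^-1 * (e ^+ 2 * q)) + (1 - a) * (2^-1 * (e ^+ 2 / (N + 1) * (T - q))) - eta * e ^+ 2 +
  (a * (- b + 2^-1 * (e ^+ 2 * q)) + (1 - a) * (2^-1 * (e ^+ 2 / (N + 1) * (T - q))) - eta * e ^+ 2) <=
    eta * e ^+ 2 ->
  (P - 2) * q + T <= 3 * eta * (P + N).
Proof.
move=> P1 N0 e0 b; cbv zeta.
have PN : 0 < P + N by lra.
rewrite [leLHS](_ : _ = e ^+ 2 * (((P - 2) * q + T) / (P + N) - 2 * eta)); last first.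
  by field; rewrite !gt_eqF//; lra.
rewrite [leRHS]mulrC ler_pM2l ?exprn_gt0// lerBlDr ler_pdivrMr//.
by rewrite (_ : eta + _ = 3 * eta); last by ring.
Qed.

Let drift_arith (a N q q' T B eta e b b' : R) : 0 <= a <= 1 -> 0 < N -> 0 <= eta ->
  `|q| <= B -> `|q'| <= B ->
  a * (b + 2^-1 * (e ^+ 2 * q)) + (1 - a) * (2^-1 * (e ^+ 2 / (N + 1) * (T - q))) - eta * e ^+ 2 +
  (a * (b' + 2^-1 * (e ^+ 2 * q')) + (1 - a) * (2^-1 * (e ^+ 2 / (N + 1) * (T - q'))) - eta * e ^+ 2) <=
    eta * e ^+ 2 ->
  a * (b + b') <= (3 * eta + 2 * B + `|T|) * e ^+ 2.
Proof.
move=> /andP[a0 a1] N0 eta0 qB qB' H.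
have N1 : 0 < N + 1 by lra.
pose c := (1 - a) / (N + 1).
have c0 : 0 <= c by rewrite divr_ge0 ?subr_ge0// ltW.
have c1 : c <= 1 by rewrite /c ler_pdivrMr// mul1r; lra.
pose r := 3 * eta - 2^-1 * (a - c) * (q + q') - c * T.
have Hr : a * (b + b') <= r * e ^+ 2.
  move: H; rewrite -subr_ge0 => H; rewrite -subr_ge0; apply: (le_trans H).
  by rewrite le_eqVlt; apply/orP; left; apply/eqP; rewrite /r /c; field; rewrite gt_eqF.
apply: (le_trans Hr); rewrite ler_wpM2r ?sqr_ge0//.
have h1 : `|2^-1 * (a - c) * (q + q')| <= 2 * B.
  rewrite normrM (_ : 2 * B = 1 * (2 * B)); last by ring.
  apply: ler_pM => //.
    by rewrite ler_norml; apply/andP; split; lra.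
  by rewrite (le_trans (ler_normD _ _))//; lra.
have h2 : `|c * T| <= `|T| by rewrite normrM ger0_norm// ler_piMl.
move: h1 h2; rewrite !ler_norml => /andP[h _] /andP[h' _]; rewrite /r; lra.
Qed.

Lemma tug_quadratic p e x nu c g S : 0 < e -> enorm nu = e ->
  tug_value p e (fun y => c + (dotv g (y - x) + 2^-1 * dotv ((y - x) *m S) (y - x))) x nu =
  c + (alpha p x * (dotv g nu + 2^-1 * dotv (nu *m S) nu) +
    (1 - alpha p x) * (2^-1 * (e ^+ 2 / m.+2%:R * (\tr S - dotv (nu *m S) nu / e ^+ 2)))).
Proof.
move=> e0 en; have nu0 := direction_neq0 e0 en.
have cg : continuous (fun h : 'rV[R]_n => dotv g h).
  by apply: continuous_dotv => z; [exact: cst_continuous|exact: cvg_id].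
have cg' := continuous_hyperplane_point (nu := nu) cg.
have cS' := continuous_hyperplane_point (nu := nu) (@continuous_quadratic_form R m S).
have cS2 := continuousT_mull (c := 2^-1) cS'.
have xK h : x + h - x = h by rewrite addrAC subrr add0r.
rewrite tug_valueE// xK (_ : (fun h => _) = (fun h => c + (dotv g h + 2^-1 * dotv (h *m S) h))); last first.
  by apply/funext => h; rewrite xK.
rewrite {1}/hmean avgD; [|exact: cst_continuous|exact: (continuousT_add cg' cS2)].
rewrite avg_cst// avgD// avgZ// (avg_odd _ cg'); last by move=> s; rewrite mulNmx dotvNr.
have := hmean_quadratic S e0 nu0; rewrite /hmean => ->.
by rewrite -sqr_enorm en; ring.
Qed.

Lemma contact_direction p e x g S v eta B : 0 < e -> continuous v -> 1 < p x -> 0 < eta ->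
  (forall w, `|dotv (w *m S) w| <= B * enorm w ^+ 2) ->
  v x = midrange p e v x ->
  (forall h, enorm h <= e ->
    v x + dotv g h + 2^-1 * dotv (h *m S) h - eta * e ^+ 2 <= v (x + h)) ->
  exists nu, [/\ enorm nu = 1,
    (p x - 2) * dotv (nu *m S) nu + \tr S <= 3 * eta * (p x + n%:R) &
    alpha p x * (dotv g nu + enorm g) <= (3 * eta + 2 * B + `|\tr S|) * e].
Proof.
move=> e0 cv p1 eta0 SB vE vlow.
have pn : 0 < p x + n%:R by rewrite addr_gt0// (lt_trans ltr01).
have a01 : 0 <= alpha p x <= 1.
  rewrite /alpha divr_ge0 ?subr_ge0 ?(ltW p1) ?(ltW pn)//= ler_pdivrMr// mul1r lerD2l.
  by rewrite (le_trans (_ : -1 <= 0)) ?oppr_le0.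
pose q w := dotv (w *m S) w.
pose Q w : R := alpha p x * (dotv g w + 2^-1 * (e ^+ 2 * q (e^-1 *: w))) +
  (1 - alpha p x) * (2^-1 * (e ^+ 2 / (n%:R + 1) * (\tr S - q (e^-1 *: w)))) - eta * e ^+ 2.
have qZ w : q w = e ^+ 2 * q (e^-1 *: w).
  rewrite /q -scalemxAl dotvZl dotvZr mulrA mulrA expr2 -(mulrA e e) divff ?mulr1 ?gt_eqF//.
  by rewrite divff ?mul1r// gt_eqF.
pose P y : R := v x - eta * e ^+ 2 + (dotv g (y - x) + 2^-1 * dotv ((y - x) *m S) (y - x)).
have ct : continuous (fun y : 'rV[R]_n => y - x).
  by apply: (@lipschitz_continuous_rV _ _ _ _ 1) => y z; rewrite opprB addrA subrK mul1r.
have cP : continuous P.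
  apply: continuousT_add; first exact: cst_continuous.
  apply: continuousT_add; first by apply: continuous_dotv => // z; exact: cst_continuous.
  apply: continuousT_mull; exact: (continuousT_comp ct (@continuous_quadratic_form R m S)).
have low w : enorm w = e -> v x + Q w <= tug_value p e v x w.
  move=> ew; apply: (@le_trans _ _ (tug_value p e P x w)); last first.
    apply: tug_le => // h he; apply: le_trans (vlow h he).
    by rewrite /P addrAC [x + h]addrC addrK addrA addrAC [leLHS]addrAC -!addrA lerD2l; lra.
  rewrite tug_quadratic// -/(q w) qZ /Q natr1.
  have -> : e ^+ 2 * q (e^-1 *: w) / e ^+ 2 = q (e^-1 *: w).
    by rewrite mulrC mulKf// expf_neq0// gt_eqF.
  by rewrite addrA [leRHS]addrAC.
have e2 : 0 < eta * e ^+ 2 by rewrite mulr_gt0// exprn_gt0.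
have [nu en hnu] := midrange_near_inf e0 cv a01 e2.
have HQ w : enorm w = e -> Q nu + Q w <= eta * e ^+ 2.
  move=> ew; have := hnu w ew; have := low _ en; have := low _ ew; rewrite -vE.
  by move: (Q nu) (Q w) (tug_value _ _ _ _ nu) (tug_value _ _ _ _ w) => A C D E; lra.
exists (e^-1 *: nu); split.
- by rewrite enormZ gtr0_norm ?invr_gt0// en mulVf// gt_eqF.
- have := HQ (- nu); rewrite enormN => /(_ en).
  rewrite /Q dotvNr scalerN /q mulNmx dotvNl dotvNr opprK -/(q _).
  exact: (diffusion_arith p1 (ltr0Sn R m) e0).
have qB w : enorm w = e -> `|q (e^-1 *: w)| <= B.
  move=> ew; apply: (le_trans (SB _)).
  by rewrite enormZ gtr0_norm ?invr_gt0// ew mulVf ?gt_eqF// expr1n mulr1.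
have [mu em gm] : exists2 mu, enorm mu = e & dotv g mu = e * enorm g.
  have [g0|g0] := eqVneq g 0.
    have [mu em] := @exists_enorm R m e (ltW e0); exists mu => //.
    by rewrite g0 dotv0l enorm0 mulr0.
  have gn : enorm g != 0 by rewrite gt_eqF// enorm_gt0.
  exists ((e / enorm g) *: g).
    by rewrite enormZ ger0_norm ?divr_ge0 ?enorm_ge0 ?(ltW e0)// divfK.
  by rewrite dotvZr -sqr_enorm expr2 mulrA divfK.
have /= := drift_arith a01 (ltr0Sn R m) (ltW eta0) (qB _ en) (qB _ em) (HQ _ em).
rewrite gm => H; rewrite dotvZr -(ler_pM2r e0) -[leRHS]mulrA -expr2; apply: le_trans H.
rewrite -[leLHS]mulrA le_eqVlt; apply/orP; left; apply/eqP; congr (_ * _).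
by rewrite mulrDl mulrAC mulVf ?mul1r ?gt_eqF// [e * _]mulrC.
Qed.

End quadratic_tug.

Section contact_arithmetic.
Variable R : realType.

Lemma drift_limit (a a0 b b0 N0 N1 c d eta : R) : 0 < a0 -> a0 <= a -> 0 < eta ->
  a * (b + N1) <= c -> c <= a0 * (eta / 2) -> N0 - N1 <= d -> b0 - b <= d -> d <= eta / 4 ->
  b0 <= - N0 + eta.
Proof.
move=> a00 aa eta0 h1 h2 h3 h4 h5.
suff : b + N1 <= eta / 2 by lra.
rewrite leNgt; apply/negP => h; have a_0 : 0 < a by exact: lt_le_trans aa.
have : a0 * (eta / 2) < a * (b + N1).
  rewrite (@le_lt_trans _ _ (a * (eta / 2)))// ?ltr_pM2l// ler_wpM2r//; lra.
by rewrite ltNge (le_trans h1 h2).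
Qed.

Lemma diffusion_limit (P P' q T B N ka eta : R) : 0 < B -> 0 < P + 1 + N -> 0 < eta ->
  ka = eta / (6 * (P + 1 + N)) -> `|q| <= B -> `|P' - P| <= 1 -> `|P' - P| <= eta / (2 * B) ->
  (P' - 2) * q + T <= 3 * ka * (P' + N) -> (P - 2) * q + T <= eta.
Proof.
move=> B0 P0 eta0 kaE qB P1 PB h.
have ka0 : 0 < ka by rewrite kaE divr_gt0// mulr_gt0.
have h1 : 3 * ka * (P' + N) <= eta / 2.
  apply: (@le_trans _ _ (3 * ka * (P + 1 + N))).
    rewrite ler_wpM2l ?mulr_ge0 ?(ltW ka0)//.
    by move: P1; rewrite ler_norml => /andP[_ ?]; lra.
  by rewrite kaE le_eqVlt; apply/orP; left; apply/eqP; field; rewrite gt_eqF.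
have h2 : `|(P' - P) * q| <= eta / 2.
  rewrite normrM (_ : eta / 2 = eta / (2 * B) * B); last by field; rewrite gt_eqF.
  exact: ler_pM.
move: h2; rewrite ler_norml => /andP[h2 _].
have -> : (P - 2) * q + T = ((P' - 2) * q + T) - (P' - P) * q by ring.
by move: (le_trans h h1) h2; move: ((P' - 2) * q + T) ((P' - P) * q) => x y; lra.
Qed.

End contact_arithmetic.

(** * Contact points of the approximating solutions *)

Section contact.
Variables (R : realType) (m : nat).
Local Notation n := m.+1.
Implicit Types (x y h g nu mu : 'rV[R]_n) (e : R) (S : 'M[R]_n).
Variables (Omega : set 'rV[R]_n) (p F : 'rV[R]_n -> R) (a0 : R).
Hypotheses (O0 : Omega !=set0) (oO : open Omega) (bO : bounded_set Omega) (a00 : 0 < a0).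
Hypothesis pa : forall x, Omega x -> a0 <= alpha p x.
Hypothesis p1 : forall x, Omega x -> 1 < p x.
Variables (u phi : 'rV[R]_n -> R) (e : nat -> R) (w : nat -> 'rV[R]_n -> R).
Hypothesis cu : forall x, Omega x -> {for x, continuous u}.
Hypothesis cphi : forall x, Omega x -> {for x, continuous phi}.
Hypothesis e01 : forall k, 0 < e k < 1.
Hypothesis e_to0 : e @ \oo --> (0 : R).
Hypothesis dw : forall k, dpp_representative Omega p F (e k) (w k).
Hypothesis wu : forall d, 0 < d -> \forall k \near \oo, forall x, Omega x -> `|w k x - u x| <= d.
Variable x0 : 'rV[R]_n.
Hypotheses (Ox0 : Omega x0) (ux0 : u x0 = phi x0).
Hypothesis touch : forall y, Omega y -> y != x0 -> phi y < u y.

(** On the annulus between rho / 2 and rho, u - phi has a positive minimum c. Once w k is within c /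
    3 of u, w k - phi is at least 2 c / 3 there and at most c / 3 at x0, so its minimum over the
    ball is reached inside rho / 2. *)
Lemma contact_point rho : 0 < rho -> (forall y, enorm (y - x0) <= rho -> Omega y) ->
  \forall k \near \oo, exists2 x, enorm (x - x0) < rho / 2 &
    forall h, enorm h <= rho / 2 -> w k x - phi x <= w k (x + h) - phi (x + h).
Proof.
move=> rho0 rO; pose K : set 'rV[R]_n := [set y | enorm (y - x0) <= rho].
pose A : set 'rV[R]_n := K `&` [set y | rho / 2 <= enorm (y - x0)].
have cd : continuous (fun y : 'rV[R]_n => enorm (y - x0)).
  apply: continuous_enorm; apply: (@lipschitz_continuous_rV _ _ _ _ 1) => y z.
  by rewrite opprB addrA subrK mul1r.
have clK : closed K by exact: (closed_comp (fun x _ => cd x) (@closed_le _ rho)).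
have KM x : K x -> enorm x <= rho + enorm x0.
  by move=> Kx; rewrite -[x in enorm x](subrK x0) (le_trans (ler_enormD _ _))// lerD2r.
have cK : compact K by exact: compact_enorm_closed KM.
have cA : compact A.
  apply: (@compact_enorm_closed R m A (rho + enorm x0)); last by move=> x [/KM].
  by apply: closedI => //; exact: (closed_comp (fun x _ => cd x) (@closed_ge _ (rho / 2))).
have wi (B : set 'rV[R]_n) (f : 'rV[R]_n -> R) : B `<=` K ->
    (forall x, Omega x -> {for x, continuous f}) -> {within B, continuous f}.
  by move=> BK cf; apply: continuous_in_subspaceT => x; rewrite inE => /BK/rO/cf.
have [z ez] := @exists_enorm R m rho (ltW rho0).
have A0 : A !=set0.
  exists (x0 + z); rewrite /A/K /= addrAC subrr add0r ez lexx; split => //.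
  by rewrite ler_pdivrMr// ler_peMr ?ler1n// ltW.
have [y Ay ymin] := EVT_min_rV A0 cA (wi A (fun x => u x - phi x) (@subIsetl _ _ _)
   (fun x Ox => continuousB (cu Ox) (cphi Ox))).
have {}Ay : A y by rewrite inE in Ay.
pose c := u y - phi y; have c0 : 0 < c.
  rewrite subr_gt0; apply: touch; first by apply: rO; exact: Ay.1.
  apply/negP => /eqP yx; have := Ay.2; rewrite /= yx subrr enorm0.
  by rewrite leNgt divr_gt0.
have c3 : 0 < c / 3 by rewrite divr_gt0.
apply: filterS (wu c3) => k wk; have [cw _ _] := dw k.
have K0 : K !=set0 by exists x0; rewrite /K/= subrr enorm0 ltW.
have [x Kx xmin] := EVT_min_rV K0 cK (wi K (fun x => w k x - phi x) (fun _ => id)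
   (fun x Ox => continuousB (cw x) (cphi Ox))).
have {}Kx : K x by rewrite inE in Kx.
have xr : enorm (x - x0) < rho / 2.
  rewrite ltNge; apply/negP => xr; have Ax : A x by split.
  have := ymin x; rewrite inE => /(_ Ax); have := xmin x0; rewrite inE => /(_ _).
  have Kx0 : K x0 by rewrite /K/= subrr enorm0 ltW.
  move=> /(_ Kx0); have := wk _ Ox0; have := wk _ (rO _ Kx); rewrite ux0 -/c.
  move: c3; rewrite !ler_norml; move: (w k x) (w k x0) (phi x) (phi x0) (u x) (c) => a b d f g c'.
  by move=> ? /andP[? ?] /andP[? ?] ? ?; lra.
exists x => // h hr; apply: xmin; rewrite inE /K/= addrAC (splitr rho).
by rewrite (le_trans (ler_enormD _ _))// lerD// ltW.
Qed.

Variables (G : 'rV[R]_n -> 'rV[R]_n) (S : 'M[R]_n).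
Hypothesis cp : {for x0, continuous p}.
Hypothesis cG : forall q, 0 < q -> exists2 r, 0 < r &
  forall x, enorm (x - x0) < r -> enorm (G x - G x0) <= q.
Hypothesis taylor : forall eta, 0 < eta -> exists2 r, 0 < r &
  forall x h, enorm (x - x0) < r -> enorm h < r ->
    phi x + dotv (G x) h + 2^-1 * dotv (h *m S) h - eta * enorm h ^+ 2 <= phi (x + h).

(** [G] and [S] are abstract so that both phi and -phi can be treated. For a given [eta] one
    sufficiently large index is enough; no limit of directions is taken. The choice e k < r / 4
    keeps the steps where the expansion holds and makes the cutoff vanish at the contact point. *)
Lemma contact_limit eta : 0 < eta -> exists nu, [/\ enorm nu = 1,
  (p x0 - 2) * dotv (nu *m S) nu + \tr S <= eta & dotv (G x0) nu <= - enorm (G x0) + eta].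
Proof.
move=> eta0; have [B B0 SB] := quadratic_form_bounded S.
have P0 : 0 < p x0 + 1 + n%:R by rewrite addr_gt0// addr_gt0// (lt_trans ltr01)// p1.
pose ka := eta / (6 * (p x0 + 1 + n%:R)); have ka0 : 0 < ka by rewrite divr_gt0// mulr_gt0.
pose pd := Num.min 1 (eta / (2 * B)).
have pd0 : 0 < pd by rewrite lt_min ltr01 divr_gt0// mulr_gt0.
have [r1 r10 h1] := (nbhs_eballP _ _).1 (continuous_near_dist cp pd0).
have [r2 r20 h2] := cG (divr_gt0 eta0 (ltr0n R 4)).
have [r3 r30 h3] := taylor ka0.
have [r4 r40 h4] := open_eballP oO Ox0.
pose r := Num.min (Num.min r1 r2) (Num.min r3 r4).
have r0 : 0 < r by rewrite !lt_min r10 r20 r30.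
have rho0 : 0 < r / 2 by rewrite divr_gt0.
have rO y : enorm (y - x0) <= r / 2 -> Omega y.
  move=> yr; apply: h4; apply: (le_lt_trans yr); rewrite (@lt_le_trans _ _ r)//.
    by rewrite ltr_pdivrMr// ltr_pMr// ltr1n.
  by rewrite /r !ge_min lexx !orbT.
pose C := 3 * ka + 2 * B + `|\tr S|.
have C0 : 0 < C by rewrite ltr_wpDr// addr_gt0// mulr_gt0.
pose ee := Num.min (r / 4) (a0 * (eta / 2) / C).
have ee0 : 0 < ee by rewrite lt_min !divr_gt0// mulr_gt0// divr_gt0.
have esmall : \forall k \near \oo, e k < ee.
  have /cvgrPdist_lt /(_ _ ee0) := e_to0; apply: filterS => k.
  by rewrite sub0r normrN; apply: le_lt_trans; exact: ler_norm.
have [k [[x xr xmin] ek]] := filter_ex (filterI (contact_point rho0 rO) esmall).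
have /andP[ek0 ek1] := e01 k; have [cw wE _] := dw k.
have {}xr : enorm (x - x0) < r / 4 by rewrite (lt_le_trans xr)// -mulrA -invfM -natrM.
have r4r : r / 4 < r by rewrite ltr_pdivrMr// ltr_pMr// ltr1n.
have [xr1 xr2 xr3] : [/\ enorm (x - x0) < r1, enorm (x - x0) < r2 & enorm (x - x0) < r3].
  by have := lt_trans xr r4r; rewrite /r !lt_min => /andP[/andP[-> ->] /andP[-> _]].
have Ox : Omega x.
  by apply: rO; rewrite (le_trans (ltW xr))// ler_pM2l// lef_pV2 ?posrE// ler_nat.
have [ekr ekC] : e k < r / 4 /\ e k < a0 * (eta / 2) / C.
  by move: ek; rewrite /ee lt_min => /andP.
have c0 : cutoff Omega (e k) x = 0.
  apply: (cutoff_far O0 oO bO ek0 (ltW ekr)) => y yx.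
  apply: rO; apply: ltW; rewrite (le_lt_trans (ler_enorm_dist _ x _))//.
  by rewrite (_ : r / 2 = r / 4 + r / 4) ?ltrD//; field.
have wE' : w k x = midrange p (e k) (w k) x by rewrite {1}wE// c0 subr0 mul1r mul0r addr0.
have low h : enorm h <= e k ->
    w k x + dotv (G x) h + 2^-1 * dotv (h *m S) h - ka * e k ^+ 2 <= w k (x + h).
  move=> he; have hr : enorm h < r / 4 by exact: le_lt_trans ekr.
  have hr3 : enorm h < r3.
    by have := lt_trans hr r4r; rewrite /r !lt_min => /andP[_ /andP[-> _]].
  have hm : enorm h <= r / 2 / 2 by rewrite (le_trans (ltW hr))// -mulrA -invfM -natrM.
  have := h3 x h xr3 hr3; have := xmin h hm.
  have : ka * enorm h ^+ 2 <= ka * e k ^+ 2.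
    by rewrite ler_pM2l// lerXn2r ?nnegrE ?enorm_ge0// ltW.
  move: (ka * _ ^+ 2) (ka * _ ^+ 2) (w k x) (w k _) (phi x) (phi _) (dotv _ _) (2^-1 * _).
  by move=> *; lra.
have [nu [nu1 hd hs]] := contact_direction ek0 cw (p1 Ox) ka0 SB wE' low.
exists nu; split => //.
  have := h1 x xr1; rewrite /= /pd le_min => /andP[pd1 pd2].
  apply: (diffusion_limit B0 P0 eta0 (erefl ka) _ pd1 pd2 hd).
  by rewrite (le_trans (SB nu))// nu1 expr1n mulr1.
have d2 := h2 x xr2.
apply: (drift_limit a00 (pa Ox) eta0 hs _ _ _ d2).
- by rewrite -/C mulrC -ler_pdivlMr// ltW.
- rewrite enormB in d2 *; rewrite lerBlDr -[G x0 in leLHS](subrK (G x)).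
  by rewrite (le_trans (ler_enormD _ _)).
- rewrite -dotvNl -dotvDl (le_trans (dotv_le _ _))// nu1 mulr1.
  by rewrite enormB.
Qed.

End contact.

(** * From near-optimal directions to the viscosity inequalities *)

Section viscosity.
Variables (R : realType) (m : nat).
Local Notation n := m.+1.
Implicit Types (x y h g nu mu : 'rV[R]_n) (S X : 'M[R]_n) (p F phi : 'rV[R]_n -> R).

Let unit_distance (N d r : R) : 0 < N -> 0 < r -> d + N <= r ^+ 2 * N / 4 ->
  1 ^+ 2 + N^-1 * d + (N^-1 * d + N^-1 * (N^-1 * N ^+ 2)) < r ^+ 2.
Proof.
move=> N0 r0 dN; have r2 : 0 < r ^+ 2 by rewrite exprn_gt0.
have -> : 1 ^+ 2 + N^-1 * d + (N^-1 * d + N^-1 * (N^-1 * N ^+ 2)) = 2 * (d + N) / N.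
  by field; rewrite gt_eqF.
rewrite ltr_pdivrMr//; have : 0 < r ^+ 2 * N by rewrite mulr_gt0.
by move: (r ^+ 2 * N) dN => x; lra.
Qed.

Lemma FpE p x h X : Fp p x h X = (p x - 2) * (dotv (h *m X) h / enorm h ^+ 2) + \tr X.
Proof.
rewrite /Fp (_ : \sum_i _ = dotv (h *m X) h / enorm h ^+ 2); first by ring.
rewrite dotv_mulmx_sum mulr_suml; apply: eq_bigr => i _.
rewrite mulr_sumr mulr_suml; apply: eq_bigr => j _; ring.
Qed.

Lemma FpN p x h X : Fp p x (- h) (- X) = - Fp p x h X.
Proof.
rewrite !FpE enormN mulNmx mulmxN opprK dotvNr raddfN /=.
by rewrite mulNr mulrN -opprD.
Qed.

(** For a zero gradient, any unit direction bounds the smallest eigenvalue. Otherwise <g, nu> <=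
    -|g| + eta forces [nu] close to -g / |g|, where the quadratic form is continuous and, being
    even, has its value at g / |g|. *)
Lemma viscosity_super_of_directions p x g X : X^T = X ->
  (forall eta, 0 < eta -> exists nu, [/\ enorm nu = 1,
     (p x - 2) * dotv (nu *m X) nu + \tr X <= eta & dotv g nu <= - enorm g + eta]) ->
  if g == 0 then lambda_min ((p x - 2) *: X) + \tr X <= 0 else Fp p x g X <= 0.
Proof.
move=> XX H; case: eqVneq => [g0|g0].
  apply/ler_addgt0Pl => eta eta0; rewrite addr0; have [nu [nu1 h _]] := H eta eta0.
  apply: le_trans h; rewrite lerD2r.
  have XX' : ((p x - 2) *: X)^T = (p x - 2) *: X by rewrite linearZ /= XX.
  by apply: (le_trans (lambda_min_le XX' nu1)); rewrite -scalemxAr dotvZl.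
have gn : 0 < enorm g by rewrite enorm_gt0.
pose w := - (enorm g)^-1 *: g.
pose psi (v : 'rV[R]_n) : R := (p x - 2) * dotv (v *m X) v + \tr X.
have cpsi : continuous psi.
  apply: continuousT_add; last exact: cst_continuous.
  exact: (continuousT_mull (c := p x - 2) (@continuous_quadratic_form R m X)).
have psiw : Fp p x g X = psi w.
  rewrite FpE /psi /w -scalemxAl dotvZl dotvZr; congr (_ * _ + _).
  by rewrite mulrA mulrNN -expr2 exprVn mulrC.
apply/ler_addgt0Pl => q q0; rewrite addr0.
have q2 : 0 < q / 2 by rewrite divr_gt0.
have [r r0 hr] := (nbhs_eballP _ _).1 (continuous_near_dist (cpsi w) q2).
(* The second entry yields |nu - w|^2 = 2 (<g, nu> + |g|) / |g| < r^2. *)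
have eta0 : 0 < Num.min (q / 2) (r ^+ 2 * enorm g / 4).
  by rewrite lt_min q2 divr_gt0// mulr_gt0// exprn_gt0.
have [nu [nu1]] := H _ eta0; rewrite -lerBlDl opprK !le_min => /andP[h1 _] /andP[_ h2].
have nw : enorm (nu - w) < r.
  have gE : enorm g != 0 by rewrite gt_eqF.
  rewrite enorm_lt_sqr ?(ltW r0)// /w dotvDl !dotvDr scaleNr opprK !dotvZl !dotvZr !(dotvC nu) dotvC.
  rewrite -[dotv nu nu]sqr_enorm nu1 -[dotv g g]sqr_enorm (dotvC nu).
  exact: unit_distance gn r0 h2.
have := hr nu nw; rewrite /= ler_norml => /andP[h3 _].
rewrite psiw -/(psi nu) in h1 *; rewrite (splitr q); lra.
Qed.

Variables (Omega : set 'rV[R]_n) (phi : 'rV[R]_n -> R).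
Hypotheses (oO : open Omega) (C2 : C2_on Omega phi).

Lemma gradient_continuous x0 q : Omega x0 -> 0 < q -> exists2 r, 0 < r &
  forall x, enorm (x - x0) < r -> enorm (gradient phi x - gradient phi x0) <= q.
Proof.
move=> Ox0 q0; have q1 : 0 < q / n%:R by rewrite divr_gt0.
have cp i := continuous_near_dist ((let: And3 _ H _ := C2 Ox0 in H) i).2 q1.
have := @filter_forall _ _ (fun i y => `|partial i phi y - partial i phi x0| <= q / n%:R) (nbhs x0) (nbhs_filter x0) cp.
move=> /nbhs_eballP[r r0 rh]; exists r => // x xr.
apply: (le_trans (enorm_le_sum _)); apply: (@le_trans _ _ (\sum_(i < n) q / n%:R)).
  by apply: ler_sum => i _; have := rh x xr i; rewrite !mxE.
by rewrite sumr_const card_ord -[leLHS]mulr_natr divfK// pnatr_eq0.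
Qed.

Variables (p F u : 'rV[R]_n -> R) (a0 : R) (e : nat -> R) (w : nat -> 'rV[R]_n -> R).
Hypotheses (O0 : Omega !=set0) (bO : bounded_set Omega) (a00 : 0 < a0).
Hypothesis pa : forall x, Omega x -> a0 <= alpha p x.
Hypothesis p1 : forall x, Omega x -> 1 < p x.
Hypothesis cp : forall x, Omega x -> {for x, continuous p}.
Hypothesis cu : forall x, Omega x -> {for x, continuous u}.
Hypothesis e01 : forall k, 0 < e k < 1.
Hypothesis e_to0 : e @ \oo --> (0 : R).
Hypothesis dw : forall k, dpp_representative Omega p F (e k) (w k).
Hypothesis wu : forall d, 0 < d -> \forall k \near \oo, forall x, Omega x -> `|w k x - u x| <= d.
Variable x0 : 'rV[R]_n.
Hypotheses (Ox0 : Omega x0) (ux0 : u x0 = phi x0).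

Let cphi x : Omega x -> {for x, continuous phi}.
Proof. by move=> /C2[]. Qed.

Lemma super_at_contact : (forall y, Omega y -> y != x0 -> phi y < u y) ->
  if gradient phi x0 == 0 then lambda_min ((p x0 - 2) *: hessian phi x0) + \tr (hessian phi x0) <= 0
  else Fp p x0 (gradient phi x0) (hessian phi x0) <= 0.
Proof.
move=> touch; apply: viscosity_super_of_directions; first exact: hessian_sym oO C2 _ Ox0.
apply: (contact_limit O0 oO bO a00 pa p1 cu cphi e01 e_to0 dw wu Ox0 ux0 touch (cp Ox0)).
  by move=> q q0; exact: gradient_continuous.
move=> eta eta0; have [r r0 hr] := second_order_taylor oO C2 Ox0 eta0.
exists r => // x h xr hh; have [_] := hr x h xr hh.
move: (phi (x + h)) (phi x) (dotv _ h) (dotv _ h) (eta * _) => a b c d f.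
by rewrite ler_norml => /andP[? _]; lra.
Qed.

(** The lower contact argument is applied to -u and -phi; [FpN] and [lambda_maxN] translate the
    conclusion back. *)
Lemma sub_at_contact : (forall y, Omega y -> y != x0 -> u y < phi y) ->
  if gradient phi x0 == 0 then 0 <= lambda_max ((p x0 - 2) *: hessian phi x0) + \tr (hessian phi x0)
  else 0 <= Fp p x0 (gradient phi x0) (hessian phi x0).
Proof.
move=> touch.
have XX : (- hessian phi x0)^T = - hessian phi x0 by rewrite linearN /= (hessian_sym oO C2 Ox0).
suff /(viscosity_super_of_directions XX) : forall eta, 0 < eta -> exists nu, [/\ enorm nu = 1,
     (p x0 - 2) * dotv (nu *m - hessian phi x0) nu + \tr (- hessian phi x0) <= eta &
     dotv (- gradient phi x0) nu <= - enorm (- gradient phi x0) + eta].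
  rewrite oppr_eq0 FpN oppr_le0 scalerN raddfN /= lambda_maxN.
  by case: ifP => // _; rewrite -opprB oppr_le0 opprK addrC.
have wu' d : 0 < d -> \forall k \near \oo, forall x, Omega x -> `|- w k x - - u x| <= d.
  by move=> /wu; apply: filterS => k h x Ox; rewrite -opprD normrN h.
apply: (contact_limit (phi := fun x => - phi x) (G := fun x => - gradient phi x) O0 oO bO a00 pa p1
  (fun x Ox => continuousN (cu Ox)) (fun x Ox => continuousN (cphi Ox)) e01 e_to0
  (fun k => dpp_representative_opp (proj1 (andP (e01 k))) (dw k)) wu' Ox0 _ _ (cp Ox0)).
- by rewrite ux0.
- by move=> y Oy yx; rewrite ltrN2 touch.
- move=> q q0; have [r r0 hr] := gradient_continuous Ox0 q0; exists r => // x xr.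
  by rewrite -opprD enormN hr.
move=> eta eta0; have [r r0 hr] := second_order_taylor oO C2 Ox0 eta0.
exists r => // x h xr hh; have [_] := hr x h xr hh.
rewrite mulmxN !dotvNl.
move: (phi (x + h)) (phi x) (dotv _ h) (dotv _ h) (eta * _) => a b c d f.
by rewrite ler_norml => /andP[_ ?]; lra.
Qed.

End viscosity.

(** * Bounds on the tug probability *)

Section alpha_bounds.
Variables (R : realType) (n : nat).
Implicit Types (x z : 'rV[R]_n) (p : 'rV[R]_n -> R).

(** The difference quotient of [alpha] in p is (1 + n) / ((p x + n) (p z + n)), which is at most 1
    when both exponents exceed 1; so [alpha] inherits the modulus of continuity of [p]. *)
Lemma alphaB_le p x z : 1 < p x -> 1 < p z -> `|alpha p x - alpha p z| <= `|p x - p z|.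
Proof.
rewrite /alpha; move: (p x) (p z) => a b a1 b1; have N0 : (0 : R) <= n%:R by [].
move: (n%:R : R) N0 => N N0; have aN : 1 <= a + N by lra.
have bN : 1 + N <= b + N by lra.
have -> : (a - 1) / (a + N) - (b - 1) / (b + N) = (a - b) * ((1 + N) / ((a + N) * (b + N))).
  by field; rewrite !gt_eqF//; lra.
rewrite normrM ler_piMr// ger0_norm; last by rewrite divr_ge0 ?mulr_ge0//; lra.
by rewrite ler_pdivrMr ?mulr_gt0 ?mul1r//; [rewrite (le_trans bN)// ler_peMl//; lra|lra|lra].
Qed.

(** (p - 1) / (p + n) increases with p, so [a0] is its value at the infimum of [p], which is finite
    because [Omega] is nonempty. *)
Lemma alpha_lower p (Omega : set 'rV[R]_n) : Omega !=set0 ->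
  (1 < ereal_inf [set (p x)%:E | x in Omega])%E ->
  exists2 a0 : R, 0 < a0 <= 1 & forall x, Omega x -> 1 < p x /\ a0 <= alpha p x <= 1.
Proof.
move=> [x0 Ox0]; set I := ereal_inf _ => I1.
have Ile x : Omega x -> (I <= (p x)%:E)%E by move=> Ox; apply: ereal_inf_lbound; exists x.
have [r IE] : exists r, I = r%:E.
  move: I1 (Ile _ Ox0); case: I {Ile} => [r _ _|//|//]; by exists r.
move: I1 Ile; rewrite IE lte_fin => r1 Ile; have N0 : (0 : R) <= n%:R by [].
have rN : 0 < r + n%:R by lra.
exists ((r - 1) / (r + n%:R)).
  by rewrite divr_gt0 ?subr_gt0//= ler_pdivrMr// mul1r; lra.
move=> x /Ile; rewrite lee_fin => rp; have p1 : 1 < p x by lra.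
have pN : 0 < p x + n%:R by lra.
split=> //; rewrite /alpha; have h : (r - 1) * (p x + n%:R) <= (p x - 1) * (r + n%:R) by nra.
apply/andP; split; last by rewrite ler_pdivrMr// mul1r; lra.
by rewrite ler_pdivrMr// mulrAC ler_pdivlMr.
Qed.

End alpha_bounds.

Theorem theorem6p2 (R : realType) (n : nat) (Omega : set 'rV[R]_n)
    (p F : 'rV[R]_n -> R) (ueps : R -> 'rV[R]_n -> R) :
  (2 <= n)%N ->
  domain Omega -> bounded_set Omega -> boundary_regular Omega ->
  {within closure Omega, continuous p} ->
  (1 < ereal_inf [set (p x)%:E | x in Omega])%E ->
  (ereal_sup [set (p x)%:E | x in Omega] < +oo)%E ->
  {within strip Omega 1, continuous F} ->
  (forall eps : R, 0 < eps < 1 -> dpp_solution Omega p F eps (ueps eps)) ->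
  exists (u : 'rV[R]_n -> R) (e : nat -> R),
    [/\ forall i, 0 < e i < 1,
        e @ \oo --> (0 : R),
        {uniform closure Omega, (fun i => ueps (e i)) @ \oo --> u},
        viscosity_solution Omega p u &
        forall x, boundary Omega x -> u x = F x].

Proof.
case: n Omega p F ueps => [|[|m]]// Omega p F ueps _ [ O0 oO _] bO rO cp p1 _ cF du.
have [a0 /andP[a00 a01] hp] := alpha_lower O0 p1.
have {}p1 x : Omega x -> 1 < p x by move=> /hp[].
have pa x : Omega x -> a0 <= alpha p x <= 1 by move=> /hp[].
have cA := compact_closure_domain bO.
have pu q : 0 < q -> exists2 r, 0 < r &
    forall x z, Omega x -> Omega z -> enorm (x - z) < r -> `|alpha p x - alpha p z| < q.
  move=> q0; have [r r0 hr] := uniform_on_compact cA cp q0; exists r => // x z Ox Oz xz.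
  rewrite (le_lt_trans (alphaB_le (p1 _ Ox) (p1 _ Oz)))//.
  by apply: hr => //; exact: subset_closure.
have cpO x : Omega x -> {for x, continuous p}.
  have := continuous_subspaceW (@subset_closure _ Omega) cp.
  by rewrite continuous_open_subspace// => + Ox; apply; rewrite inE.
(* Representatives are chosen for all [e] at once; outside the interval (0, 1) the value [ueps e] is
   a dummy. *)
have rep e : exists v, 0 < e < 1 -> dpp_representative Omega p F e v /\
    forall x, closure (Defs.extended Omega e) x -> v x = ueps e x.
  have [e01|ne] := boolP (0 < e < 1); last by exists (ueps e).
  have [v [cv vE vO vF]] := dpp_extension O0 oO bO e01 (du e e01).
  by exists v => _; split.
have [V hV] := choice rep.
have clX e x : closure Omega x -> closure (Defs.extended Omega e) x by exact: closure_sub_extended.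
have [M M0 FM] := bounded_on_compact (compact_strip O0 oO bO) cF.
have uM e x : 0 < e < 1 -> closure Omega x -> `|ueps e x| <= M.
  move=> e01 /(clX e) Xx; have [dV <-//] := hV e e01; have [e0 _] := andP e01.
  rewrite ler_norml lerNl; apply/andP; split.
    apply: (dpp_le_max O0 oO bO a00 a01 pa e01 (dpp_representative_opp e0 dV)) => // y sy.
    by rewrite (le_trans _ (FM y sy))// -normrN ler_norm.
  apply: (dpp_le_max O0 oO bO a00 a01 pa e01 dV) => // y sy.
  by rewrite (le_trans _ (FM y sy))// ler_norm.
have ec eta : 0 < eta -> exists r eps : R, [/\ 0 < r, 0 < eps <= 1 &
    forall e x z, 0 < e < eps -> closure Omega x -> closure Omega z -> enorm (x - z) < r ->
      `|ueps e x - ueps e z| <= eta].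
  move=> eta0.
  have [r [eps [r0 /andP[eps0 eps1] h]]] := asymptotic_equicontinuity O0 oO bO a00 a01 pa pu rO cF eta0.
  exists r, eps; rewrite eps0; split=> // e x z ee /(clX e) Xx /(clX e) Xz xz.
  have e01 : 0 < e < 1 by have /andP[-> he] := ee; rewrite (lt_le_trans he).
  by have [dV E] := hV e e01; rewrite -(E x Xx) -(E z Xz); exact: (h e _ x z ee dV Xx Xz xz).
have [u [e [e01 e0 cvg_u near_u um]]] := asymptotic_arzela_ascoli cA uM ec.
have cu x : Omega x -> {for x, continuous u}.
  move=> Ox; apply: (iffRL (@cvgrPdist_le _ _ _ (nbhs x) (nbhs_filter x) u (u x))) => d d0.
  have [r r0 hr] := um d d0.
  apply/nbhs_eballP; have [s s0 hs] := open_eballP oO Ox.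
  exists (Num.min r s); first by rewrite lt_min r0.
  move=> y; rewrite /eball /= lt_min => /andP[yr /hs Oy].
  by apply: hr; [exact: subset_closure|exact: subset_closure|rewrite enormB].
have wu d : 0 < d -> \forall k \near \oo, forall x, Omega x -> `|V (e k) x - u x| <= d.
  move=> /near_u; apply: filterS => k h x Ox; have Cx := subset_closure Ox.
  by have [_ ->] := hV _ (e01 k); [exact: h|exact: clX].
have dw k := (hV _ (e01 k)).1.
have pa' x : Omega x -> a0 <= alpha p x by move=> /pa/andP[].
exists u, e; split => //.
- split.
  + by rewrite continuous_open_subspace// => x; rewrite inE => /cu.
  + move=> x phi Ox C2 ux; exact: (super_at_contact oO C2 O0 bO a00 pa' p1 cpO cu e01 e0 dw wu Ox ux).
  + move=> x phi Ox C2 ux; exact: (sub_at_contact oO C2 O0 bO a00 pa' p1 cpO cu e01 e0 dw wu Ox ux).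
(* Each approximating function equals [F] exactly on the boundary, so its uniform limit does as
   well. *)
move=> x /(boundaryP _ oO)[Cx nOx]; apply/eqP; rewrite -subr_eq0 -normr_le0.
apply/ler_addgt0Pl => d d0; rewrite addr0.
have [k hk] := filter_ex (near_u d d0); have := hk x Cx.
have [[_ _ vF] E] := hV _ (e01 k); have Xx := clX (e k) x Cx.
by rewrite -E// vF// distrC.
Qed.
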